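(* Let $k$ be a field of characteristic zero and let $d,e\ge1$ be integers with $(d,e)\ne(1,1)$. Then the moduli space $\mathrm{Dyn}_{d,e}$ of dynamical systems of correspondences of degree $(d,e)$ on $\mathbb{P}^1$ is a rational variety over $k$ (i.e. birational over $k$ to a projective space).
   Context: $V_{d,e}$ denotes the $k$-vector space of forms $f=\sum_{0\le i\le d,\,0\le j\le e}a_{ij}x_0^{d-i}x_1^{i}y_0^{e-j}y_1^{j}$, and $\mathrm{Corr}_{d,e}:=\mathbb{P}(V_{d,e})$ is the space of lines in $V_{d,e}$, parameterizing the closed subschemes $V(f)\subset\mathbb{P}^1\times\mathbb{P}^1$ (divisorial correspondences of degree $(d,e)$). The group $\mathrm{PGL}_2=\mathrm{Aut}(\mathbb{P}^1)$ acts on $\mathrm{Corr}_{d,e}$ by conjugation, i.e. via its diagonal action on $\mathbb{P}^1\times\mathbb{P}^1$; the pulled-back action of $\mathrm{SL}_2$ comes from the linear action on $V_{d,e}$ by simultaneous substitution of the same linear change of variables in $(x_0,x_1)$ and $(y_0,y_1)$, and this gives an $\mathrm{SL}_2$-linearization of $\mathcal{O}(1)$. The moduli space is the GIT quotient $\mathrm{Dyn}_{d,e}:=\mathrm{Corr}_{d,e}^{ss}/\!/\mathrm{PGL}_2=\mathrm{Corr}_{d,e}^{ss}/\!/\mathrm{SL}_2=\mathrm{Proj}\bigoplus_{n\ge0}H^0(\mathrm{Corr}_{d,e},\mathcal{O}(n))^{\mathrm{SL}_2}$, where $\mathrm{Corr}_{d,e}^{ss}$ is the semistable locus. *)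

(* Defs.v *)
From HB Require Import structures.
From mathcomp Require Import all_boot all_order all_algebra.
From mathcomp Require Import mpoly.
From mathcomp Require Import classical_sets.

Set Implicit Arguments.
Unset Strict Implicit.
Unset Printing Implicit Defensive.

Import GRing.Theory.
Local Open Scope ring_scope.
Local Open Scope classical_set_scope.

(* Ringed spaces over k whose structure sheaf is a sheaf of functions with
   values in one fixed commutative ring.  A section over U is represented by a
   function on the whole space of which only the values on U matter, so equality
   of sections over U means equality at all points of U (eq_over below). *)
Record fspace (k : fieldType) := FSpace {
  point :> Type;
  is_open : set (set point);
  value : comNzRingType;
  const : {rmorphism k -> value};
  is_section : set point -> set (point -> value)
}.

Section Birational.

Variables (k : fieldType) (X Y : fspace k).

Definition eq_over (Z : fspace k) (W : set Z) (s t : Z -> value Z) : Prop :=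
  forall z, W z -> s z = t z.

Definition homeo_on (U : set X) (V : set Y) (f : X -> Y) (g : Y -> X) : Prop :=
  [/\ forall x, U x -> V (f x) /\ g (f x) = x,
      forall y, V y -> U (g y) /\ f (g y) = y,
      forall W, is_open W -> W `<=` V -> is_open (U `&` f @^-1` W)
    & forall W, is_open W -> W `<=` U -> is_open (V `&` g @^-1` W)].

(* phi W : O_Y(W) -> O_X(U `&` f @^-1` W), for W an open subset of V, is an
   isomorphism of sheaves of k-algebras O_V -> f_* O_U. *)
Definition sheaf_iso_on (U : set X) (V : set Y) (f : X -> Y)
    (phi : set Y -> (Y -> value Y) -> (X -> value X)) : Prop :=
  forall W, is_open W -> W `<=` V ->
  let W' := U `&` f @^-1` W in
  [/\ (forall s, is_section W s -> is_section W' (phi W s)),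
      (forall s t, is_section W s -> is_section W t ->
         eq_over W s t <-> eq_over W' (phi W s) (phi W t)),
      (forall t, is_section W' t ->
         exists2 s, is_section W s & eq_over W' (phi W s) t),
      [/\ forall s t, is_section W s -> is_section W t ->
            eq_over W' (phi W (fun y => s y + t y))
                       (fun x => phi W s x + phi W t x),
          forall s t, is_section W s -> is_section W t ->
            eq_over W' (phi W (fun y => s y * t y))
                       (fun x => phi W s x * phi W t x)
        & forall c, eq_over W' (phi W (fun=> const Y c)) (fun=> const X c)]
    & (forall W1 s, is_open W1 -> W1 `<=` W -> is_section W s ->
         eq_over (U `&` f @^-1` W1) (phi W1 s) (phi W s))].

(* Meant for integral schemes, where nonempty open subsets are dense.  The local
   rings need no separate condition: an isomorphism of ringed spaces between
   locally ringed spaces is automatically local. *)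
Definition birational : Prop :=
  exists (U : set X) (V : set Y),
  [/\ is_open U, is_open V, U !=set0, V !=set0
    & exists f g phi, homeo_on U V f g /\ sheaf_iso_on U V f phi].

End Birational.

(* A graded k-subalgebra S of the polynomial ring k[z_0, ..., z_(N-1)] with its
   standard grading, given by its homogeneous pieces S_n. *)
Record graded_subalg (k : fieldType) (N : nat) := GradedSubalg {
  piece :> nat -> set {mpoly k[N]};
  piece_homog : forall n F, piece n F -> F \is n.-homog;
  piece_lin : forall n c F G, piece n F -> piece n G -> piece n (c *: F + G);
  piece0 : forall n, piece n 0;
  piece1 : piece 0%N 1;
  pieceM : forall m n F G, piece m F -> piece n G -> piece (m + n)%N (F * G)
}.

Section Proj.

Variables (k : fieldType) (N : nat) (S : graded_subalg k N).

Definition total_ring : set {mpoly k[N]} :=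
  [set F | forall n, S n (pihomog mdeg n F)].

Definition irrelevant : set {mpoly k[N]} :=
  [set F | total_ring F /\ pihomog mdeg 0 F = 0].

Record hprime := HPrime {
  ideal :> set {mpoly k[N]};
  ideal_sub : ideal `<=` total_ring;
  ideal0 : ideal 0;
  idealD : forall F G, ideal F -> ideal G -> ideal (F + G);
  idealM : forall F G, total_ring F -> ideal G -> ideal (F * G);
  ideal_homog : forall n F, ideal F -> ideal (pihomog mdeg n F);
  ideal_proper : ~ ideal 1;
  ideal_prime : forall F G, total_ring F -> total_ring G ->
    ideal (F * G) -> ideal F \/ ideal G;
  ideal_relevant : ~ irrelevant `<=` ideal
}.

(* The complements of the closed sets V(E), E a set of homogeneous elements. *)
Definition zariski_open : set (set hprime) :=
  [set U | exists2 E : set {mpoly k[N]},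
     E `<=` [set F | exists n, S n F]
     & U = [set p : hprime | ~ E `<=` ideal p]].

(* Locally, s is a fraction a / b of elements of S of the same degree.  Since S
   is a domain, all the local rings S_(p) are subrings of one fraction field. *)
Definition regular (U : set hprime) : set (hprime -> {fraction {mpoly k[N]}}) :=
  [set s | forall p, U p ->
     exists W : set hprime, [/\ zariski_open W, W p, W `<=` U
     & exists n a b, [/\ S n a, S n b
       & forall q : hprime, W q ->
           ~ ideal q b /\ s q = FracField.tofrac a / FracField.tofrac b]]].

Definition scalar_frac : {rmorphism k -> {fraction {mpoly k[N]}}} :=
  @FracField.tofrac {mpoly k[N]} \o @mpolyC N k.

Definition Proj : fspace k := FSpace zariski_open scalar_frac regular.

End Proj.

Section ProjectiveSpace.

Variables (k : fieldType) (n : nat).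

Definition all_forms (m : nat) : set {mpoly k[n.+1]} :=
  [set F | F \is m.-homog].

Lemma all_forms_homog m F : all_forms m F -> F \is m.-homog.
Proof. by []. Qed.

Lemma all_forms_lin m c F G :
  all_forms m F -> all_forms m G -> all_forms m (c *: F + G).
Proof. by move=> hF hG; apply: rpredD => //; apply: rpredZ. Qed.

Lemma all_forms0 m : all_forms m 0.
Proof. exact: rpred0. Qed.

Lemma all_forms1 : all_forms 0 1.
Proof. exact: dhomog1. Qed.

Lemma all_formsM m m' F G :
  all_forms m F -> all_forms m' G -> all_forms (m + m') (F * G).
Proof. exact: dhomogM. Qed.

Definition projective_space : fspace k :=
  Proj (GradedSubalg all_forms_homog all_forms_lin all_forms0 all_forms1
                     all_formsM).

End ProjectiveSpace.

Definition rational (k : fieldType) (X : fspace k) : Prop :=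
  exists n, birational X (projective_space k n).

(* The four variables of index 0, 1, 2, 3 are x_0, x_1, y_0, y_1. *)
Definition xdeg (m : 'X_{1..4}) : nat := (m 0%R + m 1%R)%N.

Definition ydeg (m : 'X_{1..4}) : nat := (m 2%R + m 3%R)%N.

Fact xdeg0 : xdeg 0%MM = 0%N.
Proof. by rewrite /xdeg !mnmE. Qed.
Fact xdegD : {morph xdeg : a b / (a + b)%MM >-> (a+b)%N}.
Proof. by move=> a b; rewrite /xdeg !mnmE addnACA. Qed.

Fact ydeg0 : ydeg 0%MM = 0%N.
Proof. by rewrite /ydeg !mnmE. Qed.

Fact ydegD : {morph ydeg : a b / (a + b)%MM >-> (a+b)%N}.
Proof. by move=> a b; rewrite /ydeg !mnmE addnACA. Qed.

HB.instance Definition _ := isMeasure.Build 4 xdeg xdeg0 xdegD.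
HB.instance Definition _ := isMeasure.Build 4 ydeg ydeg0 ydegD.

Section BihomogeneousForms.

Variables (A : comNzRingType) (d e : nat).

Definition bimon (i : 'I_d.+1) (j : 'I_e.+1) : 'X_{1..4} :=
  [multinom of [:: (d - i)%N; val i; (e - j)%N; val j]].

Definition biform (a : 'M[A]_(d.+1, e.+1)) : {mpoly A[4]} :=
  \sum_i \sum_j a i j *: 'X_[bimon i j].

Definition diag_subst (g : 'M[A]_2) : 4.-tuple {mpoly A[4]} :=
  [tuple g 0 0 *: 'X_0 + g 0 1 *: 'X_1;
         g 1 0 *: 'X_0 + g 1 1 *: 'X_1;
         g 0 0 *: 'X_2 + g 0 1 *: 'X_3;
         g 1 0 *: 'X_2 + g 1 1 *: 'X_3].

Definition act (g : 'M[A]_2) (a : 'M[A]_(d.+1, e.+1)) : 'M[A]_(d.+1, e.+1) :=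
  \matrix_(i, j) (biform a \mPo diag_subst g)@_(bimon i j).

Lemma biform_coefs (p : {mpoly A[4]}) : p \is d.-homog for xdeg ->
  p \is e.-homog for ydeg ->
  biform (\matrix_(i < d.+1, j < e.+1) p@_(bimon i j)) = p.
Proof.
move=> /dhomogP hx /dhomogP hy; apply/mpolyP => m; rewrite /biform.
rewrite raddf_sum /=; under eq_bigr do rewrite raddf_sum /=.
under eq_bigr do under eq_bigr do rewrite mcoeffZ mcoeffX mxE.
have bE (i : 'I_d.+1) (j : 'I_e.+1) : (bimon i j == m) =
    [&& m 0%R == (d - i)%N, m 1%R == i, m 2%R == (e - j)%N & m 3%R == j] :> bool.
  apply/eqP/and4P => [<-|[/eqP h0 /eqP h1 /eqP h2 /eqP h3]].
    by rewrite /bimon /fun_of_multinom !(tnth_nth 0%N) /= !eqxx.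
  apply/mnmP => l; rewrite /bimon {1}/fun_of_multinom (tnth_nth 0%N) /=.
  case: l => [[|[|[|[|//]]]]] /= hl.
  - by rewrite -h0; congr (m _); apply: val_inj.
  - by rewrite -h1; congr (m _); apply: val_inj.
  - by rewrite -h2; congr (m _); apply: val_inj.
  - by rewrite -h3; congr (m _); apply: val_inj.
have [mp|mp] := boolP (m \in msupp p); last first.
  rewrite (memN_msupp_eq0 mp) big1 // => i _; rewrite big1 // => j _.
  case: eqP => [E|]; last by rewrite mulr0.
  by rewrite E (memN_msupp_eq0 mp) mul0r.
have := hx _ mp; have := hy _ mp; rewrite /= /xdeg /ydeg => ey ex.
have l1 : (m 1%R < d.+1)%N by rewrite ltnS -ex leq_addl.
have l3 : (m 3%R < e.+1)%N by rewrite ltnS -ey leq_addl.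
have b0 : bimon (Ordinal l1) (Ordinal l3) = m.
  by apply/eqP; rewrite bE /= -ex -ey !addnK !eqxx.
rewrite (bigD1 (Ordinal l1)) //= (bigD1 (Ordinal l3)) //= b0 eqxx mulr1.
rewrite big1 ?addr0 ?big1 ?addr0 // => [i ni|j nj].
  rewrite big1 // => j _; rewrite bE; case: (m 1%R =P i) => [E|]; last by rewrite andbF mulr0.
  by case/eqP: ni; apply: val_inj.
rewrite bE; case: (m 3%R =P j) => [E|]; last by rewrite !andbF mulr0.
by case/eqP: nj; apply: val_inj.
Qed.

(* act only reads off the coefficients of the bidegree (d, e) monomials; this
   loses nothing, since the substituted form is again of bidegree (d, e). *)
Lemma biform_act (g : 'M[A]_2) (a : 'M[A]_(d.+1, e.+1)) :
  biform (act g a) = biform a \mPo diag_subst g.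
Proof.
have tr (n m : nat) (mf : measure 4) (q : {mpoly A[4]}) :
  n = m -> q \is m.-homog for mf -> q \is n.-homog for mf by move->.
suff H : (biform a \mPo diag_subst g \is d.-homog for xdeg) /\
  (biform a \mPo diag_subst g \is e.-homog for ydeg) by apply: biform_coefs; case: H.
have X m n : (('X_[n] : {mpoly A[4]}) \is m.-homog for xdeg) = (xdeg n == m) by rewrite dhomogX.
have Y m n : (('X_[n] : {mpoly A[4]}) \is m.-homog for ydeg) = (ydeg n == m) by rewrite dhomogX.
rewrite /biform !raddf_sum /=; split; apply: rpred_sum => i _; rewrite raddf_sum /=; apply: rpred_sum => j _;
 rewrite comp_mpolyZ; apply: rpredZ; rewrite comp_mpolyX /bimon;
 rewrite !big_ord_recl big_ord0 mulr1 /fun_of_multinom !(tnth_nth 0%N) !(tnth_nth 0) /=.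
- have E : (d = (1*(d - i) + (1*i + (0*(e - j) + 0*j))))%N by rewrite !mul1n !mul0n !addn0 subnK // -ltnS.
  apply: (tr _ _ _ _ E).
  apply: dhomogM; last (apply: dhomogM; last apply: dhomogM);
    apply: dhomogMn; apply: rpredD; apply: rpredZ; by rewrite X /xdeg !mnmE.
- have E : (e = (0*(d - i) + (0*i + (1*(e - j) + 1*j))))%N by rewrite !mul1n !mul0n !add0n subnK // -ltnS.
  apply: (tr _ _ _ _ E).
  apply: dhomogM; last (apply: dhomogM; last apply: dhomogM);
    apply: dhomogMn; apply: rpredD; apply: rpredZ; by rewrite Y /ydeg !mnmE.
Qed.

End BihomogeneousForms.

Section Dyn.

Variables (k : fieldType) (d e : nat).

(* A polynomial function on V_(d,e); its variable of index mxvec_index i j is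
   the coordinate a_ij. *)
Definition coord_poly := {mpoly k[d.+1 * e.+1]}.

Definition eval_form (A : comAlgType k) (F : coord_poly)
    (a : 'M[A]_(d.+1, e.+1)) : A :=
  mmap (in_alg A) (fun l => mxvec a 0 l) F.

(* Invariance under the group scheme SL_2, on points in all k-algebras. *)
Definition SL2_invariant (F : coord_poly) : Prop :=
  forall (A : comAlgType k) (g : 'M[A]_2) (a : 'M[A]_(d.+1, e.+1)),
    \det g = 1 -> eval_form F (act g a) = eval_form F a.

(* H^0(Corr_(d,e), O(n)) is the space of degree n forms on V_(d,e). *)
Definition invariant_forms (n : nat) : set coord_poly :=
  [set F : coord_poly | F \is n.-homog /\ SL2_invariant F].

Lemma invariant_forms_homog n F : invariant_forms n F -> F \is n.-homog.
Proof. by case. Qed.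

Lemma invariant_forms_lin n c F G :
  invariant_forms n F -> invariant_forms n G -> invariant_forms n (c *: F + G).
Proof.
move=> [hF iF] [hG iG]; split; first by apply: rpredD => //; apply: rpredZ.
move=> A g a dg; rewrite /eval_form.
by rewrite !mmapD !mmapZ; congr (_ * _ + _); [exact: iF | exact: iG].
Qed.

Lemma invariant_forms0 n : invariant_forms n 0.
Proof. by split=> [|A g a dg]; [exact: rpred0 | rewrite /eval_form !mmap0]. Qed.

Lemma invariant_forms1 : invariant_forms 0 1.
Proof. by split=> [|A g a dg]; [exact: dhomog1 | rewrite /eval_form !rmorph1]. Qed.

Lemma invariant_formsM m n F G :
  invariant_forms m F -> invariant_forms n G -> invariant_forms (m + n) (F * G).
Proof.
move=> [hF iF] [hG iG]; split; first exact: dhomogM.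
move=> A g a dg; rewrite /eval_form !rmorphM /=.
by congr (_ * _); [exact: iF | exact: iG].
Qed.

Definition Dyn : fspace k :=
  Proj (GradedSubalg invariant_forms_homog invariant_forms_lin invariant_forms0
                     invariant_forms1 invariant_formsM).

End Dyn.

(* Main.v *)
(* Put n = d + e.  A form f of bidegree (d, e) has two SL_2-covariants, its
   restriction P to the diagonal, of degree n, and the restriction R of
   (d^2/dx_0 dy_1 - d^2/dx_1 dy_0) f, of degree n - 2.  The transvectant of
   order n of P and R (x_0 z_1 - x_1 z_0)^2 is a covariant binary quadratic form
   q in z.  Moving the two roots of q to 0 and oo, which requires a square root s
   of disc q, reduces SL_2 to the normalizer of its torus: the torus scales the
   entry of index (i, j) of the coefficient matrix with weight n - 2 (i + j), and
   the exchange of the roots is the conjugation s -> - s.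

   In the normalized form set one or two entries to 1 with the torus, and write
   each pair of entries exchanged by the conjugation as w + sigma w' and
   w - sigma w', where sigma is the imaginary part of one chosen entry.  The w, the
   w' and sigma^2 are independent coordinates of the quotient.  They are rational
   functions of f by means of explicit invariants:
   multiply an entry of the normalized form by a power of another entry to reach
   torus weight 0, pair the result with a power of q, and split the value into its
   components in 1 and s.  Conversely an invariant is determined by its
   restriction to the slice of normalized forms, since the generic form, over a
   quadratic extension, is equivalent to a point of the slice. *)
Require Import Defs.
From HB Require Import structures.
From mathcomp Require Import all_boot all_order all_algebra.
From mathcomp Require Import mpoly.
From mathcomp Require Import boolp classical_sets.
From mathcomp Require Import ring zify.

Set Implicit Arguments.
Unset Strict Implicit.
Unset Printing Implicit Defensive.

Import GRing.Theory.
Local Open Scope ring_scope.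

(** * Rationality of Proj from a chart *)

(** The pair P, R is chosen because the corner entries a_00 and a_de enter only P, as its extreme
    coefficients. The coefficients of q are bilinear in P and R; the two outer ones contain one
    corner each, linearly, and the middle one none. So the condition that the roots of q be 0 and oo
    is solved rationally for the corners, and two such forms that agree off the corners agree. The
    square root of disc q is adjoined formally, and the extension is handled as a ring with a
    conjugation: nonvanishing is replaced by invertibility, which is tested through the norm on the
    slice. GL_2 acts on an invariant of degree D through the power n D / 2 of the determinant, and
    the matrix exchanging the roots has a determinant known only with a sign. Degrees divisible by 4
    remove both the parity and the sign; this explains the fourth powers in the denominator of the
    chart and in the injectivity argument. The passage to Proj compares one chart on each side: both
    are embedded in a common field, where their degree 0 rings turn out to be the same subring. *)

Section HomogeneousComponents.

Variables (k : fieldType) (N : nat) (S : graded_subalg k N).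
Implicit Types F G : {mpoly k[N]}.

Lemma pieceD n F G : S n F -> S n G -> S n (F + G).
Proof. by move=> hF hG; rewrite -[F]scale1r; apply: piece_lin. Qed.

Lemma pieceZ n c F : S n F -> S n (c *: F).
Proof. by move=> hF; rewrite -[_ *: _]addr0; apply: piece_lin (@piece0 _ _ S n). Qed.

Lemma pieceX n j F : S n F -> S (n * j)%N (F ^+ j).
Proof.
move=> hF; elim: j => [|j IH]; first by rewrite muln0 expr0; apply: piece1.
by rewrite exprS mulnS; apply: pieceM.
Qed.

Lemma pihomog_piece n m F : S n F ->
  pihomog mdeg m F = if n == m then F else 0.
Proof.
move=> /piece_homog hF; case: eqP => [<-|/eqP nm]; first exact: pihomog_dE.
exact: pihomog_ne0 nm hF.
Qed.

Lemma piece_total n F : S n F -> total_ring S F.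
Proof.
by move=> hF m; rewrite (pihomog_piece _ hF); case: eqP => [<-|_] //; apply: piece0.
Qed.

(** Every large bound is allowed, so that two factors can be cut at the same one and a bound can be
    raised later. *)
Lemma homog_decomp F : exists K, forall K', (K <= K')%N ->
  F = \sum_(d < K') pihomog mdeg d F.
Proof.
by exists (mmeasure mdeg F) => K' h; apply: pihomog_partitionE.
Qed.

Lemma pihomogM_pieces F G i : total_ring S F -> total_ring S G ->
  exists K, forall K', (K <= K')%N -> pihomog mdeg i (F * G) =
    \sum_(j < K') \sum_(l < K' | (j + l == i)%N)
        pihomog mdeg j F * pihomog mdeg l G.
Proof.
move=> tF tG; have [K1 h1] := homog_decomp F; have [K2 h2] := homog_decomp G.
exists (maxn K1 K2) => K'; rewrite geq_max => /andP[l1 l2].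
rewrite {1}(h1 _ l1) {1}(h2 _ l2).
rewrite mulr_suml raddf_sum; apply: eq_bigr => j _.
rewrite mulr_sumr raddf_sum [RHS]big_mkcond; apply: eq_bigr => l _ /=.
by rewrite (pihomog_piece _ (pieceM (tF j) (tG l))).
Qed.

Lemma hprime_eq (p q : hprime S) : (forall F, ideal p F <-> ideal q F) -> p = q.
Proof.
case: p q => [p p1 p2 p3 p4 p5 p6 p7 p8] [q q1 q2 q3 q4 q5 q6 q7 q8] /= h.
have E : p = q by apply/funext => F; apply/propext; exact: h.
by case: _ / E in q1 q2 q3 q4 q5 q6 q7 q8 h *; congr HPrime; apply: Prop_irrelevance.
Qed.

Variable p : hprime S.

Lemma hprimeM n m F G : S n F -> S m G -> ideal p (F * G) <-> ideal p F \/ ideal p G.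
Proof.
move=> /piece_total hF /piece_total hG; split; first exact: ideal_prime.
by case=> [h|h]; [rewrite mulrC|]; apply: idealM.
Qed.

Lemma hprimeX n j F : (0 < j)%N -> S n F -> ideal p (F ^+ j) <-> ideal p F.
Proof.
case: j => // j _ hF; elim: j => [|j IH]; first by rewrite expr1.
rewrite exprS; split => [|h]; last by apply/(hprimeM hF (pieceX j.+1 hF)); left.
by move/(hprimeM hF (pieceX j.+1 hF)) => [//|/IH].
Qed.

Lemma hprime_components F : total_ring S F ->
  ideal p F <-> forall i, ideal p (pihomog mdeg i F).
Proof.
move=> tF; split => [h i|h]; first exact: ideal_homog.
have [K /(_ _ (leqnn K)) ->] := homog_decomp F.
by elim/big_ind: _ => //; [exact: ideal0 | exact: idealD].
Qed.

End HomogeneousComponents.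

(* The chart D_+(b) of Proj S, together with an embedding of the degree 0 part
   of S[1/b] into the field Omega. *)
Record chart (k : fieldType) (N : nat) (S : graded_subalg k N) (Omega : fieldType) :=
  Chart {
    emb : {rmorphism {mpoly k[N]} -> Omega};
    cdeg : nat;
    cden : {mpoly k[N]};
    cdeg_gt0 : (0 < cdeg)%N;
    cden_piece : S cdeg cden;
    cden_neq0 : cden != 0;
    emb_inj : forall n F, S n F -> emb F = 0 -> F = 0
  }.

Section ChartTheory.

Variables (k : fieldType) (N : nat) (S : graded_subalg k N) (Omega : fieldType).
Variable ch : chart S Omega.

Local Notation rho := (emb ch).
Local Notation bb := (cdeg ch).
Local Notation b := (cden ch).
Implicit Types (F G : {mpoly k[N]}) (p : hprime S) (P : set Omega).

Definition chart_ring : set Omega :=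
  [set x | exists j F, S (bb * j)%N F /\ x = rho F / rho b ^+ j]%classic.

(** Primes of the chart ring are kept as subsets of [Omega], so that two charts with the same ring
    have literally the same primes. *)
Definition chart_prime P : Prop :=
  [/\ (P `<=` chart_ring)%classic, P 0 /\ ~ P 1,
      forall x y, P x -> P y -> P (x + y),
      forall x y, chart_ring x -> P y -> P (x * y)
    & forall x y, chart_ring x -> chart_ring y -> P (x * y) -> P x \/ P y].

Lemma emb_den_neq0 : rho b != 0.
Proof.
by apply/eqP => /(emb_inj (cden_piece ch)) /eqP; rewrite (negPf (cden_neq0 ch)).
Qed.

Lemma emb_denX_neq0 j : rho b ^+ j != 0.
Proof. by rewrite expf_neq0 // emb_den_neq0. Qed.

(** The comparison is degree by degree because [emb], for instance a dehomogenization, may identify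
    elements of different degrees. *)
Lemma emb_eq n F G : S n F -> S n G -> rho F = rho G -> F = G.
Proof.
move=> hF hG E; apply/eqP; rewrite -subr_eq0; apply/eqP.
apply: (@emb_inj _ _ _ _ ch n); last by rewrite rmorphB E subrr.
by rewrite -scaleN1r; apply: pieceD (pieceZ _ _).
Qed.

(** The power [bb] turns an element of arbitrary degree into a fraction of degree 0; in this way a
    prime of the chart is tested on all homogeneous elements. *)
Lemma chart_ringV n G : S n G -> chart_ring (rho G ^+ bb / rho b ^+ n).
Proof.
by move=> hG; exists n, (G ^+ bb); rewrite rmorphXn mulnC; split=> //; apply: pieceX.
Qed.

Lemma chart_ring1 : chart_ring 1.
Proof. by exists 0%N, 1; rewrite muln0 rmorph1 expr0 divr1; split=> //; apply: piece1. Qed.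

Lemma chart_ringM x y : chart_ring x -> chart_ring y -> chart_ring (x * y).
Proof.
move=> [j [F [hF ->]]] [l [G [hG ->]]]; exists (j + l)%N, (F * G).
by rewrite mulnDr rmorphM exprD mulf_div; split=> //; apply: pieceM.
Qed.

Definition prime_of_hprime p : set Omega :=
  [set x | exists j F, [/\ S (bb * j)%N F, ideal p F & x = rho F / rho b ^+ j]]%classic.

(** Membership is independent of the chosen numerator: after cross-multiplication two numerators of
    one fraction differ by powers of [b], which the prime does not contain. *)
Lemma prime_of_hprimeE p j F : ~ ideal p b -> S (bb * j)%N F ->
  prime_of_hprime p (rho F / rho b ^+ j) <-> ideal p F.
Proof.
move=> nb hF; split=> [[l [G [hG pG /eqP]]]|pF]; last by exists j, F.
rewrite eqr_div ?emb_denX_neq0 // -!rmorphXn -!rmorphM => /eqP.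
have hb i : S (bb * i)%N (b ^+ i) by apply: pieceX (cden_piece ch).
move/(@emb_eq (bb * j + bb * l)%N) => E.
have {}E : F * b ^+ l = G * b ^+ j.
  by apply: E; [|rewrite addnC]; apply: pieceM.
have : ideal p (F * b ^+ l).
  by rewrite E mulrC; apply: idealM pG; apply: piece_total (hb _).
move/(hprimeM _ hF (hb l)) => [//|].
case: l {hG E} => [|l]; first by rewrite expr0 => /ideal_proper.
by move/(hprimeX _ (ltn0Sn l) (cden_piece ch)).
Qed.

Lemma prime_of_hprimeP p : ~ ideal p b -> chart_prime (prime_of_hprime p).
Proof.
move=> nb; have hb i : S (bb * i)%N (b ^+ i) by apply: pieceX (cden_piece ch).
split.
- by move=> x [j [F [hF _ ->]]]; exists j, F.
- split; first by exists 0%N, 0; split; [exact: piece0|exact: ideal0|rewrite rmorph0 mul0r].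
  have := @prime_of_hprimeE p 0 1 nb; rewrite muln0 rmorph1 expr0 divr1.
  by move=> /(_ (@piece1 _ _ S)) -> /ideal_proper.
- move=> x y [j [F [hF pF ->]]] [l [G [hG pG ->]]].
  exists (j + l)%N, (F * b ^+ l + G * b ^+ j); split.
  + by rewrite mulnDr; apply: pieceD; [|rewrite addnC]; apply: pieceM.
  + by apply: idealD; rewrite mulrC; apply: idealM => //; apply: piece_total (hb _).
  + by rewrite addf_div ?emb_denX_neq0 // exprD rmorphD !rmorphM !rmorphXn.
- move=> x y [j [F [hF ->]]] [l [G [hG pG ->]]].
  exists (j + l)%N, (F * G); split.
  + by rewrite mulnDr; apply: pieceM.
  + by apply: idealM => //; apply: piece_total hF.
  + by rewrite rmorphM exprD mulf_div.
- move=> x y [j [F [hF ->]]] [l [G [hG ->]]].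
  rewrite mulf_div -rmorphM -exprD.
  rewrite prime_of_hprimeE //; last by rewrite mulnDr; apply: pieceM.
  by rewrite !prime_of_hprimeE // => /(hprimeM _ hF hG).
Qed.

Section HprimeOfPrime.

Variable P : set Omega.
Hypothesis hP : chart_prime P.

(* Homogeneous elements of the ideal of S corresponding to P. *)
Definition contracted n F := S n F /\ P (rho F ^+ bb / rho b ^+ n).

Lemma chart_primeX x j : (0 < j)%N -> chart_ring x -> P (x ^+ j) <-> P x.
Proof.
case: hP => [_ _ _ hM hpr]; case: j => // j _ hx.
have hX i : chart_ring (x ^+ i).
  elim: i => [|i IH]; first by rewrite expr0; apply: chart_ring1.
  by rewrite exprS; apply: chart_ringM.
split; last by rewrite exprSr; apply: hM.
elim: j => [|j IH]; first by rewrite expr1.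
by rewrite exprS => /hpr [] // /IH.
Qed.

Lemma contracted0 n : contracted n 0.
Proof.
split; first exact: piece0.
by rewrite rmorph0 expr0n eqn0Ngt cdeg_gt0 mul0r; case: hP => _ [].
Qed.

(* In the expansion of (F + G)^(2 bb) every term is divisible by F^bb or G^bb. *)
Lemma contractedD n F G : contracted n F -> contracted n G -> contracted n (F + G).
Proof.
case: (hP) => [_ [P0 _] hD hM _] [hF pF] [hG pG].
have hFG : S n (F + G) by exact: pieceD.
split=> //; have /(_ _ (chart_ringV hFG)) <- := @chart_primeX _ 2 isT.
have -> : (rho (F + G) ^+ bb / rho b ^+ n) ^+ 2
    = \sum_(i < (bb + bb).+1)
        (rho (F ^+ (bb + bb - i) * G ^+ i) / rho b ^+ (n + n)) *+ 'C(bb + bb, i).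
  rewrite expr_div_n -!exprM !muln2 -!addnn.
  rewrite rmorphD exprDn mulr_suml; apply: eq_bigr => i _.
  by rewrite rmorphM !rmorphXn mulrnAl.
elim/big_ind: _ => // i _.
have PMn x j : P x -> P (x *+ j).
  by move=> px; elim: j => [|j IH]; rewrite ?mulr0n ?mulrS //; apply: hD.
apply: PMn; rewrite exprD -!rmorphXn.
have hi : (i <= bb + bb)%N by rewrite -ltnS.
case: (leqP bb i) => h.
- have -> : G ^+ i = G ^+ (i - bb) * G ^+ bb by rewrite -exprD subnK.
  rewrite mulrA rmorphM -mulf_div; apply: hM; last by rewrite !rmorphXn.
  exists n, (F ^+ (bb + bb - i) * G ^+ (i - bb)); rewrite !rmorphXn; split=> //.
  have -> : (bb * n = n * (bb + bb - i) + n * (i - bb))%N by nia.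
  by apply: pieceM; apply: pieceX.
- have -> : F ^+ (bb + bb - i) = F ^+ (bb - i) * F ^+ bb.
    by rewrite -exprD; congr (_ ^+ _); lia.
  rewrite mulrAC rmorphM -mulf_div; apply: hM; last by rewrite !rmorphXn.
  exists n, (F ^+ (bb - i) * G ^+ i); rewrite !rmorphXn; split=> //.
  have -> : (bb * n = n * (bb - i) + n * i)%N by nia.
  by apply: pieceM; apply: pieceX.
Qed.

Lemma contracted_sum n (I : Type) (r : seq I) (Q : pred I) (E : I -> {mpoly k[N]}) :
  (forall i, Q i -> contracted n (E i)) -> contracted n (\sum_(i <- r | Q i) E i).
Proof.
move=> h; elim/big_ind: _ => //; first exact: contracted0.
by move=> x y; apply: contractedD.
Qed.

Lemma contractedM n m F G : S n F -> contracted m G -> contracted (n + m) (F * G).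
Proof.
case: (hP) => [_ _ _ hM _] hF [hG pG]; split; first exact: pieceM.
by rewrite rmorphM exprMn exprD -mulf_div; apply: hM => //; apply: chart_ringV.
Qed.

Lemma contracted_prime n m F G : S n F -> S m G -> contracted (n + m) (F * G) ->
  contracted n F \/ contracted m G.
Proof.
case: (hP) => [_ _ _ _ hpr] hF hG [_].
rewrite rmorphM exprMn exprD -mulf_div => /hpr.
by case; [exact: chart_ringV|exact: chart_ringV|left|right].
Qed.

Definition contracted_ideal : set {mpoly k[N]} :=
  [set F | forall i, contracted i (pihomog mdeg i F)]%classic.

Lemma contracted_total F : contracted_ideal F -> total_ring S F.
Proof. by move=> h i; case: (h i). Qed.

Lemma contracted_piece n F : S n F -> contracted_ideal F <-> contracted n F.
Proof.
move=> hF; split=> [/(_ n)|h i]; first by rewrite (pihomog_piece _ hF) eqxx.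
by rewrite (pihomog_piece _ hF); case: eqP => [<-|_] //; apply: contracted0.
Qed.

Lemma contracted_idealM F G : total_ring S F -> contracted_ideal G ->
  contracted_ideal (F * G).
Proof.
move=> tF iG i; have [K /(_ _ (leqnn K)) ->] := pihomogM_pieces i tF (contracted_total iG).
apply: contracted_sum => j _; apply: contracted_sum => l /eqP <-.
exact: contractedM.
Qed.

(** Primality is known for homogeneous elements. In general take the lowest components of [F] and
    [G] outside the ideal: modulo the ideal, their product is the component of [F * G] in the sum of
    the two degrees. *)
Lemma contracted_ideal_prime F G : total_ring S F -> total_ring S G ->
  contracted_ideal (F * G) -> contracted_ideal F \/ contracted_ideal G.
Proof.
move=> tF tG iFG; apply: contrapT => /not_orP [nF nG].
have low H : ~ contracted_ideal H -> exists i,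
    ~ contracted i (pihomog mdeg i H) /\
    forall j, (j < i)%N -> contracted j (pihomog mdeg j H).
  move=> /existsNP [i ni].
  have ex : exists i, ~~ `[< contracted i (pihomog mdeg i H) >].
    by exists i; apply/asboolPn.
  case: (ex_minnP ex) => j /asboolPn nj jmin; exists j; split=> // l lj.
  by apply: contrapT => /asboolPn /jmin; rewrite leqNgt lj.
have [i [ni hi]] := low _ nF; have [l [nl hl]] := low _ nG.
(* The bound is raised above [i + l], so that the indices [i] and [l] both occur in the sums. *)
have [K /(_ (K + (i + l).+1)%N (leq_addr _ _)) E] := pihomogM_pieces (i + l) tF tG.
have li : (i < K + (i + l).+1)%N by lia.
have ll : (l < K + (i + l).+1)%N by lia.
move: (K + (i + l).+1)%N li ll E => {}K li ll E.
have := iFG (i + l)%N; rewrite E (bigD1 (Ordinal li)) //= (bigD1 (Ordinal ll)) //=.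
rewrite -addrA; set rest := (X in _ + X) => hs.
suff : contracted (i + l) (pihomog mdeg i F * pihomog mdeg l G).
  by case/(contracted_prime (tF i) (tG l)).
have hr : contracted (i + l) rest.
  apply: contractedD.
    apply: contracted_sum => j /andP[/eqP jl /eqP nj].
    by move/eqP: jl; rewrite eqn_add2l => /eqP jl; case: nj; apply: val_inj.
  apply: contracted_sum => j nj; apply: contracted_sum => r /eqP jr.
  rewrite -jr; have [jlt|ile] := ltnP j i.
    by rewrite mulrC addnC; apply: contractedM (tG r) (hi _ jlt).
  apply: contractedM (tF j) (hl _ _).
  have : j != i :> nat by apply: contraNneq nj => ji; apply/eqP/val_inj.
  by move: jr ile; lia.
rewrite -[X in contracted _ X](addrK rest); apply: contractedD hs _.
rewrite -mulN1r -[(i + l)%N]add0n; apply: contractedM hr.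
by rewrite -scaleN1r; apply: pieceZ; apply: piece1.
Qed.
End HprimeOfPrime.
End ChartTheory.

Section HprimeFromChart.

Variables (k : fieldType) (N : nat) (S : graded_subalg k N) (Omega : fieldType).
Variables (ch : chart S Omega) (P : set Omega) (hP : chart_prime ch P).

Lemma contracted_idealD F G : contracted_ideal ch P F ->
  contracted_ideal ch P G -> contracted_ideal ch P (F + G).
Proof. by move=> hF hG i; rewrite raddfD; apply: contractedD. Qed.

Lemma contracted_ideal0 : contracted_ideal ch P 0.
Proof. by move=> i; rewrite raddf0; apply: contracted0. Qed.

Lemma contracted_ideal_homog n F : contracted_ideal ch P F ->
  contracted_ideal ch P (pihomog mdeg n F).
Proof. by move=> h; apply/(contracted_piece hP (proj1 (h n))). Qed.

Lemma contracted_ideal_proper : ~ contracted_ideal ch P 1.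
Proof.
move/(contracted_piece hP (@piece1 _ _ S)) => [_].
by case: (hP) => _ [_ n1] _ _ _; rewrite rmorph1 expr1n expr0 divr1.
Qed.

Lemma contracted_ideal_den : ~ contracted_ideal ch P (cden ch).
Proof.
move/(contracted_piece hP (cden_piece ch)) => [_].
by case: (hP) => _ [_ n1] _ _ _; rewrite divff ?emb_denX_neq0.
Qed.

Lemma contracted_ideal_relevant : ~ (irrelevant S `<=` contracted_ideal ch P)%classic.
Proof.
move=> h; apply: contracted_ideal_den; apply: h; split.
  exact: piece_total (cden_piece ch).
rewrite (pihomog_piece _ (cden_piece ch)).
by rewrite (gtn_eqF (cdeg_gt0 ch)).
Qed.

Definition hprime_of_prime : hprime S :=
  HPrime (@contracted_total _ _ _ _ ch P) contracted_ideal0 contracted_idealD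
    (contracted_idealM hP) contracted_ideal_homog contracted_ideal_proper
    (contracted_ideal_prime hP) contracted_ideal_relevant.

Lemma prime_of_hprimeK x : prime_of_hprime ch hprime_of_prime x <-> P x.
Proof.
case: (hP) => [sub _ _ _ _]; have main j F : S (cdeg ch * j)%N F ->
    contracted_ideal ch P F <-> P (emb ch F / emb ch (cden ch) ^+ j).
  move=> hF; rewrite (contracted_piece hP hF) /contracted [in _ ^+ (_ * j)]mulnC exprM.
  rewrite -expr_div_n.
  rewrite (chart_primeX hP (cdeg_gt0 ch)); last by exists j, F.
  by split=> [[]|].
split=> [[j [F [hF /= iF ->]]]|Px]; first by apply/(main _ _ hF).
by have [j [F [hF E]]] := sub _ Px; exists j, F; split=> //=; apply/(main _ _ hF); rewrite -E.
Qed.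

End HprimeFromChart.

Lemma hprime_of_primeK (k : fieldType) (N : nat) (S : graded_subalg k N)
    (Omega : fieldType) (ch : chart S Omega) (p : hprime S)
    (hP : chart_prime ch (prime_of_hprime ch p)) :
  ~ ideal p (cden ch) -> hprime_of_prime hP = p.
Proof.
move=> nb; apply: hprime_eq => F /=; split=> [hF|pF].
- have tF := contracted_total hF.
  apply/(hprime_components _ tF) => i; have [_] := hF i.
  rewrite -rmorphXn prime_of_hprimeE //; last by rewrite mulnC; apply: pieceX.
  by move/(hprimeX _ (cdeg_gt0 ch) (tF i)).
- have tF := ideal_sub pF; move=> i; split=> //; rewrite -rmorphXn.
  apply/prime_of_hprimeE => //; first by rewrite mulnC; apply: pieceX.
  by apply/(hprimeX _ (cdeg_gt0 ch) (tF i)); apply: ideal_homog.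
Qed.

(** The witness is the generic point. It shows that the chart is nonempty and serves as a default
    value for the maps between charts. *)
Lemma hprime0 (k : fieldType) (N : nat) (S : graded_subalg k N)
    (Omega : fieldType) (ch : chart S Omega) :
  exists p : hprime S, ~ ideal p (cden ch).
Proof.
have nb : ~ (cden ch = 0) by apply/eqP; exact: cden_neq0.
suff [p hp] : exists p : hprime S, forall F, ideal p F <-> F = 0.
  by exists p; rewrite hp.
unshelve refine (ex_intro _ (@HPrime _ _ S [set F | F = 0]%classic _ _ _ _ _ _ _ _) _)
  => //=.
- by move=> F /= ->; apply: piece_total (@piece0 _ _ S 0%N).
- by move=> F G -> ->; rewrite addr0.
- by move=> F G _ ->; rewrite mulr0.
- by move=> n F ->; rewrite raddf0.
- by apply/eqP; exact: oner_neq0.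
- by move=> F G _ _ /eqP; rewrite mulf_eq0 => /orP[] /eqP ->; [left|right].
- move=> h; apply: nb; apply: h; split; first exact: piece_total (cden_piece ch).
  by rewrite (pihomog_piece _ (cden_piece ch)) (gtn_eqF (cdeg_gt0 ch)).
Qed.

(** * Transport of primes and fractions between two charts with the same ring *)

Section Transport.

Variables (k : fieldType) (N M : nat) (S : graded_subalg k N) (T : graded_subalg k M).
Variables (Omega : fieldType) (cS : chart S Omega) (cT : chart T Omega).
Hypothesis same_ring : chart_ring cS = chart_ring cT.
Hypothesis same_const : forall c : k, emb cS c%:MP = emb cT c%:MP.

Local Notation tofrac := FracField.tofrac.

(** The value [p0] is a dummy, taken off the chart: a prime containing the denominator gives a set
    containing 1. *)
Definition chart_map (p0 : hprime T) (p : hprime S) : hprime T :=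
  match pselect (chart_prime cT (prime_of_hprime cS p)) with
  | left h => hprime_of_prime h
  | right _ => p0
  end.

Lemma prime_transport p : ~ ideal p (cden cS) ->
  chart_prime cT (prime_of_hprime cS p).
Proof. by move/(prime_of_hprimeP (ch := cS)); rewrite /chart_prime same_ring. Qed.

Lemma chart_mapE p0 p n G : ~ ideal p (cden cS) -> T n G ->
  ideal (chart_map p0 p) G <->
  prime_of_hprime cS p (emb cT G ^+ cdeg cT / emb cT (cden cT) ^+ n).
Proof.
move=> nb hG; rewrite /chart_map; case: pselect => [h|/(_ (prime_transport nb))] //=.
by rewrite (contracted_piece h hG) /contracted; split=> [[]|].
Qed.

Lemma chart_map_den p0 p : ~ ideal p (cden cS) -> ~ ideal (chart_map p0 p) (cden cT).
Proof.
move=> nb; rewrite /chart_map; case: pselect => [h|/(_ (prime_transport nb))] //=.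
exact: contracted_ideal_den h.
Qed.

Lemma chart_map_prime p0 p x : ~ ideal p (cden cS) ->
  prime_of_hprime cT (chart_map p0 p) x <-> prime_of_hprime cS p x.
Proof.
move=> nb; rewrite /chart_map; case: pselect => [h|/(_ (prime_transport nb))] //=.
exact: prime_of_hprimeK.
Qed.

Lemma chart_map_open p0 (W : set (hprime T)) : zariski_open W ->
  zariski_open ([set p | ~ ideal p (cden cS)] `&` chart_map p0 @^-1` W)%classic.
Proof.
case=> E hE ->.
(* Each [G] is replaced by a numerator, over [cS], of the fraction of degree 0 that tests it; the
   extra factor [cden cS] confines the open set to the chart. *)
pose E' := [set H | exists n G j F, [/\ E G, T n G, S (cdeg cS * j)%N F,
   emb cS F / emb cS (cden cS) ^+ j = emb cT G ^+ cdeg cT / emb cT (cden cT) ^+ n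
   & H = cden cS * F]]%classic.
exists E'.
  move=> H [n [G [j [F [_ _ hF _ ->]]]]].
  by eexists; apply: pieceM hF; apply: cden_piece.
apply/seteqP; split=> p /=.
- move=> [nb /existsNP [G /not_implyP [EG nG]]] /= sub.
  have [n hn] := hE _ EG.
  have : chart_ring cS (emb cT G ^+ cdeg cT / emb cT (cden cT) ^+ n).
    by rewrite same_ring; apply: chart_ringV.
  case=> j [F [hF eF]].
  have : ideal p (cden cS * F) by apply: sub; exists n, G, j, F.
  move/(hprimeM _ (cden_piece cS) hF) => [//|pF]; apply: nG.
  by apply/(chart_mapE _ nb hn); rewrite eF; apply/prime_of_hprimeE.
- move=> /existsNP [H /not_implyP [[n [G [j [F [EG hG hF eF ->]]]]] npH]].
  have nb : ~ ideal p (cden cS).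
    by move=> pb; apply: npH; apply/(hprimeM _ (cden_piece cS) hF); left.
  split=> // sub; apply: npH; apply/(hprimeM _ (cden_piece cS) hF); right.
  by have /(chart_mapE _ nb hG) := sub _ EG; rewrite -eF => /prime_of_hprimeE; apply.
Qed.

(* The isomorphism between the fields of homogeneous fractions of degree 0 of
   T and S induced by their common embedding in Omega, as a relation. *)
Definition frac_rel (v : {fraction {mpoly k[M]}}) (w : {fraction {mpoly k[N]}}) :=
  exists n a a' m F F', [/\ T n a, T n a' /\ a' != 0, S m F, S m F' /\ F' != 0
   & [/\ v = tofrac a / tofrac a', w = tofrac F / tofrac F'
     & emb cS F * emb cT a' = emb cS F' * emb cT a]].

Definition frac_map (v : {fraction {mpoly k[M]}}) : {fraction {mpoly k[N]}} :=
  xget 0 [set w | frac_rel v w]%classic.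

Lemma emb_neq0 n a : T n a -> a != 0 -> emb cT a != 0.
Proof. by move=> hn; apply: contraNneq => /(emb_inj hn) ->. Qed.

Lemma frac_rel_fun v w1 w2 : frac_rel v w1 -> frac_rel v w2 -> w1 = w2.
Proof.
move=> [n [a [a' [m [F [F' [ha [ha' na'] hF [hF' nF'] [-> -> E]]]]]]]].
move=> [n1 [b [b' [l [G [G' [hb [hb' nb'] hG [hG' nG'] [E2 -> E3]]]]]]]].
have := E2; move/eqP; rewrite eqr_div ?tofrac_eq0 // -!tofracM tofrac_eq => /eqP E4.
apply/eqP; rewrite eqr_div ?tofrac_eq0 // -!tofracM tofrac_eq; apply/eqP.
apply: (@emb_eq _ _ S _ cS (m + l)); first exact: pieceM.
  by rewrite addnC; apply: pieceM.
rewrite !rmorphM; apply: (mulIf (emb_neq0 ha' na')).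
apply: (mulIf (emb_neq0 hb' nb')).
have E5 : emb cT a * emb cT b' = emb cT b * emb cT a' by rewrite -!rmorphM E4.
transitivity (emb cS F * emb cT a' * emb cS G' * emb cT b'); first by ring.
rewrite E; transitivity (emb cS F' * emb cS G' * (emb cT a * emb cT b')); first by ring.
rewrite E5; transitivity (emb cS F' * emb cT a' * (emb cS G' * emb cT b)); first by ring.
by rewrite -E3; ring.
Qed.

Lemma frac_mapP v w : frac_rel v w -> frac_map v = w.
Proof. by move=> h; apply: xget_unique => // y hy; apply: frac_rel_fun hy h. Qed.

Lemma frac_relD v1 w1 v2 w2 : frac_rel v1 w1 -> frac_rel v2 w2 ->
  frac_rel (v1 + v2) (w1 + w2).
Proof.
move=> [n [a [a' [m [F [F' [ha [ha' na'] hF [hF' nF'] [-> -> E]]]]]]]].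
move=> [n1 [b [b' [l [G [G' [hb [hb' nb'] hG [hG' nG'] [-> -> E3]]]]]]]].
exists (n + n1)%N, (a * b' + b * a'), (a' * b'), (m + l)%N, (F * G' + G * F'), (F' * G').
split.
- by apply: pieceD; [|rewrite addnC]; apply: pieceM.
- by split; [apply: pieceM|apply: mulf_neq0].
- by apply: pieceD; [|rewrite addnC]; apply: pieceM.
- by split; [apply: pieceM|apply: mulf_neq0].
rewrite !addf_div ?tofrac_eq0 // !tofracD !tofracM; split=> //.
rewrite !rmorphD !rmorphM.
transitivity (emb cS F * emb cT a' * emb cS G' * emb cT b' +
   emb cS G * emb cT b' * (emb cS F' * emb cT a')); first by ring.
by rewrite E E3; ring.
Qed.

Lemma frac_relM v1 w1 v2 w2 : frac_rel v1 w1 -> frac_rel v2 w2 ->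
  frac_rel (v1 * v2) (w1 * w2).
Proof.
move=> [n [a [a' [m [F [F' [ha [ha' na'] hF [hF' nF'] [-> -> E]]]]]]]].
move=> [n1 [b [b' [l [G [G' [hb [hb' nb'] hG [hG' nG'] [-> -> E3]]]]]]]].
exists (n + n1)%N, (a * b), (a' * b'), (m + l)%N, (F * G), (F' * G').
split; try by [apply: pieceM | split; [apply: pieceM|apply: mulf_neq0]].
rewrite !mulf_div !tofracM; split=> //; rewrite !rmorphM.
transitivity (emb cS F * emb cT a' * (emb cS G * emb cT b')); first by ring.
by rewrite E E3; ring.
Qed.

Lemma frac_rel_const c : frac_rel (tofrac c%:MP) (tofrac c%:MP).
Proof.
have h L (U : graded_subalg k L) : U 0%N c%:MP.
  by rewrite -[_%:MP]mulr1 mul_mpolyC; apply: pieceZ; apply: piece1.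
exists 0%N, c%:MP, 1, 0%N, c%:MP, 1; rewrite !tofrac1 !divr1 !rmorph1 mulr1 mul1r.
by split=> //; split=> //; try exact: piece1; exact: oner_neq0.
Qed.

(** Multiply [a] and [a'] by [a' ^+ (cdeg cT).-1] and divide by [cden cT ^+ n]: both become elements
    of the common chart ring and have numerators over [S], which powers of [cden cS] bring to one
    degree. The last clause carries the nonvanishing of denominators across, as regularity of
    sections requires. *)
Lemma frac_rel_ex n a a' : T n a -> T n a' -> a' != 0 ->
  exists m F F', [/\ S m F, S m F' /\ F' != 0,
     emb cS F * emb cT a' = emb cS F' * emb cT a,
     frac_rel (tofrac a / tofrac a') (tofrac F / tofrac F')
   & forall p0 p, ~ ideal p (cden cS) ->
       ~ ideal (chart_map p0 p) a' <-> ~ ideal p F'].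
Proof.
move=> ha ha' na'.
have : chart_ring cT (emb cT (a * a' ^+ (cdeg cT).-1) / emb cT (cden cT) ^+ n).
  exists n, (a * a' ^+ (cdeg cT).-1); split=> //.
  have -> : (cdeg cT * n = n + n * (cdeg cT).-1)%N.
    by rewrite mulnC -mulnS prednK // cdeg_gt0.
  exact: pieceM ha (pieceX _ ha').
have : chart_ring cT (emb cT (a' ^+ cdeg cT) / emb cT (cden cT) ^+ n).
  by rewrite rmorphXn; apply: chart_ringV.
rewrite -same_ring => -[j [F' [hF' eF']]] [l [F [hF eF]]].
have nb := emb_den_neq0 cS; have nc := emb_den_neq0 cT.
have na := emb_neq0 ha' na'.
have nF' : F' != 0.
  apply: contraTneq na => F0; rewrite negbK; move/eqP: eF'.
  rewrite F0 rmorph0 mul0r mulf_eq0 invr_eq0 (negPf (emb_denX_neq0 _ _)) orbF.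
  by rewrite rmorphXn expf_eq0 cdeg_gt0.
have hb i : S (cdeg cS * i)%N (cden cS ^+ i) by apply: pieceX (cden_piece cS).
have hG : S (cdeg cS * (j + l))%N (F * cden cS ^+ j).
  by rewrite mulnDr addnC; apply: pieceM.
have hG' : S (cdeg cS * (j + l))%N (F' * cden cS ^+ l).
  by rewrite mulnDr; apply: pieceM.
have nG' : F' * cden cS ^+ l != 0 by rewrite mulf_neq0 // expf_neq0 ?cden_neq0.
have EE : emb cS (F * cden cS ^+ j) * emb cT a' = emb cS (F' * cden cS ^+ l) * emb cT a.
  have {}eF : emb cS F = emb cT (a * a' ^+ (cdeg cT).-1) / emb cT (cden cT) ^+ n
      * emb cS (cden cS) ^+ l by rewrite eF divfK ?emb_denX_neq0.
  have {}eF' : emb cS F' = emb cT (a' ^+ cdeg cT) / emb cT (cden cT) ^+ n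
      * emb cS (cden cS) ^+ j by rewrite eF' divfK ?emb_denX_neq0.
  rewrite !rmorphM eF eF' !rmorphXn !rmorphM /= rmorphXn.
  rewrite -[in RHS](prednK (cdeg_gt0 cT)) exprS.
  ring.
exists (cdeg cS * (j + l))%N, (F * cden cS ^+ j), (F' * cden cS ^+ l); split=> //.
  by exists n, a, a', (cdeg cS * (j + l))%N, (F * cden cS ^+ j), (F' * cden cS ^+ l).
move=> p0 p np; rewrite (chart_mapE _ np ha') -rmorphXn eF' prime_of_hprimeE //.
rewrite (hprimeM _ hF' (hb l)); split=> [nF [//|]|n1 pF]; last by apply: n1; left.
case: l {hF eF hG hG' nG' EE} => [|l] //; first by rewrite expr0 => /ideal_proper.
by move/(hprimeX _ (ltn0Sn l) (cden_piece cS)).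
Qed.

Lemma regular_rel (W : set (hprime T)) s q : regular W s -> W q ->
  exists w, frac_rel (s q) w.
Proof.
move=> /(_ q) h /h [W1 [_ qW1 _ [n [a [a' [ha ha' hs]]]]]].
have [nq ->] := hs _ qW1.
have na' : a' != 0 by apply/eqP => a0; apply: nq; rewrite a0; apply: ideal0.
by have [m [F [F' [_ _ _ h1 _]]]] := frac_rel_ex ha ha' na'; eexists; exact: h1.
Qed.

Lemma regular_transport p0 (W : set (hprime T)) s : regular W s ->
  regular ([set p | ~ ideal p (cden cS)] `&` chart_map p0 @^-1` W)%classic
          (fun p => frac_map (s (chart_map p0 p))).
Proof.
move=> hs p [np /= Wp]; have [W1 [oW1 W1p sub [n [a [a' [ha ha' h]]]]]] := hs _ Wp.
have [nq _] := h _ W1p.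
have na' : a' != 0 by apply/eqP => a0; apply: nq; rewrite a0; apply: ideal0.
have [m [F [F' [hF [hF' nF'] _ r hiff]]]] := frac_rel_ex ha ha' na'.
exists ([set p | ~ ideal p (cden cS)] `&` chart_map p0 @^-1` W1)%classic; split.
- exact: chart_map_open.
- by split.
- by move=> q [nbq /sub].
exists m, F, F'; split=> // q [nbq W1q]; have [na sq] := h _ W1q.
by split; [apply/(hiff p0) | rewrite sq; apply: frac_mapP].
Qed.

End Transport.

Section BirationalCharts.

Variables (k : fieldType) (N M : nat) (S : graded_subalg k N) (T : graded_subalg k M).
Variables (Omega : fieldType) (cS : chart S Omega) (cT : chart T Omega).

Lemma chart_mapK p0 q0 p : chart_ring cS = chart_ring cT -> ~ ideal p (cden cS) ->
  chart_map cT cS p0 (chart_map cS cT q0 p) = p.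
Proof.
move=> same nb.
have E : prime_of_hprime cT (chart_map cS cT q0 p) = prime_of_hprime cS p.
  by apply/funext => x; apply/propext; apply: (chart_map_prime same).
rewrite {1}/chart_map; case: pselect => [h|]; last first.
  by case; rewrite E; apply: prime_of_hprimeP.
by move: h; rewrite E => h; apply: hprime_of_primeK.
Qed.

Lemma frac_rel_sym v w : frac_rel cS cT v w -> frac_rel cT cS w v.
Proof.
move=> [n [a [a' [m [F [F' [ha ha' hF hF' [-> -> E]]]]]]]].
exists m, F, F', n, a, a'; split=> //; split=> //.
by rewrite mulrC -E mulrC.
Qed.

Lemma frac_mapK v w : frac_rel cS cT v w -> frac_map cT cS (frac_map cS cT v) = v.
Proof. by move=> r; rewrite (frac_mapP r) (frac_mapP (frac_rel_sym r)). Qed.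

End BirationalCharts.

(** On points the map is the identity on primes of the common ring. Sections pass through
    [frac_map], because each Proj has its own fraction field of values. *)
Lemma birational_charts (k : fieldType) (N M : nat) (S : graded_subalg k N)
    (T : graded_subalg k M) (Omega : fieldType) (cS : chart S Omega) (cT : chart T Omega) :
  chart_ring cS = chart_ring cT -> (forall c, emb cS c%:MP = emb cT c%:MP) ->
  birational (Proj S) (Proj T).
Proof.
move=> same const_eq; have same' := esym same.
have [p0 np0] := hprime0 cS; have [q0 nq0] := hprime0 cT.
pose f := chart_map cS cT q0; pose g := chart_map cT cS p0.
have oD L (U : graded_subalg k L) (c : chart U Omega) :
    zariski_open [set p : hprime U | ~ ideal p (cden c)]%classic.
  exists [set cden c]%classic; first by move=> _ ->; exists (cdeg c); exact: cden_piece.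
  by apply/seteqP; split=> p /= h; [move/(_ _ erefl)|move=> h1; apply: h => _ ->].
have fV p : ~ ideal p (cden cS) -> ~ ideal (f p) (cden cT) by apply: chart_map_den.
have gU q : ~ ideal q (cden cT) -> ~ ideal (g q) (cden cS) by apply: chart_map_den.
have gf p : ~ ideal p (cden cS) -> g (f p) = p by apply: chart_mapK.
have fg q : ~ ideal q (cden cT) -> f (g q) = q by apply: chart_mapK.
exists [set p | ~ ideal p (cden cS)]%classic, [set q | ~ ideal q (cden cT)]%classic.
split; [exact: oD|exact: oD|by exists p0|by exists q0|].
exists f, g, (fun _ s p => frac_map cS cT (s (f p))); split.
  split=> [p np|q nq|W oW _|W oW _].
  - by split; [apply: fV|apply: gf].
  - by split; [apply: gU|apply: fg].
  - exact: chart_map_open.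
  - exact: chart_map_open.
move=> W oW WV /=.
have rel s q : regular W s -> W q -> exists w, frac_rel cS cT (s q) w.
  by move=> hs Wq; apply: regular_rel hs Wq.
split.
- by move=> s hs; apply: regular_transport.
- move=> s t hs ht; split=> [e p [_ /= Wp]|e q Wq]; first by rewrite e.
  have nq := WV _ Wq; have := e (g q); rewrite /= fg // => e1.
  have [w r] := rel _ _ hs Wq; have [w' r'] := rel _ _ ht Wq.
  have {}e1 : w = w' by rewrite -(frac_mapP r) -(frac_mapP r') e1 //; split=> //; exact: gU.
  rewrite -e1 in r'; exact: frac_rel_fun (frac_rel_sym r) (frac_rel_sym r').
- move=> t ht; have ht' := regular_transport same' (p0 := p0) ht.
  exists (fun q => frac_map cT cS (t (g q))).
    move: ht'; congr regular; apply/seteqP; split=> q /=; first by rewrite -/g => -[nq [_]]; rewrite -/f fg.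
    move=> Wq; have nq := WV _ Wq; split=> //; split; first exact: gU.
    by rewrite -/f -/g fg.
  move=> p [/= np Wp]; rewrite gf //.
  have [w r] : exists w, frac_rel cT cS (t p) w by apply: regular_rel ht _.
  exact: frac_mapK r.
- split=> [s t hs ht p [_ /= Wp]|s t hs ht p [_ /= Wp]|c p _].
  + have [w r] := rel _ _ hs Wp; have [w' r'] := rel _ _ ht Wp.
    by rewrite (frac_mapP r) (frac_mapP r') (frac_mapP (frac_relD r r')).
  + have [w r] := rel _ _ hs Wp; have [w' r'] := rel _ _ ht Wp.
    by rewrite (frac_mapP r) (frac_mapP r') (frac_mapP (frac_relM r r')).
  + exact: (frac_mapP (frac_rel_const const_eq c)).
- by [].
Qed.

(** * Affine coordinates on projective space *)

Section Dehomogenization.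

Variables (k : fieldType) (M : nat).

Definition dehom : {mpoly k[M.+1]} -> {mpoly k[M]} :=
  mmap (@mpolyC M k) (fun i => if unlift ord0 i is Some j then 'X_j else 1).

HB.instance Definition _ := GRing.RMorphism.on dehom.
Arguments dehom : simpl never.

Definition mtail (m : 'X_{1..M.+1}) : 'X_{1..M} := [multinom m (lift ord0 j) | j < M].

Definition mcons (D : nat) (m : 'X_{1..M}) : 'X_{1..M.+1} :=
  [multinom (if unlift ord0 i is Some j then m j else D - mdeg m)%N | i < M.+1].

Lemma mcons_tail D m : mtail (mcons D m) = m.
Proof. by apply/mnmP => j; rewrite !mnmE liftK. Qed.

Lemma mdeg_tail m : mdeg m = (m ord0 + mdeg (mtail m))%N.
Proof.
rewrite !mdegE big_ord_recl; congr (_ + _)%N.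
by apply: eq_bigr => j _; rewrite mnmE.
Qed.

Lemma mdeg_cons D m : (mdeg m <= D)%N -> mdeg (mcons D m) = D.
Proof. by move=> h; rewrite mdeg_tail mcons_tail mnmE unlift_none subnK. Qed.

Lemma mtail_inj m1 m2 : mdeg m1 = mdeg m2 -> mtail m1 = mtail m2 -> m1 = m2.
Proof.
rewrite !mdeg_tail => e1 e2; rewrite e2 in e1; move/eqP: e1; rewrite eqn_add2r => /eqP e1.
apply/mnmP => i; case: (unliftP ord0 i) => [j|] -> //.
by move/mnmP: e2 => /(_ j); rewrite !mnmE.
Qed.

Lemma dehomC c : dehom c%:MP = c%:MP.
Proof. exact: mmapC. Qed.

Lemma dehomZ c p : dehom (c *: p) = c *: dehom p.
Proof. by rewrite -mul_mpolyC rmorphM /= dehomC mul_mpolyC. Qed.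

Lemma dehomX m : dehom 'X_[m] = 'X_[mtail m].
Proof.
rewrite /dehom mmapX /mmap1 big_ord_recl unlift_none expr1n mul1r.
by rewrite [RHS]mpolyXE_id; apply: eq_bigr => j _; rewrite liftK mnmE.
Qed.

Lemma dehomE p : dehom p = \sum_(m <- msupp p) p@_m *: 'X_[mtail m].
Proof.
rewrite {1}[p]mpolyE (raddf_sum (@dehom : {rmorphism _ -> _})) /=.
by apply: eq_bigr => m _; rewrite dehomZ dehomX.
Qed.

Lemma dehom_inj D G : G \is D.-homog -> dehom G = 0 -> G = 0.
Proof.
move=> /dhomogP hG G0; apply/mpolyP => m; rewrite mcoeff0.
have [mG|] := boolP (m \in msupp G); last exact: memN_msupp_eq0.
have := congr1 (mcoeff (mtail m)) G0; rewrite dehomE mcoeff0 raddf_sum.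
rewrite (bigD1_seq m) ?msupp_uniq //= mcoeffZ mcoeffX eqxx mulr1.
rewrite big_seq_cond big1 ?addr0 // => m' /andP[m'G nm]; rewrite mcoeffZ mcoeffX.
case: eqP => [E|]; last by rewrite mulr0.
by case/eqP: nm; apply: mtail_inj E; rewrite (hG _ mG) (hG _ m'G).
Qed.

(** The first exponent absorbs any excess of degree, so every large degree is available; numerators
    and denominators can then be matched. *)
Lemma dehom_surj P : exists K, forall D, (K <= D)%N ->
  exists2 G, G \is D.-homog & dehom G = P.
Proof.
exists (msize P) => D KD.
exists (\sum_(m <- msupp P) P@_m *: 'X_[mcons D m]).
  rewrite big_seq_cond; apply: rpred_sum => m /andP[mP _]; apply: rpredZ.
  rewrite dhomogX /= mdeg_cons //; apply: ltnW; apply: leq_trans KD.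
  exact: msize_mdeg_lt.
rewrite (raddf_sum (@dehom : {rmorphism _ -> _})) [RHS]mpolyE; apply: eq_bigr => m _ /=.
by rewrite dehomZ dehomX mcons_tail.
Qed.

End Dehomogenization.

(** * Rationality from generators on a slice *)

Section RationalityCriterion.

Variables (k : fieldType) (N M : nat) (S : graded_subalg k N) (E : idomainType).
Variables (rho : {rmorphism {mpoly k[N]} -> E}) (phi : {rmorphism {mpoly k[M]} -> E}).
Variables (Nb : nat) (b : {mpoly k[N]}).
Hypothesis phi_inj : injective phi.
Hypothesis rho_phi_const : forall c : k, rho c%:MP = phi c%:MP.
Hypothesis Nb_gt0 : (0 < Nb)%N.
Hypothesis b_piece : S Nb b.
Hypothesis rho_b : rho b != 0.
Hypothesis rho_inj : forall n F, S n F -> rho F = 0 -> F = 0.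
Hypothesis rho_phi : forall j F, S (Nb * j)%N F -> exists P, rho F = phi P.
Hypothesis lift_var :
  forall i, exists r F, S (Nb * r)%N F /\ rho F = phi 'X_i * rho b ^+ r.

Local Notation tofrac := (@FracField.tofrac E).

Lemma lift_pad r F P s : S (Nb * r)%N F -> rho F = phi P * rho b ^+ r ->
  S (Nb * (r + s))%N (F * b ^+ s) /\ rho (F * b ^+ s) = phi P * rho b ^+ (r + s).
Proof.
move=> hF eF; split; first by rewrite mulnDr; apply: pieceM => //; apply: pieceX.
by rewrite rmorphM eF rmorphXn exprD mulrA.
Qed.

Let liftable P := exists r F, S (Nb * r)%N F /\ rho F = phi P * rho b ^+ r.

Lemma lift_poly P : liftable P.
Proof.
have liftM Q Q' : liftable Q -> liftable Q' -> liftable (Q * Q').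
  move=> [r [F [hF eF]]] [r' [F' [hF' eF']]]; exists (r + r')%N, (F * F').
  rewrite mulnDr !rmorphM eF eF' exprD; split; [exact: pieceM | by ring].
have lift1 : liftable 1.
  exists 0%N, 1; rewrite muln0 !rmorph1 expr0 mulr1; split=> //; exact: piece1.
rewrite [P]mpolyE; apply: (big_ind liftable) => [|Q Q'|m _].
- exists 0%N, 0; rewrite !rmorph0 mul0r; split=> //; exact: piece0.
- move=> [r [F [hF eF]]] [r' [F' [hF' eF']]].
  have [h1 e1] := lift_pad r' hF eF; have [h2 e2] := lift_pad r hF' eF'.
  exists (r + r')%N, (F * b ^+ r' + F' * b ^+ r).
  rewrite addnC in h2 e2; split; first exact: pieceD.
  by rewrite !rmorphD e1 e2 -mulrDl.
- rewrite -mul_mpolyC; apply: (liftM).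
    exists 0%N, (P@_m)%:MP; rewrite muln0 expr0 mulr1 rho_phi_const; split=> //.
    by rewrite -[_%:MP]mulr1 mul_mpolyC; apply: pieceZ; apply: piece1.
  rewrite mpolyXE_id; apply: (big_ind liftable) => [//|Q Q'|i _]; first exact: (liftM).
  elim: (m i) => [|l IH]; first by rewrite expr0.
  by rewrite exprS; apply: (liftM).
Qed.

(** Let [B] be the polynomial to which [b] restricts. Both charts have the ring k[z][1/B] inside the
    fraction field of [E]; on projective space it is the chart where a homogenization [c] of [B] is
    nonzero. *)
Theorem rational_criterion : rational (Proj S).
Proof.
exists M; pose T := GradedSubalg (@all_forms_homog k M) (@all_forms_lin k M)
  (@all_forms0 k M) (@all_forms1 k M) (@all_formsM k M).
change (birational (Proj S) (Proj T)).
have [B eB] : exists B, rho b = phi B by apply: (@rho_phi 1); rewrite muln1.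
have nB : B != 0 by apply: contraNneq rho_b => B0; rewrite eB B0 rmorph0.
have [r [num [hnum enum]]] := lift_poly B.
rewrite eB -rmorphXn -rmorphM -exprS in enum.
(* [num] has degree [Nb * r] but restricts to [B ^+ r.+1]. Hence [b ^+ r.+1] and [b'] have the same
   degree and their quotient restricts to 1/B: passing from [b] to [b'] puts the inverse of [B] into
   the chart ring. *)
pose b' := b * num; have hb' : S (Nb * r.+1)%N b' by rewrite mulnS; apply: pieceM.
have [r2 er2] : exists r2, r2 = r.+2 by exists r.+2.
have eb' : rho b' = phi (B ^+ r2) by rewrite rmorphM enum eB -rmorphM -exprS er2.
have phi0 P : phi P = 0 -> P = 0 by move=> h; apply: phi_inj; rewrite rmorph0.
have nb' : b' != 0.
  apply: contraNneq nB => b0; move: eb'; rewrite b0 rmorph0 => /esym /phi0 /eqP.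
  by rewrite expf_eq0 => /andP[].
pose embS : {rmorphism {mpoly k[N]} -> {fraction E}} := tofrac \o rho.
have embS_inj n F : S n F -> embS F = 0 -> F = 0.
  by move=> hF /eqP; rewrite /= tofrac_eq0 => /eqP; apply: rho_inj hF.
have dS : (0 < Nb * r.+1)%N by rewrite muln_gt0 Nb_gt0.
pose cS := Chart dS hb' nb' embS_inj.
(* Degree [K.+1] rather than [K], since the denominator of a chart must have positive degree. *)
have [K hK] := dehom_surj B; have [c hc ec] := hK K.+1 (leqnSn K).
have nc : c != 0 by apply: contraNneq nB => c0; rewrite -ec c0 rmorph0.
pose embT : {rmorphism {mpoly k[M.+1]} -> {fraction E}} := tofrac \o (phi \o @dehom k M).
have embT_inj n G : T n G -> embT G = 0 -> G = 0.
  by move=> hG /eqP; rewrite /= tofrac_eq0 => /eqP /phi0; apply: dehom_inj hG.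
pose cT := @Chart _ _ T _ embT K.+1 c (ltn0Sn K) hc nc embT_inj.
apply: (@birational_charts _ _ _ _ _ _ cS cT); last first.
  by move=> a; rewrite /= dehomC rho_phi_const.
have nfB : tofrac (phi B) != 0.
  by rewrite tofrac_eq0; apply: contraNneq nB => /phi0 ->.
have nfBX l : tofrac (phi B) ^+ l != 0 by rewrite expf_neq0.
apply/seteqP; split=> x.
- move=> [j [F [hF ->]]] /=; rewrite eb'.
  have [P eP] : exists P, rho F = phi P by apply: (@rho_phi (r.+1 * j)); rewrite mulnA.
  have [L hL] := dehom_surj P; have [G hG eG] := hL L (leqnn L).
  have [c0 hc0 ec0] := hK K (leqnn K).
  (* The numerator must have the degree of [c ^+ (L + r2 * j)]; ['X_ord0], which dehomogenizes to 1,
     fills the gap. *)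
  pose pad := (K.+1 * (L + r2 * j) - (L + K * L))%N.
  exists (L + r2 * j)%N, (G * c0 ^+ L * 'X_ord0 ^+ pad); split.
    have -> : (K.+1 * (L + r2 * j) = L + K * L + 1 * pad)%N by rewrite /pad; nia.
    apply: (@pieceM _ _ T); last by apply: (@pieceX _ _ T); rewrite /= /all_forms /= dhomogX /= mdeg1.
    by apply: (@pieceM _ _ T) => //; apply: (@pieceX _ _ T).
  have e1 : dehom 'X_ord0 = 1 :> {mpoly k[M]}.
    rewrite dehomX; have -> : mtail U_(ord0) = 0%MM :> 'X_{1..M} by apply/mnmP => i; rewrite !mnmE.
    by rewrite mpolyX0.
  have e2 : dehom (G * c0 ^+ L * 'X_ord0 ^+ pad) = P * B ^+ L.
    by rewrite rmorphM rmorphM /= !rmorphXn /= eG ec0 e1 expr1n mulr1.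
  rewrite /= e2 ec eP !rmorphM !rmorphXn /= -exprM.
  apply/eqP; rewrite eqr_div ?expf_neq0 // -!mulrA -!exprD; apply/eqP.
  by congr (_ * _ ^+ _); lia.
- move=> [j [G [hG ->]]].
  have [r1 [F [hF eF]]] := lift_poly (dehom G).
  (* With this exponent the numerator has the degree of [b' ^+ (j + r1)], and exactly [B ^+ j]
     remains in the denominator. *)
  pose s := (j + r * j)%N.
  exists (j + r1)%N, (F * num ^+ r1 * b ^+ s); split.
    have -> : (Nb * r.+1 * (j + r1) = Nb * r1 + Nb * r * r1 + Nb * s)%N by rewrite /s; nia.
    by apply: pieceM; [apply: pieceM => //|]; apply: pieceX.
  have e : rho (F * num ^+ r1 * b ^+ s) = phi (dehom G) * phi B ^+ (r2 * r1 + r.+1 * j).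
    rewrite rmorphM [rho (F * _)]rmorphM !rmorphXn eF enum eB rmorphXn -exprM -!mulrA -!exprD.
    by congr (_ * _ ^+ _); rewrite /s er2; nia.
    rewrite /= e ec eb' !rmorphM !rmorphXn /= -exprM.
  apply/eqP; rewrite eqr_div ?expf_neq0 // -!mulrA -!exprD; apply/eqP.
  by congr (_ * _ ^+ _); rewrite er2; nia.
Qed.
End RationalityCriterion.

(** * The action of GL_2 *)

Lemma mpoly_rmorph_ext (R : nzRingType) (B : nzRingType) (n : nat)
    (F G : {rmorphism {mpoly R[n]} -> B}) :
  (forall c, F c%:MP = G c%:MP) -> (forall i, F 'X_i = G 'X_i) -> F =1 G.
Proof.
move=> hC hX p; rewrite [p]mpolyE !rmorph_sum; apply: eq_bigr => m _ /=.
rewrite -mul_mpolyC !rmorphM hC; congr (_ * _).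
by rewrite mpolyXE_id !rmorph_prod; apply: eq_bigr => i _; rewrite !rmorphXn hX.
Qed.

Lemma sum_I2 (V : nmodType) (F : 'I_2 -> V) : \sum_i F i = F 0 + F 1.
Proof. by rewrite big_ord_recl big_ord1; congr (_ + F _); apply: val_inj. Qed.

#[local] Opaque act.

Section Evaluation.

Variables (d e : nat).
Local Notation form A := 'M[A]_(d.+1, e.+1).
Implicit Types A B : comNzRingType.

Definition ev A (a : form A) (x0 x1 y0 y1 : A) : A :=
  \sum_i \sum_j a i j * (x0 ^+ (d - i) * x1 ^+ i * (y0 ^+ (e - j) * y1 ^+ j)).

Definition tup4 A (x0 x1 y0 y1 : A) : 'I_4 -> A := tnth [tuple x0; x1; y0; y1].

Lemma ev_map A B (f : {rmorphism A -> B}) a x0 x1 y0 y1 :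
  f (ev a x0 x1 y0 y1) = ev (map_mx f a) (f x0) (f x1) (f y0) (f y1).
Proof.
rewrite rmorph_sum; apply: eq_bigr => i _; rewrite rmorph_sum; apply: eq_bigr => j _.
by rewrite !rmorphM !rmorphXn mxE.
Qed.

Lemma mmap_biform A B (f : {rmorphism A -> B}) a x0 x1 y0 y1 :
  mmap f (tup4 x0 x1 y0 y1) (biform a) = ev (map_mx f a) x0 x1 y0 y1.
Proof.
rewrite /biform rmorph_sum; apply: eq_bigr => i _; rewrite rmorph_sum.
apply: eq_bigr => j _; rewrite /= mmapZ mxE mmapX; congr (_ * _).
rewrite /mmap1 !big_ord_recl big_ord0 mulr1 /tup4 /bimon /fun_of_multinom.
by rewrite !(tnth_nth 0%N) !(tnth_nth 0) /= !mulrA.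
Qed.

Lemma mmap_comp_mpoly A B (f : {rmorphism A -> B}) n m (t : n.-tuple {mpoly A[m]})
    (h : 'I_m -> B) p :
  mmap f h (p \mPo t) = mmap f (fun i => mmap f h (tnth t i)) p.
Proof.
move: p; apply: (@mpoly_rmorph_ext _ _ _ (mmap f h \o comp_mpoly t)) => [c|i] /=.
  by rewrite comp_mpolyC !mmapC.
by rewrite comp_mpolyXU -tnth_nth mmapX mmap1U.
Qed.

Lemma ev_act_map A B (f : {rmorphism A -> B}) g a x0 x1 y0 y1 :
  ev (map_mx f (act g a)) x0 x1 y0 y1 =
  ev (map_mx f a) (f (g 0 0) * x0 + f (g 0 1) * x1) (f (g 1 0) * x0 + f (g 1 1) * x1)
     (f (g 0 0) * y0 + f (g 0 1) * y1) (f (g 1 0) * y0 + f (g 1 1) * y1).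
Proof.
rewrite -!mmap_biform biform_act mmap_comp_mpoly.
congr (mmap f _ _); apply/funext => i; rewrite /diag_subst !(tnth_nth 0).
have e0 : mmap f (tup4 x0 x1 y0 y1) 'X_0 = x0 by rewrite mmapX mmap1U.
have e1 : mmap f (tup4 x0 x1 y0 y1) 'X_1 = x1 by rewrite mmapX mmap1U.
have e2 : mmap f (tup4 x0 x1 y0 y1) 'X_2 = y0 by rewrite mmapX mmap1U.
have e3 : mmap f (tup4 x0 x1 y0 y1) 'X_3 = y1 by rewrite mmapX mmap1U.
rewrite /tup4 (tnth_nth 0).
by case: i => [[|[|[|[|//]]]]] /= _; rewrite mmapD !mmapZ ?e0 ?e1 ?e2 ?e3.
Qed.

Lemma ev_act A g (a : form A) x0 x1 y0 y1 :
  ev (act g a) x0 x1 y0 y1 =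
  ev a (g 0 0 * x0 + g 0 1 * x1) (g 1 0 * x0 + g 1 1 * x1)
       (g 0 0 * y0 + g 0 1 * y1) (g 1 0 * y0 + g 1 1 * y1).
Proof.
have idE (b : form A) : map_mx idfun b = b by apply/matrixP => i j; rewrite mxE.
by rewrite -[act g a]idE (ev_act_map idfun) idE.
Qed.

(** Evaluating at two indeterminates recovers the coefficients. Identities between forms are thereby
    reduced to substitutions in [ev]. *)
Lemma ev_inj A (a b : form A) :
  (forall B (f : {rmorphism A -> B}) x0 x1 y0 y1,
     ev (map_mx f a) x0 x1 y0 y1 = ev (map_mx f b) x0 x1 y0 y1) -> a = b.
Proof.
pose CC : {rmorphism A -> {poly {poly A}}} := polyC \o polyC.
move=> /(_ _ CC 1 ('X%:P) 1 'X) E.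
have coefE (c : form A) (i : 'I_d.+1) (j : 'I_e.+1) :
    ((ev (map_mx CC c) 1 ('X%:P) 1 'X)`_j)`_i = c i j.
  transitivity (\sum_i' \sum_j' c i' j' * (i == i' :> nat)%:R * (j == j' :> nat)%:R).
    rewrite !coef_sum; apply: eq_bigr => i' _; rewrite !coef_sum; apply: eq_bigr => j' _.
    rewrite mxE !expr1n !mul1r /= -rmorphXn mulrA -rmorphM coefCM coefXn.
    rewrite mul_polyC; by case: (j == j' :> nat); rewrite ?mulr1 ?mulr0 ?coef0 // coefZ coefXn.
  rewrite (bigD1 i) //= (bigD1 j) //= !eqxx !mulr1.
  rewrite big1 ?addr0 ?big1 ?addr0 // => [i' ni|j' nj].
    rewrite big1 // => j' _; case: eqP => [E2|]; last by rewrite mulr0 mul0r.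
    by case/eqP: ni; apply: val_inj.
  case: eqP => [E2|]; last by rewrite mulr0.
  by case/eqP: nj; apply: val_inj.
by apply/matrixP => i j; rewrite -!coefE E.
Qed.

Lemma map_act A B (f : {rmorphism A -> B}) g (a : form A) :
  map_mx f (act g a) = act (map_mx f g) (map_mx f a).
Proof.
apply: ev_inj => C h x0 x1 y0 y1.
by rewrite ev_act_map -!map_mx_comp ev_act_map !mxE.
Qed.

(** Substitution acts from the right, hence the reversed product. *)
Lemma act_comp A g h (a : form A) : act g (act h a) = act (h *m g) a.
Proof.
apply: ev_inj => B f x0 x1 y0 y1.
apply: etrans (ev_act_map f g (act h a) _ _ _ _) _.
apply: etrans (ev_act_map f h a _ _ _ _) _.
apply: etrans (esym (ev_act_map f (h *m g) a _ _ _ _)); apply: esym.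
by rewrite ![(h *m g) _ _]mxE !sum_I2 !rmorphD !rmorphM; congr ev; ring.
Qed.

Lemma ev_scale A (a : form A) t x0 x1 y0 y1 :
  ev a (t * x0) (t * x1) (t * y0) (t * y1) = t ^+ (d + e) * ev a x0 x1 y0 y1.
Proof.
rewrite /ev mulr_sumr; apply: eq_bigr => i _; rewrite mulr_sumr; apply: eq_bigr => j _.
have -> : t ^+ (d + e) = t ^+ (d - i) * t ^+ i * (t ^+ (e - j) * t ^+ j).
  by rewrite -!exprD; congr (_ ^+ _); have := ltn_ord i; have := ltn_ord j; lia.
by rewrite !exprMn; ring.
Qed.

Lemma ev_scalel A (a : form A) t x0 x1 y0 y1 :
  ev (t *: a) x0 x1 y0 y1 = t * ev a x0 x1 y0 y1.
Proof.
rewrite /ev mulr_sumr; apply: eq_bigr => i _; rewrite mulr_sumr; apply: eq_bigr => j _.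
by rewrite mxE -(mulrA t).
Qed.

Lemma act_scaler A g t (a : form A) : act g (t *: a) = t *: act g a.
Proof.
apply: ev_inj => B f x0 x1 y0 y1.
by rewrite ev_act_map !map_mxZ !ev_scalel ev_act_map.
Qed.

Lemma act_scalel A g t (a : form A) :
  act (t *: g) a = t ^+ (d + e) *: act g a.
Proof.
apply: ev_inj => B f x0 x1 y0 y1.
rewrite ev_act_map map_mxZ ev_scalel ev_act_map rmorphXn -ev_scale !mxE !rmorphM.
by congr ev; ring.
Qed.

Definition diag2 A (p q : A) : 'M[A]_2 := \matrix_(i, j) (if i == j then if i == 0 then p else q else 0).

Definition anti2 A (p q : A) : 'M[A]_2 := \matrix_(i, j) (if i == j then 0 else if i == 0 then p else q).

Lemma act_diag A p q (a : form A) i j :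
  act (diag2 p q) a i j = p ^+ (d + e - (i + j)) * q ^+ (i + j) * a i j.
Proof.
suff -> : act (diag2 p q) a = \matrix_(i, j) (p ^+ (d + e - (i + j)) * q ^+ (i + j) * a i j).
  by rewrite mxE.
apply: ev_inj => B f x0 x1 y0 y1; rewrite ev_act_map !mxE /= rmorph0 !mul0r !addr0 !add0r.
rewrite /ev; apply: eq_bigr => i' _; apply: eq_bigr => j' _; rewrite !mxE !rmorphM !rmorphXn.
have -> : (d + e - (i' + j') = (d - i') + (e - j'))%N.
  by have := ltn_ord i'; have := ltn_ord j'; lia.
by rewrite !exprMn !exprD; ring.
Qed.

Lemma act_anti A p q (a : form A) i j :
  act (anti2 p q) a i j =
  p ^+ (i + j) * q ^+ (d + e - (i + j)) * a (rev_ord i) (rev_ord j).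
Proof.
suff -> : act (anti2 p q) a = \matrix_(i, j)
    (p ^+ (i + j) * q ^+ (d + e - (i + j)) * a (rev_ord i) (rev_ord j)).
  by rewrite mxE.
apply: ev_inj => B f x0 x1 y0 y1; rewrite ev_act_map !mxE /= rmorph0 !mul0r !addr0 !add0r.
rewrite /ev (reindex_inj rev_ord_inj) /=; apply: eq_bigr => i' _.
rewrite (reindex_inj rev_ord_inj) /=; apply: eq_bigr => j' _; rewrite !mxE !rmorphM !rmorphXn.
have li := ltn_ord i'; have lj := ltn_ord j'.
have -> : (d + e - (i' + j') = (d - i') + (e - j'))%N by lia.
have -> : (d - (d.+1 - i'.+1) = i')%N by lia.
have -> : (e - (e.+1 - j'.+1) = j')%N by lia.
rewrite !subSS !exprMn !exprD; ring.
Qed.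

End Evaluation.

Lemma prod_I2 (R : pzSemiRingType) (F : 'I_2 -> R) : \prod_i F i = F 0 * F 1.
Proof. by rewrite big_ord_recl big_ord1; congr (_ * F _); apply: val_inj. Qed.

Lemma det2E (C : comNzRingType) (g : 'M[C]_2) :
  \det g = g 0 0 * g 1 1 - g 0 1 * g 1 0.
Proof.
rewrite (expand_det_row _ 0) sum_I2 /cofactor !det_mx11 !mxE /= expr0 mul1r expr1.
rewrite mulN1r mulrN; congr (_ * g _ _ - _ * g _ _); exact: val_inj.
Qed.

(** * Binary forms *)

Section BinaryForms.

Implicit Types C B : comNzRingType.

Definition mon2 (a b : nat) : 'X_{1..2} := [multinom [:: a; b]].

Lemma mon2E a b : (mon2 a b 0 = a) * (mon2 a b 1 = b).
Proof. by rewrite /mon2 /fun_of_multinom !(tnth_nth 0%N). Qed.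

Lemma mon2_eq (m : 'X_{1..2}) a b : m 0 = a -> m 1 = b -> m = mon2 a b.
Proof.
move=> h0 h1; apply/mnmP => i; case: (unliftP 0 i) => [j|] ->; last by rewrite h0 mon2E.
by rewrite (ord1 j) (_ : lift 0 0 = 1) ?h1 ?mon2E //; apply: val_inj.
Qed.

Lemma mon2_inj a b a' b' : mon2 a b = mon2 a' b' -> a = a' /\ b = b'.
Proof.
move=> h; have /(congr1 (fun m : 'X_{1..2} => m 0)) := h.
by have /(congr1 (fun m : 'X_{1..2} => m 1)) := h; rewrite !mon2E.
Qed.

Lemma mon2_eqE a b a' b' : (mon2 a b == mon2 a' b') = (a == a') && (b == b').
Proof.
apply/eqP/andP => [/mon2_inj[-> ->]|[/eqP -> /eqP ->]] //; by rewrite !eqxx.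
Qed.

Lemma mdeg_mon2 a b : mdeg (mon2 a b) = (a + b)%N.
Proof. by rewrite mdegE sum_I2 !mon2E. Qed.

Lemma X2E C a b : 'X_0 ^+ a * 'X_1 ^+ b = 'X_[mon2 a b] :> {mpoly C[2]}.
Proof.
by rewrite [RHS]mpolyXE_id prod_I2 !mon2E.
Qed.

Lemma form2E C D (p : {mpoly C[2]}) : p \is D.-homog ->
  p = \sum_(l < D.+1) p@_(mon2 (D - l) l) *: ('X_0 ^+ (D - l) * 'X_1 ^+ l).
Proof.
move=> /dhomogP hp; apply/mpolyP => m; rewrite raddf_sum /=.
under eq_bigr do rewrite X2E mcoeffZ mcoeffX.
have [mp|mp] := boolP (m \in msupp p); last first.
  rewrite (memN_msupp_eq0 mp) big1 // => l _; case: eqP => [E|]; last by rewrite mulr0.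
  by rewrite E (memN_msupp_eq0 mp) mul0r.
have md := hp _ mp; rewrite /= mdegE sum_I2 in md.
have l1 : (m 1%R < D.+1)%N by rewrite ltnS -md leq_addl.
have em : m = mon2 (D - m 1%R) (m 1%R) by apply: mon2_eq => //; rewrite -md addnK.
rewrite (bigD1 (Ordinal l1)) //= -em eqxx mulr1 big1 ?addr0 // => l nl.
case: eqP => [E|]; last by rewrite mulr0.
case/eqP: nl; apply: val_inj; rewrite /= -E; exact: (esym (mon2E _ _).2).
Qed.

Lemma form2_eval C B (f : {rmorphism C -> B}) (h : 'I_2 -> B) D (p : {mpoly C[2]}) :
  p \is D.-homog ->
  mmap f h p = \sum_(l < D.+1) f p@_(mon2 (D - l) l) * (h 0 ^+ (D - l) * h 1 ^+ l).
Proof.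
move=> hp; rewrite {1}(form2E hp) rmorph_sum; apply: eq_bigr => l _ /=.
by rewrite mmapZ rmorphM !rmorphXn /= !mmapX !mmap1U.
Qed.

(* The classical invariant pairing (transvectant of order D) of binary forms. *)
Definition pairing C D (p c : {mpoly C[2]}) : C :=
  \sum_(l < D.+1) (-1) ^+ l * (l`! * (D - l)`!)%:R * p@_(mon2 (D - l) l)
     * c@_(mon2 l (D - l)).

Lemma pairing_map C B (f : {rmorphism C -> B}) D p c :
  f (pairing D p c) = pairing D (map_mpoly f p) (map_mpoly f c).
Proof.
rewrite rmorph_sum; apply: eq_bigr => l _.
by rewrite !(rmorphM f) rmorph_sign rmorph_nat !mcoeff_map_mpoly.
Qed.

Lemma pairingDr C D (p c1 c2 : {mpoly C[2]}) :
  pairing D p (c1 + c2) = pairing D p c1 + pairing D p c2.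
Proof. by rewrite -big_split; apply: eq_bigr => l _ /=; rewrite mcoeffD mulrDr. Qed.

Lemma pairing0r C D (p : {mpoly C[2]}) : pairing D p 0 = 0.
Proof. by apply: big1 => l _; rewrite mcoeff0 mulr0. Qed.

Lemma pairing_sumr C D (p : {mpoly C[2]}) I (r : seq I) (P : pred I) E :
  pairing D p (\sum_(i <- r | P i) E i) = \sum_(i <- r | P i) pairing D p (E i).
Proof. exact: (big_morph _ (@pairingDr C D p) (pairing0r D p)). Qed.

Lemma pairingZr C D t (p c : {mpoly C[2]}) : pairing D p (t *: c) = t * pairing D p c.
Proof.
by rewrite /pairing mulr_sumr; apply: eq_bigr => l _; rewrite mcoeffZ mulrCA.
Qed.

Lemma pairingZl C D t (p c : {mpoly C[2]}) : pairing D (t *: p) c = t * pairing D p c.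
Proof.
rewrite /pairing mulr_sumr; apply: eq_bigr => l _; rewrite mcoeffZ; ring.
Qed.

Lemma pairing_mon C D (p : {mpoly C[2]}) (l : 'I_D.+1) :
  pairing D p ('X_0 ^+ (D - l) * 'X_1 ^+ l) =
  (-1) ^+ (D - l) * ((D - l)`! * l`!)%:R * p@_(mon2 l (D - l)).
Proof.
rewrite X2E /pairing (bigD1 (rev_ord l)) //= mcoeffX mon2_eqE subSS.
have h : (D - (D - l) = l)%N by have := ltn_ord l; lia.
rewrite h !eqxx mulr1 big1 ?addr0 // => i ni; rewrite mcoeffX mon2_eqE.
case: eqP => [E|]; last by rewrite /= mulr0.
by case/eqP: ni; apply: val_inj; rewrite /= subSS -E; have := ltn_ord i; lia.
Qed.

(** The point of evaluation [(be, - al)] is the zero of the linear form. The behaviour of the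
    pairing under substitution is derived from this case. *)
Lemma pairing_power C D (p : {mpoly C[2]}) (al be : C) : p \is D.-homog ->
  pairing D p ((al *: 'X_0 + be *: 'X_1) ^+ D) =
  D`!%:R * mmap idfun (fun i : 'I_2 => if i == 0 then be else - al) p.
Proof.
move=> hp; rewrite (form2_eval idfun _ hp) mulr_sumr exprDn pairing_sumr.
rewrite (reindex_inj rev_ord_inj); apply: eq_bigr => l _ /=; rewrite subSS.
have lD := ltn_ord l; have h : (D - (D - l) = l)%N by lia.
rewrite h !exprZn -scalerAl -scalerAr scalerA -scaler_nat scalerA pairingZr.
have := pairing_mon p (rev_ord l); rewrite /= subSS h => E.
rewrite E.
have -> : D`!%:R = ('C(D, D - l) * (l`! * (D - l)`!))%:R :> C.
  by rewrite -(@bin_fact D (D - l)) ?leq_subr // h [((D - l)`! * _)%N]mulnC.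
rewrite !natrM [(- al) ^+ _]exprNn; ring.
Qed.

Definition subst2 C (g : 'M[C]_2) : {mpoly C[2]} -> {mpoly C[2]} :=
  comp_mpoly [tuple g 0 0 *: 'X_0 + g 0 1 *: 'X_1; g 1 0 *: 'X_0 + g 1 1 *: 'X_1].

HB.instance Definition _ C g := GRing.RMorphism.on (@subst2 C g).
HB.instance Definition _ C g := GRing.Linear.on (@subst2 C g).

Lemma subst2_sum C (g : 'M[C]_2) I (r : seq I) (P : pred I) E :
  subst2 g (\sum_(i <- r | P i) E i) = \sum_(i <- r | P i) subst2 g (E i).
Proof. exact: (raddf_sum (comp_mpoly _)). Qed.

Lemma subst2Z C (g : 'M[C]_2) t p : subst2 g (t *: p) = t *: subst2 g p.
Proof. exact: comp_mpolyZ. Qed.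

Lemma subst2X C (g : 'M[C]_2) i :
  subst2 g 'X_i = g i 0 *: 'X_0 + g i 1 *: 'X_1.
Proof.
rewrite /subst2 comp_mpolyXU; case: (unliftP 0 i) => [j|] -> //=.
by rewrite (ord1 j) (_ : lift 0 0 = 1) //; apply: val_inj.
Qed.

Lemma subst2C C (g : 'M[C]_2) c : subst2 g c%:MP = c%:MP.
Proof. exact: comp_mpolyC. Qed.

Lemma map_subst2 C B (f : {rmorphism C -> B}) (g : 'M[C]_2) p :
  map_mpoly f (subst2 g p) = subst2 (map_mx f g) (map_mpoly f p).
Proof.
move: p; apply: (@mpoly_rmorph_ext _ _ _ (map_mpoly f \o subst2 g)
   (subst2 (map_mx f g) \o map_mpoly f)) => [c|i] /=.
  by rewrite subst2C !map_mpolyC subst2C.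
by rewrite subst2X rmorphD /= !map_mpolyZ !map_mpolyX subst2X !mxE.
Qed.

Lemma mmap_subst2 C B (f : {rmorphism C -> B}) (h : 'I_2 -> B) (g : 'M[C]_2) p :
  mmap f h (subst2 g p) = mmap f (fun i => f (g i 0) * h 0 + f (g i 1) * h 1) p.
Proof.
rewrite /subst2 mmap_comp_mpoly; congr (mmap f _ p); apply/funext => i.
rewrite (tnth_nth 0) -[nth _ _ _]/(nth 0 _ i) -comp_mpolyXU -/(subst2 g _) subst2X.
by rewrite mmapD !mmapZ !mmapX !mmap1U.
Qed.

Lemma subst2_homog C (g : 'M[C]_2) D p : p \is D.-homog -> subst2 g p \is D.-homog.
Proof.
move=> hp; rewrite (form2E hp) subst2_sum; apply: rpred_sum => l _ /=.
rewrite subst2Z; apply: rpredZ; rewrite rmorphM !rmorphXn /=.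
have h i : subst2 g 'X_i \is 1.-homog.
  by rewrite subst2X; apply: rpredD; apply: rpredZ; rewrite dhomogX /= mdeg1.
suff : subst2 g 'X_0 ^+ (D - l) * subst2 g 'X_1 ^+ l \is (1 * (D - l) + 1 * l).-homog.
  by rewrite !mul1n subnK // -ltnS.
by apply: dhomogM; apply: dhomogMn.
Qed.

(* Both sides are linear in c, and the powers (X_0 + m X_1)^D, m an
   indeterminate, suffice to separate linear forms in characteristic 0. *)
Lemma pairing_subst2 C D (g : 'M[C]_2) p c :
  (forall n (x : C), x *+ n.+1 = 0 -> x = 0) ->
  p \is D.-homog -> c \is D.-homog ->
  pairing D (subst2 g p) (subst2 g c) = \det g ^+ D * pairing D p c.
Proof.
move=> tf hp hc; rewrite (form2E hc) subst2_sum !pairing_sumr mulr_sumr.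
apply: eq_bigr => l _; rewrite subst2Z !pairingZr mulrCA; congr (_ * _).
pose L (l : 'I_D.+1) := pairing D (subst2 g p) (subst2 g ('X_0 ^+ (D - l) * 'X_1 ^+ l)).
pose f : {rmorphism C -> {poly C}} := polyC.
have [gf egf] : exists gf, gf = map_mx f g by eexists.
have [pf epf] : exists pf, pf = map_mpoly f p by eexists.
have hpf : pf \is D.-homog.
  rewrite epf (form2E hp) raddf_sum; apply: rpred_sum => i _ /=.
  by rewrite map_mpolyZ X2E map_mpolyX; apply: rpredZ; rewrite dhomogX /= mdeg_mon2 subnK // -ltnS.
have E : pairing D (subst2 gf pf) (subst2 gf (('X_0 + 'X *: 'X_1) ^+ D)) =
   \sum_(l < D.+1) (L l *+ 'C(D, l))%:P * 'X ^+ l.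
  rewrite exprDn subst2_sum pairing_sumr; apply: eq_bigr => i _.
  rewrite -scaler_nat subst2Z pairingZr exprZn -scalerAr subst2Z pairingZr.
  have <- : (L i)%:P = pairing D (subst2 gf pf) (subst2 gf ('X_0 ^+ (D - i) * 'X_1 ^+ i)).
    rewrite -[(L i)%:P]/(f (L i)) /L pairing_map !map_subst2 -egf -epf; congr pairing.
    by congr (subst2 _ _); rewrite rmorphM !rmorphXn /= !map_mpolyX.
  rewrite rmorphMn /= -mulr_natl; ring.
have E2 : pairing D (subst2 gf pf) (subst2 gf (('X_0 + 'X *: 'X_1) ^+ D)) =
   \sum_(i < D.+1) (D`!%:R * \det g ^+ D * (-1) ^+ i * p@_(mon2 (D - i) i))%:P * 'X ^+ (D - i).
  have -> : subst2 gf (('X_0 + 'X *: 'X_1) ^+ D) =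
      ((gf 0 0 + 'X * gf 1 0) *: 'X_0 + (gf 0 1 + 'X * gf 1 1) *: 'X_1) ^+ D.
    rewrite rmorphXn rmorphD /= subst2Z !subst2X; congr (_ ^+ _).
    by rewrite scalerDr !scalerA !scalerDl addrACA.
  rewrite pairing_power ?subst2_homog // mmap_subst2 (form2_eval _ _ hpf) mulr_sumr.
  apply: eq_bigr => i _; rewrite epf mcoeff_map_mpoly /= egf !mxE.
  have -> : (g 0 0)%:P * ((g 0 1)%:P + 'X * (g 1 1)%:P) +
     (g 0 1)%:P * - ((g 0 0)%:P + 'X * (g 1 0)%:P) = 'X * (\det g)%:P :> {poly C}.
    by rewrite det2E rmorphB !rmorphM /=; ring.
  have -> : (g 1 0)%:P * ((g 0 1)%:P + 'X * (g 1 1)%:P) +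
     (g 1 1)%:P * - ((g 0 0)%:P + 'X * (g 1 0)%:P) = - (\det g)%:P :> {poly C}.
    by rewrite det2E rmorphB !rmorphM /=; ring.
  rewrite [(- (\det g)%:P) ^+ i]exprNn exprMn !rmorphM /= !rmorphXn /= rmorphN rmorph1 polyC_natr.
  have -> : (\det g)%:P ^+ D = (\det g)%:P ^+ (D - i) * (\det g)%:P ^+ i :> {poly C}.
    by rewrite -exprD subnK // -ltnS.
  ring.
(* The coefficient of ['X^l] gives the claim multiplied by a binomial coefficient, which
   torsion-freeness removes. *)
have := congr1 (fun q : {poly C} => q`_l) (etrans (esym E) E2).
rewrite !coef_sum (bigD1 l) //= coefCM coefXn eqxx mulr1 big1 ?addr0; last first.
  move=> i ni; rewrite coefCM coefXn; case: eqP => [e|]; last by rewrite mulr0.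
  by case/eqP: ni; apply: val_inj.
rewrite (bigD1 (rev_ord l)) //= coefCM coefXn subSS.
have lD := ltn_ord l; have h : (D - (D - l) = l)%N by lia.
rewrite h eqxx mulr1 big1 ?addr0; last first.
  move=> i ni; rewrite coefCM coefXn; case: eqP => [e|]; last by rewrite mulr0.
  by case/eqP: ni; apply: val_inj; rewrite /= subSS e; have := ltn_ord i; lia.
move=> E3; apply/eqP; rewrite -subr_eq0; apply/eqP.
have bpos : (0 < 'C(D, l))%N by rewrite bin_gt0 -ltnS.
apply: (tf ('C(D, l)).-1); rewrite prednK // mulrnBl -/(L l) E3 pairing_mon.
have -> : D`!%:R = 'C(D, l)%:R * (l`!%:R * (D - l)`!%:R) :> C.
  by rewrite -!natrM bin_fact // -ltnS.
rewrite -[X in _ - X]mulr_natl [((D - l)`! * l`!)%:R]natrM.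
move: ('C(D, l)%:R) (l`!%:R) ((D - l)`!%:R) => /= x y z; ring.
Qed.

End BinaryForms.

(** * The quadratic covariant *)

Section Covariants.

Variables (d e : nat).
Local Notation form A := 'M[A]_(d.+1, e.+1).
Implicit Types A B : comNzRingType.
Local Notation n := (d + e)%N.

Definition lev (i : 'I_d.+1) (j : 'I_e.+1) : nat := (i + j)%N.

(** This is (d - i) j - i (e - j), the factor that d^2/dx_0 dy_1 - d^2/dx_1 dy_0 produces on the
    monomial of index (i, j). *)
Definition omega_coef A (i : 'I_d.+1) (j : 'I_e.+1) : A := (d * j)%:R - (e * i)%:R.

Definition level_sum A (a : form A) (l : nat) : A :=
  \sum_i \sum_(j | lev i j == l) a i j.

Definition omega_sum A (a : form A) (l : nat) : A :=
  \sum_i \sum_(j | lev i j == l) omega_coef A i j * a i j.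

(* The restriction of f to the diagonal, and that of (d^2/dx_0 dy_1 - d^2/dx_1 dy_0) f. *)
Definition diag_form A (a : form A) : {mpoly A[2]} :=
  \sum_i \sum_j a i j *: ('X_0 ^+ (n - lev i j) * 'X_1 ^+ lev i j).

Definition omega_form A (a : form A) : {mpoly A[2]} :=
  \sum_i \sum_j (omega_coef A i j * a i j) *:
     ('X_0 ^+ (n - lev i j).-1 * 'X_1 ^+ (lev i j).-1).

Lemma lev_le (i : 'I_d.+1) (j : 'I_e.+1) : (lev i j <= n)%N.
Proof. by rewrite /lev; have := ltn_ord i; have := ltn_ord j; lia. Qed.

(** Vanishing here and at level [n] makes the truncated predecessors in [omega_form] harmless and
    keeps both corner entries out of R. *)
Lemma omega_coef0 A (i : 'I_d.+1) (j : 'I_e.+1) : lev i j = 0%N -> omega_coef A i j = 0.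
Proof.
rewrite /lev /omega_coef => /eqP; rewrite addn_eq0 => /andP[/eqP -> /eqP ->].
by rewrite !muln0 subrr.
Qed.

Lemma omega_coefn A (i : 'I_d.+1) (j : 'I_e.+1) : lev i j = n -> omega_coef A i j = 0.
Proof.
rewrite /lev /omega_coef => h; have li := ltn_ord i; have lj := ltn_ord j.
have -> : (i = d :> nat)%N by lia.
have -> : (j = e :> nat)%N by lia.
by rewrite mulnC subrr.
Qed.

Lemma level_sum_map A B (f : {rmorphism A -> B}) a l :
  f (level_sum a l) = level_sum (map_mx f a) l.
Proof.
rewrite rmorph_sum; apply: eq_bigr => i _; rewrite rmorph_sum.
by apply: eq_bigr => j _; rewrite mxE.
Qed.

Lemma omega_coef_map A B (f : {rmorphism A -> B}) i j :
  f (omega_coef A i j) = omega_coef B i j.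
Proof. by rewrite rmorphB !rmorph_nat. Qed.

Lemma omega_sum_map A B (f : {rmorphism A -> B}) a l :
  f (omega_sum a l) = omega_sum (map_mx f a) l.
Proof.
rewrite rmorph_sum; apply: eq_bigr => i _; rewrite rmorph_sum.
by apply: eq_bigr => j _; rewrite rmorphM omega_coef_map mxE.
Qed.

Lemma diag_form_homog A (a : form A) : diag_form a \is n.-homog.
Proof.
apply: rpred_sum => i _; apply: rpred_sum => j _; apply: rpredZ.
by rewrite X2E dhomogX /= mdeg_mon2 subnK ?lev_le.
Qed.

Lemma diag_form_coef A (a : form A) l : (l <= n)%N ->
  (diag_form a)@_(mon2 (n - l) l) = level_sum a l.
Proof.
move=> ln; rewrite raddf_sum; apply: eq_bigr => i _; rewrite raddf_sum [RHS]big_mkcond.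
apply: eq_bigr => j _ /=; rewrite X2E mcoeffZ mcoeffX mon2_eqE.
have := lev_le i j; case: eqP => [E|E] /= h.
  have -> : lev i j = l by lia.
  by rewrite eqxx mulr1.
by case: eqP => [E2|_]; [rewrite E2 in E|rewrite mulr0].
Qed.

Lemma diag_form_ev A (a : form A) :
  diag_form a = ev (map_mx (@mpolyC 2 A) a) 'X_0 'X_1 'X_0 'X_1.
Proof.
apply: eq_bigr => i _; apply: eq_bigr => j _; rewrite mxE mul_mpolyC; congr (_ *: _).
have -> : (n - lev i j = (d - i) + (e - j))%N.
  by rewrite /lev; have := ltn_ord i; have := ltn_ord j; lia.
by rewrite /lev !exprD; ring.
Qed.

Lemma map_mx_mpolyC_act A (g : 'M[A]_2) (a : form A) :
  map_mx (@mpolyC 2 A) (act g a) = act (map_mx (@mpolyC 2 A) g) (map_mx (@mpolyC 2 A) a).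
Proof. exact: map_act. Qed.

Lemma diag_form_act A (g : 'M[A]_2) a : diag_form (act g a) = subst2 g (diag_form a).
Proof.
rewrite !diag_form_ev map_mx_mpolyC_act ev_act !mxE (ev_map (subst2 g)) -map_mx_comp /= !subst2X !mul_mpolyC.
by congr (ev _ _ _ _ _); apply/matrixP => i j; rewrite !mxE /= subst2C.
Qed.

(* Directional derivatives of f in the first and second pair of variables. *)
Definition dev1 A (a : form A) (z0 z1 x0 x1 y0 y1 : A) : A :=
  \sum_i \sum_j a i j * ((z0 * x0 ^+ (d - i).-1 *+ (d - i) * x1 ^+ i
      + z1 * x1 ^+ i.-1 *+ i * x0 ^+ (d - i)) * (y0 ^+ (e - j) * y1 ^+ j)).

Definition dev2 A (a : form A) (z0 z1 x0 x1 y0 y1 : A) : A :=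
  \sum_i \sum_j a i j * (x0 ^+ (d - i) * x1 ^+ i * (z0 * y0 ^+ (e - j).-1 *+ (e - j) * y1 ^+ j
      + z1 * y1 ^+ j.-1 *+ j * y0 ^+ (e - j))).

Lemma lin_exp_deriv0 A (x z : A) m :
  (((x%:P + z *: 'X) ^+ m)^`()).[0] = z * x ^+ m.-1 *+ m.
Proof.
rewrite deriv_exp derivD derivC add0r derivZ derivX alg_polyC hornerMn hornerM hornerC.
by rewrite horner_exp hornerD hornerZ hornerC hornerX mulr0 addr0.
Qed.

Lemma lin_exp_at0 A (x z : A) m : ((x%:P + z *: 'X) ^+ m).[0] = x ^+ m.
Proof. by rewrite horner_exp hornerD hornerZ hornerC hornerX mulr0 addr0. Qed.

Lemma dev1E A (a : form A) z0 z1 x0 x1 y0 y1 :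
  dev1 a z0 z1 x0 x1 y0 y1 =
  ((ev (map_mx polyC a) (x0%:P + z0 *: 'X) (x1%:P + z1 *: 'X) y0%:P y1%:P)^`()).[0].
Proof.
rewrite /ev raddf_sum horner_sum; apply: eq_bigr => i _.
rewrite raddf_sum horner_sum; apply: eq_bigr => j _ /=.
rewrite mxE -!rmorphXn -rmorphM derivM derivC mul0r add0r derivM derivC mulr0 addr0.
rewrite derivM !hornerM hornerD !hornerM !lin_exp_deriv0 !lin_exp_at0 !hornerC.
by congr (_ * (_ * _)); rewrite [x0 ^+ _ * _]mulrC.
Qed.

Lemma dev2E A (a : form A) z0 z1 x0 x1 y0 y1 :
  dev2 a z0 z1 x0 x1 y0 y1 =
  ((ev (map_mx polyC a) x0%:P x1%:P (y0%:P + z0 *: 'X) (y1%:P + z1 *: 'X))^`()).[0].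
Proof.
rewrite /ev raddf_sum horner_sum; apply: eq_bigr => i _.
rewrite raddf_sum horner_sum; apply: eq_bigr => j _ /=.
rewrite mxE -!rmorphXn -rmorphM derivM derivC mul0r add0r derivM derivC mul0r add0r.
rewrite derivM !hornerM hornerD !hornerM !lin_exp_deriv0 !lin_exp_at0 !hornerC.
by congr (_ * (_ * _)); rewrite [y0 ^+ _ * _]mulrC.
Qed.

Lemma dev1_act A (g : 'M[A]_2) a z0 z1 x0 x1 y0 y1 :
  dev1 (act g a) z0 z1 x0 x1 y0 y1 =
  dev1 a (g 0 0 * z0 + g 0 1 * z1) (g 1 0 * z0 + g 1 1 * z1)
         (g 0 0 * x0 + g 0 1 * x1) (g 1 0 * x0 + g 1 1 * x1)
         (g 0 0 * y0 + g 0 1 * y1) (g 1 0 * y0 + g 1 1 * y1).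
Proof.
rewrite !dev1E (ev_act_map polyC) /= !rmorphD !rmorphM /= !scalerDl -!mul_polyC !rmorphM.
by congr (_^`()).[0]; congr ev; ring.
Qed.

Lemma dev2_act A (g : 'M[A]_2) a z0 z1 x0 x1 y0 y1 :
  dev2 (act g a) z0 z1 x0 x1 y0 y1 =
  dev2 a (g 0 0 * z0 + g 0 1 * z1) (g 1 0 * z0 + g 1 1 * z1)
         (g 0 0 * x0 + g 0 1 * x1) (g 1 0 * x0 + g 1 1 * x1)
         (g 0 0 * y0 + g 0 1 * y1) (g 1 0 * y0 + g 1 1 * y1).
Proof.
rewrite !dev2E (ev_act_map polyC) /= !rmorphD !rmorphM /= !scalerDl -!mul_polyC !rmorphM.
by congr (_^`()).[0]; congr ev; ring.
Qed.

Definition omega_ev A (a : form A) (x0 x1 : A) : A :=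
  \sum_i \sum_j (omega_coef A i j * a i j) *
     (x0 ^+ (n - lev i j).-1 * x1 ^+ (lev i j).-1).

(** By Euler's identity the left side vanishes on the diagonal when z = x, so it is divisible by the
    determinant of z and x; the quotient is R. The covariance of R is thus reduced to that of
    directional derivatives, which is a substitution. *)
Lemma omega_evE A (a : form A) z0 z1 x0 x1 :
  e%:R * dev1 a z0 z1 x0 x1 x0 x1 - d%:R * dev2 a z0 z1 x0 x1 x0 x1 =
  omega_ev a x0 x1 * (z0 * x1 - z1 * x0).
Proof.
rewrite !mulr_sumr -sumrB mulr_suml; apply: eq_bigr => i _.
rewrite !mulr_sumr -sumrB mulr_suml; apply: eq_bigr => j _.
have li : (i <= d)%N by rewrite -ltnS.
have lj : (j <= e)%N by rewrite -ltnS.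
have nl : (n - lev i j = (d - i) + (e - j))%N by rewrite /lev; lia.
have pred (x : A) m k : m%:R * (x ^+ m.-1 * x ^+ k) = m%:R * x ^+ (m + k).-1.
  by case: m => [|m]; rewrite ?mul0r // -exprD.
have al : (d - i)%:R = d%:R - i%:R :> A by rewrite natrB.
have be : (e - j)%:R = e%:R - j%:R :> A by rewrite natrB.
transitivity (e%:R * a i j * (z0 * ((d - i)%:R * (x0 ^+ (d - i).-1 * x0 ^+ (e - j))) * (x1 ^+ i * x1 ^+ j)
     + z1 * (i%:R * (x1 ^+ i.-1 * x1 ^+ j)) * (x0 ^+ (d - i) * x0 ^+ (e - j)))
   - d%:R * a i j * (z0 * ((e - j)%:R * (x0 ^+ (e - j).-1 * x0 ^+ (d - i))) * (x1 ^+ i * x1 ^+ j)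
     + z1 * (j%:R * (x1 ^+ j.-1 * x1 ^+ i)) * (x0 ^+ (d - i) * x0 ^+ (e - j)))).
  rewrite -!(mulr_natl (_ * _)); ring.
rewrite !pred -!exprD [((e - j) + (d - i))%N]addnC [(j + i)%N]addnC -nl -/(lev i j) al be.
transitivity (omega_coef A i j * a i j *
    (z0 * x0 ^+ (n - lev i j).-1 * x1 ^+ lev i j - z1 * x1 ^+ (lev i j).-1 * x0 ^+ (n - lev i j))).
  by rewrite /omega_coef !natrM; ring.
have [z|z] := eqVneq (lev i j) 0%N; first by rewrite omega_coef0 // !mul0r.
have [z'|z'] := eqVneq (n - lev i j)%N 0%N.
  by rewrite omega_coefn ?mul0r //; have := lev_le i j; lia.
have -> : x1 ^+ lev i j = x1 * x1 ^+ (lev i j).-1 by rewrite -exprS prednK ?lt0n.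
have -> : x0 ^+ (n - lev i j) = x0 * x0 ^+ (n - lev i j).-1 by rewrite -exprS prednK ?lt0n.
ring.
Qed.

Lemma omega_ev_map A B (f : {rmorphism A -> B}) (a : form A) x0 x1 :
  f (omega_ev a x0 x1) = omega_ev (map_mx f a) (f x0) (f x1).
Proof.
rewrite rmorph_sum; apply: eq_bigr => i _; rewrite rmorph_sum; apply: eq_bigr => j _.
by rewrite !rmorphM !rmorphXn omega_coef_map mxE.
Qed.

Lemma omega_form_ev A (a : form A) :
  omega_form a = omega_ev (map_mx (@mpolyC 2 A) a) 'X_0 'X_1.
Proof.
apply: eq_bigr => i _; apply: eq_bigr => j _.
by rewrite mxE -(omega_coef_map (@mpolyC 2 A)) -rmorphM mul_mpolyC.
Qed.

Lemma omega_ev_act A (g : 'M[A]_2) (a : form A) z0 z1 x0 x1 :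
  omega_ev (act g a) x0 x1 * (z0 * x1 - z1 * x0) =
  \det g * omega_ev a (g 0 0 * x0 + g 0 1 * x1) (g 1 0 * x0 + g 1 1 * x1)
     * (z0 * x1 - z1 * x0).
Proof. by rewrite -omega_evE dev1_act dev2_act omega_evE det2E; ring. Qed.

Lemma mulX1_inj A (p q : {mpoly A[2]}) : p * 'X_1 = q * 'X_1 -> p = q.
Proof.
by move=> h; apply/mpolyP => m; rewrite -(mcoeffMX p U_(1)) h mcoeffMX.
Qed.

Lemma omega_form_act A (g : 'M[A]_2) a :
  omega_form (act g a) = \det g *: subst2 g (omega_form a).
Proof.
rewrite !omega_form_ev map_mx_mpolyC_act.
(* For the direction (1, 0) the determinant factor is the variable ['X_1], which cancels over any
   ring. *)
apply: mulX1_inj; have := omega_ev_act (map_mx (@mpolyC 2 A) g) (map_mx (@mpolyC 2 A) a) 1 0 'X_0 'X_1.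
rewrite mul1r mul0r subr0 => ->; congr (_ * _).
rewrite !mxE (omega_ev_map (subst2 g)) -map_mx_comp /= !subst2X !mul_mpolyC -[RHS]mul_mpolyC; congr (_ * _).
  by rewrite !det2E !mxE rmorphB !rmorphM.
by congr (omega_ev _ _ _); apply/matrixP => i j; rewrite !mxE /= subst2C.
Qed.

(* qform below is the transvectant of diag_form with omega_form times the square
   of the linear form vanishing at (z0, z1). *)
Definition qsum A (a : form A) (r : nat -> nat) : A :=
  \sum_(l < n.+1) (-1) ^+ l * (l`! * (n - l)`!)%:R * level_sum a l * omega_sum a (r (n - l)%N).

Definition q0 A (a : form A) : A := qsum a predn.
Definition q1 A (a : form A) : A := - 2 * qsum a id.
Definition q2 A (a : form A) : A := qsum a succn.

Definition qform A (a : form A) (z0 z1 : A) : A :=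
  q0 a * z0 ^+ 2 + q1 a * z0 * z1 + q2 a * z1 ^+ 2.

Lemma omega_form_coef A (a : form A) r s l :
  (r + s = 2)%N -> (l <= n)%N ->
  (omega_form a * ('X_0 ^+ r * 'X_1 ^+ s))@_(mon2 l (n - l)) =
  (if (s <= n - l + 1)%N then omega_sum a (n - l + 1 - s)%N else 0).
Proof.
move=> rs ln; rewrite mulr_suml raddf_sum /=.
transitivity (\sum_i \sum_j (omega_coef A i j * a i j *
    (lev i j + s == n - l + 1)%N%:R)).
  apply: eq_bigr => i _; rewrite mulr_suml raddf_sum; apply: eq_bigr => j _ /=.
  rewrite -scalerAl mulrACA -!exprD X2E mcoeffZ mcoeffX mon2_eqE.
  have [z|z] := eqVneq (lev i j) 0%N; first by rewrite omega_coef0 // !mul0r.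
  have [z'|z'] := eqVneq (n - lev i j)%N 0%N.
    by rewrite omega_coefn ?mul0r //; have := lev_le i j; lia.
  by congr (_ * _%:R); congr nat_of_bool; have := lev_le i j; lia.
case: leqP => h.
  apply: eq_bigr => i _; rewrite [RHS]big_mkcond; apply: eq_bigr => j _.
  rewrite -[in RHS](eqn_add2r s) subnK //; case: eqP => _; by rewrite ?mulr1 ?mulr0.
rewrite big1 // => i _; rewrite big1 // => j _.
by rewrite (_ : (_ == _) = false) ?mulr0 //; apply/negP => /eqP; lia.
Qed.

Definition omega_lin A (z0 z1 : A) : {mpoly A[2]} := z1 *: 'X_0 - z0 *: 'X_1.

Lemma omega_form_homog A (a : form A) r s : (r + s = 2)%N ->
  omega_form a * ('X_0 ^+ r * 'X_1 ^+ s) \is n.-homog.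
Proof.
move=> rs; rewrite mulr_suml; apply: rpred_sum => i _; rewrite mulr_suml.
apply: rpred_sum => j _; rewrite -scalerAl.
have [z|z] := eqVneq (lev i j) 0%N; first by rewrite omega_coef0 // mul0r scale0r rpred0.
have [z'|z'] := eqVneq (n - lev i j)%N 0%N.
  by rewrite omega_coefn ?mul0r ?scale0r ?rpred0 //; have := lev_le i j; lia.
rewrite mulrACA -!exprD X2E; apply: rpredZ; rewrite dhomogX /= mdeg_mon2.
by apply/eqP; have := lev_le i j; lia.
Qed.

Lemma omega_linX2 A (z0 z1 : A) : omega_lin z0 z1 ^+ 2 =
  z1 ^+ 2 *: ('X_0 ^+ 2 * 'X_1 ^+ 0) - (2 * z0 * z1) *: ('X_0 ^+ 1 * 'X_1 ^+ 1)
   + z0 ^+ 2 *: ('X_0 ^+ 0 * 'X_1 ^+ 2).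
Proof. by rewrite /omega_lin -!mul_mpolyC !rmorphXn /= !rmorphM /= rmorph_nat; ring. Qed.

Lemma omega_lin_homog A (a : form A) z0 z1 :
  omega_form a * omega_lin z0 z1 ^+ 2 \is n.-homog.
Proof.
rewrite omega_linX2 mulrDr mulrBr -!scalerAr.
by apply: rpredD; [apply: rpredB|]; apply: rpredZ; apply: omega_form_homog.
Qed.

Lemma qform_pairing A (a : form A) z0 z1 :
  qform a z0 z1 = pairing n (diag_form a) (omega_form a * omega_lin z0 z1 ^+ 2).
Proof.
pose t (l : 'I_n.+1) := (-1) ^+ l * (l`! * (n - l)`!)%:R * level_sum a l.
transitivity (\sum_(l < n.+1) (t l * omega_sum a (n - l).-1 * z0 ^+ 2
    + - 2 * (t l * omega_sum a (n - l)) * z0 * z1 + t l * omega_sum a (n - l).+1 * z1 ^+ 2)).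
  by rewrite !big_split /= -!mulr_suml -mulr_sumr.
apply: eq_bigr => l _; rewrite /t; have ln : (l <= n)%N by rewrite -ltnS.
rewrite diag_form_coef // omega_linX2 mulrDr mulrBr -!scalerAr !(mcoeffD, mcoeffN, mcoeffZ).
have -> : (omega_form a * ('X_0 ^+ 2 * 'X_1 ^+ 0))@_(mon2 l (n - l)) = omega_sum a (n - l).+1.
  by rewrite omega_form_coef // subn0 addn1.
have -> : (omega_form a * ('X_0 ^+ 1 * 'X_1 ^+ 1))@_(mon2 l (n - l)) = omega_sum a (n - l).
  by rewrite omega_form_coef // addnK addn1.
have -> : (omega_form a * ('X_0 ^+ 0 * 'X_1 ^+ 2))@_(mon2 l (n - l)) = omega_sum a (n - l).-1.
  rewrite omega_form_coef //; case: leqP => h; last by congr omega_sum; lia.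
  have -> : (n - l).-1 = 0%N by lia.
  apply: esym; rewrite /omega_sum big1 // => i _; rewrite big1 // => j /eqP h0.
  by rewrite omega_coef0 ?mul0r.
ring.
Qed.

(** The linear form vanishing at gz pulls back to [\det g] times the one vanishing at z; its square
    gives the factor on the left. On the right R contributes one power of the determinant and the
    pairing [n]. The powers stay uncancelled because the determinant may be a zero divisor. *)
Lemma qform_act A (g : 'M[A]_2) (a : form A) z0 z1 :
  (forall m (x : A), x *+ m.+1 = 0 -> x = 0) ->
  \det g ^+ 2 * qform (act g a) z0 z1 =
  \det g ^+ n.+1 * qform a (g 0 0 * z0 + g 0 1 * z1) (g 1 0 * z0 + g 1 1 * z1).
Proof.
move=> tf; rewrite !qform_pairing diag_form_act omega_form_act.
rewrite -pairingZr -scalerAl.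
have -> : \det g ^+ 2 *: (\det g *: (subst2 g (omega_form a) * omega_lin z0 z1 ^+ 2)) =
    \det g *: subst2 g (omega_form a * omega_lin (g 0 0 * z0 + g 0 1 * z1) (g 1 0 * z0 + g 1 1 * z1) ^+ 2).
  rewrite rmorphM rmorphXn /=.
  have -> : subst2 g (omega_lin (g 0 0 * z0 + g 0 1 * z1) (g 1 0 * z0 + g 1 1 * z1)) =
     \det g *: omega_lin z0 z1.
    rewrite /omega_lin raddfB /= !subst2Z !subst2X det2E -!mul_mpolyC.
    by rewrite !(rmorphD, rmorphB, rmorphM) /=; ring.
  by rewrite exprZn scalerA -!scalerAr !scalerA [_ ^+ 2 * _]mulrC.
rewrite pairingZr pairing_subst2 //; last exact: omega_lin_homog.
  by rewrite mulrA -exprS.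
exact: diag_form_homog.
Qed.

End Covariants.

(** Scaling by an indeterminate detects homogeneity, so degrees can be read off from evaluations at
    scaled points. *)
Lemma dhomog_scale (R : comNzRingType) m D (P : {mpoly R[m]}) :
  mmap ((polyC : {rmorphism _ -> _}) \o @mpolyC m R) (fun i => 'X * ('X_i)%:P) P
    = 'X^D * P%:P -> P \is D.-homog.
Proof.
move=> E; apply/dhomogP => t tP; apply/eqP; apply: contraT => ne.
have E2 : mmap ((polyC : {rmorphism _ -> _}) \o @mpolyC m R) (fun i => 'X * ('X_i)%:P) P
   = \sum_(s <- msupp P) (P@_s *: 'X_[s])%:P * 'X^(mdeg s).
  rewrite {1}[P]mpolyE rmorph_sum; apply: eq_bigr => s _ /=.
  rewrite mmapZ mmapX /= /mmap1 -[_ *: _]mul_mpolyC [in RHS]rmorphM /= -mulrA; congr (_ * _).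
  rewrite mpolyXE_id rmorph_prod mdegE -prodrXr -big_split; apply: eq_bigr => i _ /=.
  by rewrite exprMn rmorphXn mulrC.
have := congr1 (fun Q : {poly {mpoly R[m]}} => (Q`_(mdeg t))@_t) (etrans (esym E2) E).
rewrite coefMC coefXn (negPf ne) mul0r mcoeff0 coef_sum raddf_sum /=.
rewrite (bigD1_seq t) ?msupp_uniq //= coefCM coefXn eqxx mulr1 mcoeffZ mcoeffX eqxx mulr1.
rewrite big_seq_cond big1 ?addr0 => [Pt0|s /andP[_ st]].
  by move: tP; rewrite mcoeff_msupp Pt0 eqxx.
rewrite coefCM coefXn; case: (mdeg t == mdeg s); rewrite ?mulr0 ?mcoeff0 // mulr1.
by rewrite mcoeffZ mcoeffX (negPf st) mulr0.
Qed.

#[local] Opaque act.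

Lemma I2_cases (i : 'I_2) : i = 0 \/ i = 1.
Proof.
case: (unliftP 0 i) => [l|] ->; last by left.
by right; rewrite (ord1 l); apply: val_inj.
Qed.

(** * Frames of roots of the quadratic covariant *)

Section Frames.

Variables (d e : nat).
Local Notation form A := 'M[A]_(d.+1, e.+1).
Implicit Types A B C : comNzRingType.
Local Notation n := (d + e)%N.

Lemma qsum_map A B (f : {rmorphism A -> B}) (a : form A) r :
  f (qsum a r) = qsum (map_mx f a) r.
Proof.
rewrite rmorph_sum; apply: eq_bigr => l _.
by rewrite !(rmorphM f) rmorph_sign rmorph_nat level_sum_map omega_sum_map.
Qed.

Lemma q0_map A B (f : {rmorphism A -> B}) (a : form A) :
  f (q0 a) = q0 (map_mx f a).
Proof. exact: qsum_map. Qed.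

Lemma q1_map A B (f : {rmorphism A -> B}) (a : form A) :
  f (q1 a) = q1 (map_mx f a).
Proof. by rewrite /q1 rmorphM rmorphN rmorph_nat qsum_map. Qed.

Lemma q2_map A B (f : {rmorphism A -> B}) (a : form A) :
  f (q2 a) = q2 (map_mx f a).
Proof. exact: qsum_map. Qed.

Lemma level_sumZ A t (a : form A) l : level_sum (t *: a) l = t * level_sum a l.
Proof.
rewrite mulr_sumr; apply: eq_bigr => i _; rewrite mulr_sumr.
by apply: eq_bigr => j _; rewrite mxE.
Qed.

Lemma omega_sumZ A t (a : form A) l : omega_sum (t *: a) l = t * omega_sum a l.
Proof.
rewrite mulr_sumr; apply: eq_bigr => i _; rewrite mulr_sumr.
by apply: eq_bigr => j _; rewrite mxE mulrCA.
Qed.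

Lemma qsumZ A t (a : form A) r : qsum (t *: a) r = t ^+ 2 * qsum a r.
Proof.
rewrite /qsum mulr_sumr; apply: eq_bigr => l _; rewrite level_sumZ omega_sumZ; ring.
Qed.

Definition disc A (a : form A) : A := q1 a ^+ 2 - 4 * q0 a * q2 a.

Lemma disc_map A B (f : {rmorphism A -> B}) (a : form A) :
  f (disc a) = disc (map_mx f a).
Proof.
by rewrite /disc rmorphB rmorphXn q1_map !rmorphM rmorph_nat q0_map q2_map.
Qed.

Lemma discZ A t (a : form A) : disc (t *: a) = t ^+ 4 * disc a.
Proof. by rewrite /disc /q0 /q1 /q2 !qsumZ; ring. Qed.

Lemma qform_map A B (f : {rmorphism A -> B}) (a : form A) z0 z1 :
  f (qform a z0 z1) = qform (map_mx f a) (f z0) (f z1).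
Proof.
rewrite /qform -(q0_map f) -(q1_map f) -(q2_map f).
by rewrite rmorphD rmorphD (rmorphM f (q0 a)) rmorphM rmorphM (rmorphM f (q2 a)) !rmorphXn.
Qed.

(* The columns (Q + s)x and (Q - s)x, where Q is the traceless matrix of qform;
   they are isotropic for qform when s^2 = disc a. *)
Definition frame A (a : form A) (s x0 x1 : A) : 'M[A]_2 :=
  \matrix_(i, j) (if i == 0
    then (q1 a + (if j == 0 then s else - s)) * x0 + 2 * q2 a * x1
    else - 2 * q0 a * x0 + ((if j == 0 then s else - s) - q1 a) * x1).

Lemma frame_map A B (f : {rmorphism A -> B}) (a : form A) s x0 x1 :
  map_mx f (frame a s x0 x1) = frame (map_mx f a) (f s) (f x0) (f x1).
Proof.
apply/matrixP => i j; rewrite !mxE; case: (i == 0); case: (j == 0);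
  rewrite -?(q0_map f) -?(q1_map f) -?(q2_map f).
all: have := rmorph_nat f 2; move: (q0 a) (q1 a) (q2 a) 2%:R 2%:R => ? ? ? ? ? <-.
all: by rewrite !(rmorphD, rmorphB, rmorphM, rmorphN).
Qed.

Lemma frameZ A t (a : form A) s x0 x1 :
  frame (t *: a) (t ^+ 2 * s) x0 x1 = t ^+ 2 *: frame a s x0 x1.
Proof.
apply/matrixP => i j; rewrite !mxE /q0 /q1 /q2 !qsumZ.
by case: (i == 0); case: (j == 0); ring.
Qed.

Lemma frameZx A t (a : form A) s x0 x1 :
  frame a s (t * x0) (t * x1) = t *: frame a s x0 x1.
Proof.
by apply/matrixP => i j; rewrite !mxE; case: (i == 0); case: (j == 0); ring.
Qed.

Lemma frame_isotropic A (a : form A) s x0 x1 j : s ^+ 2 = disc a ->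
  qform a (frame a s x0 x1 0 j) (frame a s x0 x1 1 j) = 0.
Proof.
move=> hs; transitivity ((s ^+ 2 - disc a) * qform a x0 x1); last by rewrite hs subrr mul0r.
by rewrite !mxE /= /qform /disc; case: (j == 0); ring.
Qed.

Section CovariantCoefficients.

Variables (A : comNzRingType) (g : 'M[A]_2) (a : form A).
Hypothesis torsion_free : forall m (x : A), x *+ m.+1 = 0 -> x = 0.

Lemma q0_act : \det g ^+ 2 * q0 (act g a) = \det g ^+ n.+1 * qform a (g 0 0) (g 1 0).
Proof.
have := qform_act g a 1 0 torsion_free; rewrite !mulr1 !mulr0 !addr0 => <-.
by rewrite /qform; ring.
Qed.

Lemma q2_act : \det g ^+ 2 * q2 (act g a) = \det g ^+ n.+1 * qform a (g 0 1) (g 1 1).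
Proof.
have := qform_act g a 0 1 torsion_free; rewrite !mulr1 !mulr0 !add0r => <-.
by rewrite /qform; ring.
Qed.

End CovariantCoefficients.

Section UnitDeterminant.

Variables (A : comNzRingType) (g : 'M[A]_2) (a : form A).
Hypothesis torsion_free : forall m (x : A), x *+ m.+1 = 0 -> x = 0.
Hypothesis det_g : \det g = 1.

Lemma qform_act1 z0 z1 : qform (act g a) z0 z1 =
  qform a (g 0 0 * z0 + g 0 1 * z1) (g 1 0 * z0 + g 1 1 * z1).
Proof. by have := qform_act g a z0 z1 torsion_free; rewrite det_g !expr1n !mul1r. Qed.

Lemma q0_act1 : q0 (act g a) = qform a (g 0 0) (g 1 0).
Proof. by have := q0_act g a torsion_free; rewrite det_g !expr1n !mul1r. Qed.

Lemma q2_act1 : q2 (act g a) = qform a (g 0 1) (g 1 1).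
Proof. by have := q2_act g a torsion_free; rewrite det_g !expr1n !mul1r. Qed.

Lemma q1_act1 : q1 (act g a) =
  2 * q0 a * g 0 0 * g 0 1 + q1 a * (g 0 0 * g 1 1 + g 0 1 * g 1 0) + 2 * q2 a * g 1 0 * g 1 1.
Proof.
have := qform_act1 1 1; rewrite {1}/qform q0_act1 q2_act1 /qform => E.
have -> : q1 (act g a) = qform a (g 0 0) (g 1 0) * 1 ^+ 2 + q1 (act g a) * 1 * 1
   + qform a (g 0 1) (g 1 1) * 1 ^+ 2 - qform a (g 0 0) (g 1 0) - qform a (g 0 1) (g 1 1).
  by rewrite /qform; ring.
by rewrite {1 2}/qform E /qform; ring.
Qed.

Lemma disc_act1 : disc (act g a) = disc a.
Proof.
transitivity ((\det g) ^+ 2 * disc a); last by rewrite det_g expr1n mul1r.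
by rewrite /disc q0_act1 q1_act1 q2_act1 det2E /qform; ring.
Qed.

(** The traceless matrix Q of q transforms into g^-1 Q g when [\det g = 1], so g (g^-1 Q g + s) x =
    (Q + s) g x. *)
Lemma frame_act1 s x0 x1 : g *m frame (act g a) s x0 x1 =
  frame a s (g 0 0 * x0 + g 0 1 * x1) (g 1 0 * x0 + g 1 1 * x1).
Proof.
apply/matrixP => i j; rewrite mxE sum_I2 !mxE q0_act1 q1_act1 q2_act1 /qform /=.
have [->|] := I2_cases i.
all: rewrite /=.
- set t := (if j == 0 then s else - s).
  transitivity (\det g * (q1 a * (g 0 0 * x0 + g 0 1 * x1) + 2 * q2 a * (g 1 0 * x0 + g 1 1 * x1))
     + t * (g 0 0 * x0 + g 0 1 * x1)); last by rewrite det_g; ring.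
  by rewrite det2E; ring.
- move=> -> /=; set t := (if j == 0 then s else - s).
  transitivity (\det g * (- 2 * q0 a * (g 0 0 * x0 + g 0 1 * x1) - q1 a * (g 1 0 * x0 + g 1 1 * x1))
     + t * (g 1 0 * x0 + g 1 1 * x1)); last by rewrite det_g; ring.
  by rewrite det2E; ring.
Qed.

End UnitDeterminant.

Definition normalized A (a : form A) (s x0 x1 : A) : form A :=
  act (frame a s x0 x1) a.

Lemma normalized_map A B (f : {rmorphism A -> B}) (a : form A) s x0 x1 :
  map_mx f (normalized a s x0 x1) = normalized (map_mx f a) (f s) (f x0) (f x1).
Proof. by rewrite /normalized map_act frame_map. Qed.

Lemma normalized_act1 A (g : 'M[A]_2) (a : form A) s x0 x1 :
  (forall m (x : A), x *+ m.+1 = 0 -> x = 0) -> \det g = 1 ->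
  normalized (act g a) s x0 x1 =
  normalized a s (g 0 0 * x0 + g 0 1 * x1) (g 1 0 * x0 + g 1 1 * x1).
Proof. by move=> tf dg; rewrite /normalized act_comp frame_act1. Qed.

(** The auxiliary vector from which the frame is built is left indeterminate: each entry becomes a
    covariant binary form of degree [n] in that vector, and pairing with a power of q removes it
    again. *)
Definition generic_frame_form C (a : form C) (s : C) :=
  normalized (map_mx (@mpolyC 2 C) a) s%:MP 'X_0 'X_1.

Lemma generic_frame_form_homog C (a : form C) s i j :
  generic_frame_form a s i j \is n.-homog.
Proof.
apply: dhomog_scale; pose f : {rmorphism {mpoly C[2]} -> {poly {mpoly C[2]}}} :=
  mmap ((polyC : {rmorphism _ -> _}) \o @mpolyC 2 C) (fun i => 'X * ('X_i)%:P).
change (f (generic_frame_form a s i j) = 'X^n * (generic_frame_form a s i j)%:P).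
transitivity (map_mx f (generic_frame_form a s) i j); first by rewrite [RHS]mxE.
have fC c : f c%:MP = c%:MP%:P by rewrite /f /= mmapC.
have fX l : f 'X_l = 'X * ('X_l)%:P by rewrite /f /= mmapX mmap1U.
rewrite /generic_frame_form /normalized map_act frame_map !fX fC frameZx act_scalel mxE.
congr (_ * _).
transitivity (map_mx polyC (generic_frame_form a s) i j); last by rewrite [LHS]mxE.
rewrite /generic_frame_form /normalized map_act frame_map.
have -> // : map_mx f (map_mx (@mpolyC 2 C) a) = map_mx polyC (map_mx (@mpolyC 2 C) a).
by apply/matrixP => i' j'; rewrite !mxE fC.
Qed.

Definition lift_form C (a : form C) (s : C) i j iu ju k : {mpoly C[2]} :=
  generic_frame_form a s i j * generic_frame_form a s iu ju ^+ k.

Definition generic_qform C (a : form C) : {mpoly C[2]} :=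
  qform (map_mx (@mpolyC 2 C) a) 'X_0 'X_1.

(* The entry (i, j) of the normalized form times the k-th power of the entry
   (iu, ju), paired with the N-th power of the quadratic covariant. *)
Definition lift_inv C (a : form C) (s : C) i j iu ju k N : C :=
  pairing (2 * N) (lift_form a s i j iu ju k) (generic_qform a ^+ N).

Lemma lift_form_homog C (a : form C) s i j iu ju k N :
  (n * k.+1 = 2 * N)%N -> lift_form a s i j iu ju k \is (2 * N).-homog.
Proof.
move=> <-; rewrite mulnS; apply: dhomogM; first exact: generic_frame_form_homog.
by apply: dhomogMn; apply: generic_frame_form_homog.
Qed.

Lemma generic_qform_homog C (a : form C) N :
  generic_qform a ^+ N \is (2 * N).-homog.
Proof.
apply: dhomogMn; rewrite /generic_qform /qform -!q0_map -!q1_map -!q2_map !mul_mpolyC.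
have h i : ('X_i : {mpoly C[2]}) \is 1.-homog by rewrite dhomogX /= mdeg1.
rewrite -scalerAl; apply: rpredD; [apply: rpredD|]; apply: rpredZ.
- by have := dhomogMn 2 (h 0); rewrite mul1n.
- exact: (dhomogM (h 0) (h 1)).
- by have := dhomogMn 2 (h 1); rewrite mul1n.
Qed.

Lemma subst2_map_mpolyC C (g : 'M[C]_2) (a : form C) :
  map_mx (subst2 g) (map_mx (@mpolyC 2 C) a) = map_mx (@mpolyC 2 C) a.
Proof. by apply/matrixP => i j; rewrite !mxE subst2C. Qed.

Lemma map_mpoly_mpolyC C B (f : {rmorphism C -> B}) (a : form C) :
  map_mx (map_mpoly f) (map_mx (@mpolyC 2 C) a) = map_mx (@mpolyC 2 B) (map_mx f a).
Proof. by apply/matrixP => i j; rewrite !mxE map_mpolyC. Qed.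

Lemma lift_inv_act1 C (g : 'M[C]_2) (a : form C) s i j iu ju k N :
  (forall m (x : C), x *+ m.+1 = 0 -> x = 0) -> (n * k.+1 = 2 * N)%N ->
  \det g = 1 -> lift_inv (act g a) s i j iu ju k N = lift_inv a s i j iu ju k N.
Proof.
move=> tf hN dg; pose gX := map_mx (@mpolyC 2 C) g.
have tfX m (x : {mpoly C[2]}) : x *+ m.+1 = 0 -> x = 0.
  by move=> h; apply/mpolyP => t; rewrite mcoeff0; apply: (tf m); rewrite -mcoeffMn h mcoeff0.
have dgX : \det gX = 1 by rewrite det_map_mx dg.
have gE l : gX l 0 * 'X_0 + gX l 1 * 'X_1 = subst2 g 'X_l.
  by rewrite subst2X !mxE !mul_mpolyC.
have [aX eaX] : exists aX, aX = map_mx (@mpolyC 2 C) a by eexists.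
have saX : map_mx (subst2 g) aX = aX by rewrite eaX; apply: subst2_map_mpolyC.
have actX : map_mx (@mpolyC 2 C) (act g a) = act gX aX by rewrite eaX; apply: map_act.
have eY i' j' : generic_frame_form (act g a) s i' j' = subst2 g (generic_frame_form a s i' j').
  transitivity (map_mx (subst2 g) (generic_frame_form a s) i' j'); last by rewrite [LHS]mxE.
  congr (fun_of_matrix _ i' j'); rewrite /generic_frame_form actX -eaX.
  apply: etrans (normalized_act1 _ _ _ _ tfX dgX) _; rewrite (gE 0) (gE 1).
  apply: esym; apply: etrans (normalized_map (subst2 g) _ _ _ _) _.
  apply: etrans (congr1 (fun z => normalized z _ _ _) saX) _.
  exact: (congr1 (fun z => normalized aX z _ _) (subst2C g s)).
have eq : generic_qform (act g a) = subst2 g (generic_qform a).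
  rewrite /generic_qform actX (qform_act1 aX tfX dgX) (gE 0) (gE 1).
  by apply: esym; apply: etrans (qform_map (subst2 g) _ _ _) _; rewrite -eaX saX.
have eL : lift_form (act g a) s i j iu ju k = subst2 g (lift_form a s i j iu ju k).
  apply: etrans (congr2 (fun x y => x * y ^+ k) (eY i j) (eY iu ju)) _; apply: esym.
  by apply: etrans (rmorphM (subst2 g) _ _) _; congr (_ * _); apply: (rmorphXn (subst2 g)).
have eN : generic_qform (act g a) ^+ N = subst2 g (generic_qform a ^+ N).
  apply: etrans (congr1 (fun z => z ^+ N) eq) _; apply: esym; exact: (rmorphXn (subst2 g)).
apply: etrans (congr2 (pairing _) eL eN) _.
rewrite (pairing_subst2 g tf (lift_form_homog a s i j iu ju hN) (generic_qform_homog a N)).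
by rewrite dg expr1n mul1r.
Qed.

Lemma lift_inv_map C B (f : {rmorphism C -> B}) (a : form C) s i j iu ju k N :
  f (lift_inv a s i j iu ju k N) = lift_inv (map_mx f a) (f s) i j iu ju k N.
Proof.
have eC c : map_mpoly f c%:MP = (f c)%:MP :> {mpoly B[2]} by apply: map_mpolyC.
have eX l : map_mpoly f 'X_l = 'X_l :> {mpoly B[2]} by apply: map_mpolyX.
have eY i' j' : map_mpoly f (generic_frame_form a s i' j') =
    generic_frame_form (map_mx f a) (f s) i' j'.
  transitivity (map_mx (map_mpoly f) (generic_frame_form a s) i' j'); first by rewrite [RHS]mxE.
  apply: etrans (congr1 (fun z : 'M__ => z i' j') (normalized_map (map_mpoly f) _ _ _ _)) _.
  apply: etrans (congr1 (fun z => normalized z _ _ _ i' j') (map_mpoly_mpolyC f a)) _.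
  have c3 x x' y y' z z' : x = x' -> y = y' -> z = z' ->
    normalized (map_mx (@mpolyC 2 B) (map_mx f a)) x y z i' j' =
    normalized (map_mx (@mpolyC 2 B) (map_mx f a)) x' y' z' i' j' by move=> -> -> ->.
  by apply: c3; [exact: eC|exact: eX|exact: eX].
have eq : map_mpoly f (generic_qform a) = generic_qform (map_mx f a).
  rewrite /generic_qform; apply: etrans (qform_map (map_mpoly f) _ _ _) _.
  apply: etrans (congr1 (fun z => qform z _ _) (map_mpoly_mpolyC f a)) _.
  by congr qform; [exact: eX|exact: eX].
rewrite /lift_inv pairing_map; congr pairing.
  apply: etrans (rmorphM (map_mpoly f) _ _) _; rewrite rmorphXn.
  exact: (congr2 (fun x y => x * y ^+ k) (eY i j) (eY iu ju)).
apply: etrans (rmorphXn (map_mpoly f) _ _) _; exact: (congr1 (fun z => z ^+ N) eq).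
Qed.

Lemma lift_invZ C t (a : form C) s i j iu ju k N :
  lift_inv (t *: a) (t ^+ 2 * s) i j iu ju k N =
  t ^+ ((2 * n).+1 * k.+1 + 2 * N) * lift_inv a s i j iu ju k N.
Proof.
(* The frame scales by [t ^+ 2], which [act] raises to the power [n]; the last factor [t] comes from
   the form itself. *)
have eY i' j' : generic_frame_form (t *: a) (t ^+ 2 * s) i' j' =
    t ^+ (2 * n).+1 *: generic_frame_form a s i' j'.
  rewrite /generic_frame_form /normalized map_mxZ rmorphM rmorphXn /= frameZ.
  by rewrite act_scalel act_scaler scalerA mxE -exprM -exprSr -rmorphXn /= mul_mpolyC.
have eq : generic_qform (t *: a) = t ^+ 2 *: generic_qform a.
  rewrite /generic_qform map_mxZ /qform /q0 /q1 /q2 !qsumZ -!mul_mpolyC rmorphXn /=; ring.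
have eL : lift_form (t *: a) (t ^+ 2 * s) i j iu ju k =
    t ^+ ((2 * n).+1 * k.+1) *: lift_form a s i j iu ju k.
  apply: etrans (congr2 (fun x y => x * y ^+ k) (eY i j) (eY iu ju)) _.
  rewrite /lift_form; move: (generic_frame_form a s i j) (generic_frame_form a s iu ju) => x y.
  by rewrite exprZn -scalerAl -scalerAr scalerA -exprM -exprD mulnS.
have eN : generic_qform (t *: a) ^+ N = t ^+ (2 * N) *: generic_qform a ^+ N.
  by apply: etrans (congr1 (fun z => z ^+ N) eq) _; rewrite exprZn exprM.
apply: etrans (congr2 (pairing _) eL eN) _.
by rewrite pairingZl pairingZr mulrA -exprD.
Qed.

Lemma pairing_balanced C N (t : C) : pairing (2 * N) ('X_0 ^+ N * 'X_1 ^+ N) (t *: ('X_0 ^+ N * 'X_1 ^+ N))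
  = (-1) ^+ N * (N`! ^ 2)%:R * t.
Proof.
have lN : (N < (2 * N).+1)%N by lia.
have h : (2 * N - N = N)%N by lia.
have := pairing_mon ('X_0 ^+ N * 'X_1 ^+ N : {mpoly C[2]}) (Ordinal lN); rewrite /= h => E.
by rewrite pairingZr E X2E mcoeffX eqxx mulr1 mulrC -mulnn.
Qed.

Lemma frame_diag C (a : form C) x0 x1 : q0 a = 0 -> q2 a = 0 ->
  frame a (q1 a) x0 x1 = diag2 (2 * q1 a * x0) (- 2 * q1 a * x1).
Proof.
move=> h0 h2; apply/matrixP => i j; rewrite !mxE h0 h2.
by case: (I2_cases i) => ->; case: (I2_cases j) => -> /=; ring.
Qed.

(** For q = q1 z_0 z_1 the two square roots q1 and - q1 of the discriminant give a diagonal and an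
    antidiagonal frame, so changing the sign of the root exchanges 0 and oo. *)
Lemma frame_anti C (a : form C) x0 x1 : q0 a = 0 -> q2 a = 0 ->
  frame a (- q1 a) x0 x1 = anti2 (2 * q1 a * x0) (- 2 * q1 a * x1).
Proof.
move=> h0 h2; apply/matrixP => i j; rewrite !mxE h0 h2.
by case: (I2_cases i) => ->; case: (I2_cases j) => -> /=; ring.
Qed.

Section Diagonal.

Variables (C : comNzRingType) (a : form C).
Hypothesis q0a : q0 a = 0.
Hypothesis q2a : q2 a = 0.
Variables (i iu : 'I_d.+1) (j ju : 'I_e.+1) (k N : nat).
Hypothesis hN : (n * k.+1 = 2 * N)%N.
Hypothesis hbal : (lev i j + k * lev iu ju = N)%N.

Local Notation aX := (map_mx (@mpolyC 2 C) a).

Let q0aX : q0 aX = 0.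
Proof. by apply: etrans (esym (q0_map (@mpolyC 2 C) a)) _; rewrite q0a rmorph0. Qed.

Let q2aX : q2 aX = 0.
Proof. by apply: etrans (esym (q2_map (@mpolyC 2 C) a)) _; rewrite q2a rmorph0. Qed.

Let q1aX : q1 aX = (q1 a)%:MP.
Proof. exact: esym (q1_map (@mpolyC 2 C) a). Qed.

Lemma generic_qform_diag : generic_qform a = q1 a *: ('X_0 * 'X_1).
Proof.
by rewrite /generic_qform /qform q0aX q1aX q2aX -mul_mpolyC; ring.
Qed.

Lemma balanced : (n - lev i j + k * (n - lev iu ju) = N)%N.
Proof. by have := lev_le i j; have := lev_le iu ju; nia. Qed.

(** The frame contributes (-4 q1^2)^N, the N-th power of the covariant q1^N, and the pairing of
    balanced monomials (-1)^N N!^2; the signs cancel. *)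
Lemma lift_inv_monomial s c :
  lift_form a s i j iu ju k =
    (2 * (q1 a)%:MP * 'X_0) ^+ N * (- 2 * (q1 a)%:MP * 'X_1) ^+ N * c%:MP ->
  lift_inv a s i j iu ju k N = (4 ^ N * N`! ^ 2)%:R * q1 a ^+ (3 * N) * c.
Proof.
have [t et] : exists t, t = q1 a by eexists.
rewrite -et => eL.
have E : lift_form a s i j iu ju k = ((- 4 * t ^+ 2) ^+ N * c) *: ('X_0 ^+ N * 'X_1 ^+ N).
  rewrite eL -mul_mpolyC rmorphM rmorphXn rmorphM rmorphXn rmorphN rmorph_nat /=.
  have -> : - 4 * t%:MP ^+ 2 = (2 * t%:MP) * (- 2 * t%:MP) :> {mpoly C[2]} by ring.
  rewrite !exprMn; ring.
rewrite /lift_inv E generic_qform_diag -et exprZn [('X_0 * 'X_1) ^+ N]exprMn pairingZl pairing_balanced.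
rewrite natrM !natrX exprMn -!exprM [(- 4) ^+ N]exprNn [(3 * N)%N]mulSn exprD.
transitivity (((-1) ^+ N * (-1) ^+ N) * (4 ^+ N * N`!%:R ^+ 2 *
   (t ^+ N * t ^+ (2 * N)) * c)); first by ring.
by rewrite -signr_odd -expr2 sqrr_sign mul1r.
Qed.

Lemma lift_inv_diag : lift_inv a (q1 a) i j iu ju k N =
  (4 ^ N * N`! ^ 2)%:R * q1 a ^+ (3 * N) * (a i j * a iu ju ^+ k).
Proof.
apply: lift_inv_monomial.
have [p ep] : exists p : {mpoly C[2]}, p = 2 * (q1 a)%:MP * 'X_0 by eexists.
have [q eq] : exists q : {mpoly C[2]}, q = - 2 * (q1 a)%:MP * 'X_1 by eexists.
have eY i' j' : generic_frame_form a (q1 a) i' j' =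
    p ^+ (n - lev i' j') * q ^+ lev i' j' * (a i' j')%:MP.
  have := frame_diag 'X_0 'X_1 q0aX q2aX; rewrite q1aX => eF.
  apply: etrans (congr1 (fun g => act g aX i' j') eF) _.
  by rewrite act_diag [X in _ * X]mxE ep eq.
rewrite -ep -eq rmorphM rmorphXn /=.
transitivity ((p ^+ (n - lev i j) * p ^+ ((n - lev iu ju) * k)) *
   (q ^+ lev i j * q ^+ (lev iu ju * k)) * ((a i j)%:MP * (a iu ju)%:MP ^+ k)).
  by rewrite /lift_form !eY !exprMn -!exprM; ring.
by rewrite -!exprD ![(_ * k)%N]mulnC balanced hbal.
Qed.

Lemma lift_inv_anti : lift_inv a (- q1 a) i j iu ju k N =
  (4 ^ N * N`! ^ 2)%:R * q1 a ^+ (3 * N) *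
  (a (rev_ord i) (rev_ord j) * a (rev_ord iu) (rev_ord ju) ^+ k).
Proof.
apply: lift_inv_monomial.
set b0 := a (rev_ord i) (rev_ord j); set b1 := a (rev_ord iu) (rev_ord ju).
have [p ep] : exists p : {mpoly C[2]}, p = 2 * (q1 a)%:MP * 'X_0 by eexists.
have [q eq] : exists q : {mpoly C[2]}, q = - 2 * (q1 a)%:MP * 'X_1 by eexists.
have eY i' j' : generic_frame_form a (- q1 a) i' j' =
    p ^+ lev i' j' * q ^+ (n - lev i' j') * (a (rev_ord i') (rev_ord j'))%:MP.
  have := frame_anti 'X_0 'X_1 q0aX q2aX; rewrite q1aX -rmorphN => eF.
  apply: etrans (congr1 (fun g => act g aX i' j') eF) _.
  by rewrite act_anti [X in _ * X]mxE ep eq.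
rewrite -ep -eq rmorphM rmorphXn /=.
transitivity ((p ^+ lev i j * p ^+ (lev iu ju * k)) *
   (q ^+ (n - lev i j) * q ^+ ((n - lev iu ju) * k)) * (b0%:MP * b1%:MP ^+ k)).
  by rewrite /lift_form !eY -/b0 -/b1 !exprMn -!exprM; ring.
by rewrite -!exprD ![(_ * k)%N]mulnC balanced hbal.
Qed.

End Diagonal.
End Frames.

(** * Quadratic extensions and invariant forms *)

(* The ring A[s] / (s^2 - b). *)
Definition quad (A : comNzRingType) (b : A) : Type := (A * A)%type.

Section Quad.

Variables (A : comNzRingType) (b : A).

HB.instance Definition _ := GRing.Zmodule.on (quad b).

Implicit Types x y z : quad b.

Definition quad_one : quad b := (1, 0).
Definition quad_mul x y : quad b := (x.1 * y.1 + b * (x.2 * y.2), x.1 * y.2 + x.2 * y.1).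

Lemma quad_mulA : associative quad_mul.
Proof. by move=> x y z; congr (_, _) => /=; ring. Qed.

Lemma quad_mulC : commutative quad_mul.
Proof. by move=> x y; congr (_, _) => /=; ring. Qed.

Lemma quad_mul1 : left_id quad_one quad_mul.
Proof. by case=> x y; congr (_, _) => /=; ring. Qed.

Lemma quad_mulDl : left_distributive quad_mul +%R.
Proof. by move=> x y z; congr (_, _) => /=; ring. Qed.

Lemma quad_one_neq0 : quad_one != 0.
Proof. by apply/eqP => -[/eqP]; rewrite oner_eq0. Qed.

HB.instance Definition _ := GRing.Zmodule_isComNzRing.Build (quad b)
  quad_mulA quad_mulC quad_mul1 quad_mulDl quad_one_neq0.

Definition quad_gen : quad b := (0, 1).

Definition quad_in (x : A) : quad b := (x, 0).

Lemma quad_in_zmod : zmod_morphism quad_in.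
Proof. by move=> x y; congr (_, _); rewrite subr0. Qed.

Lemma quad_in_monoid : monoid_morphism quad_in.
Proof. by split=> // x y; congr (_, _) => /=; ring. Qed.

HB.instance Definition _ := GRing.isZmodMorphism.Build A (quad b) quad_in quad_in_zmod.
HB.instance Definition _ := GRing.isMonoidMorphism.Build A (quad b) quad_in quad_in_monoid.

Lemma quad_gen2 : quad_gen ^+ 2 = quad_in b.
Proof. by rewrite expr2; congr (_, _) => /=; ring. Qed.

Lemma quad_in_inj : injective quad_in.
Proof. by move=> x y []. Qed.

End Quad.

Section QuadMap.

Variables (A B : comNzRingType) (b : A) (f : {rmorphism A -> B}) (t : B).

(** The equation is an argument, so that the ring morphism structure can be declared on the function
    itself. *)
Definition quad_eval (h : t ^+ 2 = f b) (x : quad b) : B := f x.1 + f x.2 * t.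

Variable h : t ^+ 2 = f b.

Lemma quad_eval_zmod : zmod_morphism (quad_eval h).
Proof. by move=> x y; rewrite /quad_eval !rmorphB; ring. Qed.

Lemma quad_eval_monoid : monoid_morphism (quad_eval h).
Proof.
split=> [|x y]; first by rewrite /quad_eval rmorph1 rmorph0 mul0r addr0.
by rewrite /quad_eval !rmorphD !rmorphM -h; ring.
Qed.

HB.instance Definition _ := GRing.isZmodMorphism.Build (quad b) B (quad_eval h) quad_eval_zmod.
HB.instance Definition _ := GRing.isMonoidMorphism.Build (quad b) B (quad_eval h) quad_eval_monoid.

Lemma quad_eval_in x : quad_eval h (quad_in b x) = f x.
Proof. by rewrite /quad_eval rmorph0 mul0r addr0. Qed.

Lemma quad_eval_gen : quad_eval h (quad_gen b) = t.
Proof. by rewrite /quad_eval rmorph0 add0r rmorph1 mul1r. Qed.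

End QuadMap.

Lemma quad_torsion_free (A : comNzRingType) (b : A) :
  (forall m (x : A), x *+ m.+1 = 0 -> x = 0) -> forall m (x : quad b), x *+ m.+1 = 0 -> x = 0.
Proof.
move=> tf m x; rewrite -mulr_natl -[_%:R](rmorph_nat (quad_in b)) => h.
have h1 : (m.+1)%:R * x.1 = 0.
  by have := congr1 fst h; rewrite /= mul0r mulr0 addr0.
have h2 : (m.+1)%:R * x.2 = 0.
  by have := congr1 snd h; rewrite /= mul0r addr0.
rewrite mulr_natl in h1; rewrite mulr_natl in h2.
by case: x {h} h1 h2 => x y /= /tf -> /tf ->.
Qed.

(** Regards [A] as a k-algebra through [f]: invariance is formulated over k-algebras, while the
    evaluations below run along bare ring morphisms. *)
Definition alg_via (k : fieldType) (A : comNzRingType) (f : {rmorphism k -> A}) : Type := A.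

Section AlgVia.

Variables (k : fieldType) (A : comNzRingType) (f : {rmorphism k -> A}).

HB.instance Definition _ := GRing.ComNzRing.on (alg_via f).

Definition alg_via_scale (c : k) (x : alg_via f) : alg_via f := f c * x.

Lemma alg_via_scaleA a b x : alg_via_scale a (alg_via_scale b x) = alg_via_scale (a * b) x.
Proof. by rewrite /alg_via_scale rmorphM mulrA. Qed.

Lemma alg_via_scale1 : left_id 1 alg_via_scale.
Proof. by move=> x; rewrite /alg_via_scale rmorph1 mul1r. Qed.

Lemma alg_via_scaleDr : right_distributive alg_via_scale +%R.
Proof. by move=> c x y; rewrite /alg_via_scale mulrDr. Qed.

Lemma alg_via_scaleDl x : {morph alg_via_scale^~ x : a b / a + b}.
Proof. by move=> a b; rewrite /alg_via_scale rmorphD mulrDl. Qed.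

HB.instance Definition _ := GRing.Zmodule_isLmodule.Build k (alg_via f)
  alg_via_scaleA alg_via_scale1 alg_via_scaleDr alg_via_scaleDl.

Lemma alg_via_scaleAl (c : k) (x y : alg_via f) : c *: (x * y) = c *: x * y.
Proof. by rewrite /GRing.scale /= /alg_via_scale mulrA. Qed.

HB.instance Definition _ := GRing.Lmodule_isLalgebra.Build k (alg_via f) alg_via_scaleAl.

HB.instance Definition _ := GRing.Lalgebra_isComAlgebra.Build k (alg_via f).

End AlgVia.

Section Invariants.

Variables (k : fieldType) (d e : nat).
Local Notation form A := 'M[A]_(d.+1, e.+1).
Hypothesis char0 : [pchar k] =i pred0.
Local Notation n := (d + e)%N.
Local Notation coord := (coord_poly k d e).

Implicit Types A B : comNzRingType.

Lemma torsion_free_via A (f : {rmorphism k -> A}) m (x : A) : x *+ m.+1 = 0 -> x = 0.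
Proof.
have nz : (m.+1)%:R != 0 :> k by rewrite ((pcharf0P k).1 char0).
move=> h; rewrite -[x]mul1r -(rmorph1 f) -(mulVf nz) rmorphM rmorph_nat -mulrA mulr_natl h.
by rewrite mulr0.
Qed.

Definition coord_eval A (f : {rmorphism k -> A}) (a : form A) : coord -> A :=
  mmap f (fun l => mxvec a 0 l).

HB.instance Definition _ A f a := GRing.RMorphism.on (@coord_eval A f a).

Definition generic_point : form coord := vec_mx (\row_l 'X_l).

Lemma generic_pointE i j : generic_point i j = 'X_(mxvec_index i j).
Proof. by rewrite !mxE. Qed.

Lemma coord_eval_generic A (f : {rmorphism k -> A}) a :
  map_mx (coord_eval f a) generic_point = a.
Proof.
apply/matrixP => i j; rewrite mxE generic_pointE /coord_eval mmapX mmap1U.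
exact: mxvecE.
Qed.

Lemma coord_evalC A (f : {rmorphism k -> A}) a c : coord_eval f a c%:MP = f c.
Proof. exact: mmapC. Qed.

Lemma coord_eval_comp A B (f : {rmorphism k -> A}) (h : {rmorphism A -> B}) a F :
  h (coord_eval f a F) = coord_eval (h \o f : {rmorphism _ -> _}) (map_mx h a) F.
Proof.
move: F; apply: (@mpoly_rmorph_ext _ _ _ (h \o coord_eval f a)) => [c|l] /=.
  by rewrite !coord_evalC.
rewrite /coord_eval !mmapX !mmap1U; case/mxvec_indexP: l => i j.
by rewrite !mxvecE mxE.
Qed.

Lemma coord_eval_id F : coord_eval (@mpolyC _ k) generic_point F = F.
Proof.
move: F; apply: (@mpoly_rmorph_ext _ _ _ (coord_eval (@mpolyC _ k) generic_point) idfun)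
  => [c|l] /=; first exact: coord_evalC.
by rewrite /coord_eval mmapX mmap1U; case/mxvec_indexP: l => i j; rewrite mxvecE generic_pointE.
Qed.

Lemma SL2_invariant_eval A (f : {rmorphism k -> A}) F g a : SL2_invariant F ->
  \det g = 1 -> coord_eval f (act g a) F = coord_eval f a F.
Proof.
move=> inv dg; have := inv (alg_via f) g a dg; rewrite /eval_form.
have E (b : form A) :
    mmap (in_alg (alg_via f)) (fun l => mxvec b 0 l) F = coord_eval f b F.
  move: F {inv}; apply: (@mpoly_rmorph_ext _ _ _
     (mmap (in_alg (alg_via f)) (fun l => mxvec b 0 l : alg_via f)) (coord_eval f b)) => [c|l].
    transitivity (f c); last exact: esym (coord_evalC f b c).
    by apply: etrans (mmapC _ _ _) _; apply: mulr1.
  by rewrite /= /coord_eval !mmapX !mmap1U.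
by rewrite !E.
Qed.

Lemma SL2_invariantP F :
  (forall A (f : {rmorphism k -> A}) g a, \det g = 1 ->
     coord_eval f (act g a) F = coord_eval f a F) -> SL2_invariant F.
Proof. by move=> h A g a dg; apply: (h A (in_alg A)). Qed.

Lemma coord_eval_scale A (f : {rmorphism k -> A}) D F t a : F \is D.-homog ->
  coord_eval f (t *: a) F = t ^+ D * coord_eval f a F.
Proof.
move=> /dhomogP hF; rewrite /coord_eval /mmap mulr_sumr big_seq_cond [RHS]big_seq_cond.
apply: eq_bigr => m /andP[mF _]; rewrite mulrCA; congr (_ * _).
rewrite /mmap1 -(hF _ mF) /= mdegE -prodrXr -big_split.
apply: eq_bigr => l _ /=; rewrite -exprMn; congr (_ ^+ _).
by case/mxvec_indexP: l => i j; rewrite !mxvecE mxE.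
Qed.

Definition poly_scalar : {rmorphism k -> {poly coord}} :=
  (polyC : {rmorphism _ -> _}) \o @mpolyC _ k.

Lemma coord_homog D F :
  coord_eval poly_scalar ('X *: map_mx polyC generic_point) F =
    'X^D * coord_eval poly_scalar (map_mx polyC generic_point) F -> F \is D.-homog.
Proof.
move=> h; apply: dhomog_scale; move: h; rewrite /poly_scalar.
rewrite -(coord_eval_comp (@mpolyC _ k) (polyC : {rmorphism _ -> _})) coord_eval_id /= => <-.
rewrite /coord_eval; congr (mmap _ _ F); apply/funext => l.
by case/mxvec_indexP: l => i j; rewrite mxvecE !mxE.
Qed.

(* Adjoining a square root of det g reduces GL_2 to SL_2 and scalars. *)
Lemma coord_eval_GL2 A (f : {rmorphism k -> A}) D w F g gi a :
  invariant_forms D F -> (n * D = 2 * w)%N -> \det g * gi = 1 ->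
  coord_eval f (act g a) F = \det g ^+ w * coord_eval f a F.
Proof.
move=> [hF iF] hD hg; pose b := gi; pose Q := quad b.
have [s es] : exists s : Q, s = quad_gen b by eexists.
have s2 : s ^+ 2 = quad_in b gi by rewrite es quad_gen2.
pose t : Q := quad_in b (\det g) * s.
have ts : t * s = 1 by rewrite /t -mulrA -expr2 s2 -rmorphM hg rmorph1.
have t2 : t ^+ 2 = quad_in b (\det g).
  by rewrite /t exprMn s2 -rmorphXn -rmorphM expr2 -mulrA hg mulr1.
apply: (@quad_in_inj _ b); rewrite rmorphM rmorphXn.
rewrite !(coord_eval_comp f (quad_in b)) map_act.
set gQ := map_mx _ g; set aQ := map_mx _ a; set fQ := _ \o _.
have dgQ : \det gQ = quad_in b (\det g) by rewrite -det_map_mx.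
have -> : act gQ aQ = t ^+ n *: act (s *: gQ) aQ.
  by rewrite act_scalel scalerA -exprMn ts expr1n scale1r.
rewrite (coord_eval_scale _ _ _ hF) -exprM hD exprM t2; congr (_ * _).
by apply: SL2_invariant_eval iF _; rewrite detZ dgQ s2 -rmorphM mulrC hg rmorph1.
Qed.

End Invariants.

(** * Invariants from the components of a lift over the quadratic extension *)

Section LiftComponents.

Variables (k : fieldType) (d e : nat).
Local Notation form A := 'M[A]_(d.+1, e.+1).
Hypothesis char0 : [pchar k] =i pred0.
Local Notation n := (d + e)%N.
Local Notation coord := (coord_poly k d e).
Local Notation v := (generic_point k d e).
Implicit Types A : comNzRingType.

Lemma coord_eval_disc A (f : {rmorphism k -> A}) a : coord_eval f a (disc v) = disc a.
Proof. by rewrite disc_map coord_eval_generic. Qed.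

Lemma invariant_disc : invariant_forms 4 (disc v).
Proof.
split.
  by apply: coord_homog; rewrite !coord_eval_disc discZ.
apply: SL2_invariantP => A f g a dg; rewrite !coord_eval_disc disc_act1 //.
exact: (torsion_free_via char0 f).
Qed.

Variables (i : 'I_d.+1) (j : 'I_e.+1) (iu : 'I_d.+1) (ju : 'I_e.+1) (r N : nat).
Hypothesis n_gt0 : (0 < n)%N.
Hypothesis hN : (n * r.+1 = 2 * N)%N.

Definition generic_lift : quad (disc v) :=
  lift_inv (map_mx (quad_in (disc v)) v) (quad_gen (disc v)) i j iu ju r N.

Lemma generic_lift_eval A (f : {rmorphism k -> A}) a s : s ^+ 2 = disc a ->
  coord_eval f a generic_lift.1 + coord_eval f a generic_lift.2 * s = lift_inv a s i j iu ju r N.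
Proof.
move=> hs; have h : s ^+ 2 = coord_eval f a (disc v) by rewrite coord_eval_disc.
apply: etrans (lift_inv_map (quad_eval h) _ _ _ _ _ _ _ _) _.
have -> : map_mx (quad_eval h) (map_mx (quad_in (disc v)) v) = a.
  rewrite -[RHS](coord_eval_generic f a); apply/matrixP => l m.
  by rewrite !mxE; apply: quad_eval_in.
exact: (congr1 (fun z => lift_inv a z i j iu ju r N) (quad_eval_gen h)).
Qed.

(** The discriminant has degree 4, so [t ^+ 2] times the generator is a square root of [disc a].
    With [t] equal to 1 and to ['X], a form and its multiple by ['X] are compared in one
    extension. *)
Lemma generic_lift_quad A (f : {rmorphism k -> A}) a (b t : A) : disc a = t ^+ 4 * b ->
  quad_in b (coord_eval f a generic_lift.1) +
    quad_in b (coord_eval f a generic_lift.2) * (quad_in b (t ^+ 2) * quad_gen b) =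
  lift_inv (map_mx (quad_in b) a) (quad_in b (t ^+ 2) * quad_gen b) i j iu ju r N.
Proof.
move=> hb; rewrite !(coord_eval_comp f (quad_in b)); apply: generic_lift_eval.
by rewrite exprMn quad_gen2 -rmorphXn -rmorphM -exprM -disc_map -hb.
Qed.

(** The lift is invariant over the quadratic extension, whose generator s is invariant of degree 2.
    Its components in the basis 1, s are therefore invariant, the second one in degree lower by
    2. *)
Lemma generic_lift_invariant :
  invariant_forms ((3 * n).+1 * r.+1) generic_lift.1 /\
  invariant_forms ((3 * n).+1 * r.+1 - 2) generic_lift.2.
Proof.
have quad_inj A (b p1 p2 p3 p4 : A) : quad_in b p1 + quad_in b p2 * quad_gen b =
    quad_in b p3 + quad_in b p4 * quad_gen b -> p1 = p3 /\ p2 = p4.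
  move=> E; have E1 := congr1 fst E; have E2 := congr1 snd E.
  by move: E1 E2; rewrite /= !mulr0 !mul0r !mulr1 !addr0 !mulr0 !addr0 !add0r.
have inv A (f : {rmorphism k -> A}) g a : \det g = 1 ->
    coord_eval f (act g a) generic_lift.1 = coord_eval f a generic_lift.1 /\
    coord_eval f (act g a) generic_lift.2 = coord_eval f a generic_lift.2.
  move=> dg; have tf := torsion_free_via char0 f.
  have h1 := @generic_lift_quad A f a (disc a) 1.
  have h2 := @generic_lift_quad A f (act g a) (disc a) 1.
  rewrite expr1n mul1r in h1; rewrite expr1n mul1r in h2.
  rewrite expr1n rmorph1 mul1r in h1; rewrite expr1n rmorph1 mul1r disc_act1 // in h2.
  apply: (quad_inj _ (disc a)); rewrite (h1 erefl) (h2 erefl) map_act; apply: lift_inv_act1 => //.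
    exact: quad_torsion_free.
  by rewrite det_map_mx dg rmorph1.
have [c ec] : exists c : {rmorphism k -> {poly coord}}, c = poly_scalar k d e by eexists.
have [a ea] : exists a : form {poly coord}, a = map_mx polyC v by eexists.
pose D := ((3 * n).+1 * r.+1)%N.
have D2 : (2 <= D)%N.
  by rewrite /D; case: (n) n_gt0 => // p _; nia.
have hom : coord_eval c ('X *: a) generic_lift.1 = 'X^D * coord_eval c a generic_lift.1 /\
    'X^2 * coord_eval c ('X *: a) generic_lift.2 = 'X^D * coord_eval c a generic_lift.2.
  have h1 := @generic_lift_quad _ c a (disc a) 1.
  have h2 := @generic_lift_quad _ c ('X *: a) (disc a) 'X.
  rewrite expr1n mul1r in h1; rewrite expr1n rmorph1 mul1r in h1.
  have := h2 (discZ _ _).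
  have -> : map_mx (quad_in (disc a)) ('X *: a) = quad_in (disc a) 'X *: map_mx (quad_in (disc a)) a.
    exact: map_mxZ.
  rewrite rmorphXn lift_invZ // -(h1 erefl) -!rmorphXn.
  have -> : ((2 * n).+1 * r.+1 + 2 * N = D)%N by rewrite -hN /D; lia.
  move=> E; apply: (quad_inj _ (disc a)); apply: etrans (etrans _ E) _.
    by rewrite rmorphM; ring.
  by rewrite !(rmorphM (quad_in (disc a))); ring.
split; split.
- by apply: coord_homog; rewrite -ec -ea; case: hom.
- by apply: SL2_invariantP => A f g a' dg; case: (inv A f g a' dg).
- apply: coord_homog; rewrite -ec -ea; case: hom => _ h.
  apply: (@lregX _ 'X 2); first exact: (mulfI (negbT (polyX_eq0 _))).
  by rewrite h mulrA -exprD subnKC.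
- by apply: SL2_invariantP => A f g a' dg; case: (inv A f g a' dg).
Qed.

End LiftComponents.

(** Stands in for nonvanishing, since the quadratic extension is treated only as a ring. *)
Definition invertible (A : comNzRingType) (x : A) : Prop := exists x', x * x' = 1.

Lemma invertible1 (A : comNzRingType) : invertible (1 : A).
Proof. by exists 1; rewrite mulr1. Qed.

Lemma invertibleM (A : comNzRingType) (x y : A) : invertible x -> invertible y -> invertible (x * y).
Proof. by move=> [x' hx] [y' hy]; exists (x' * y'); rewrite mulrACA hx hy mulr1. Qed.

Lemma invertibleX (A : comNzRingType) (x : A) m : invertible x -> invertible (x ^+ m).
Proof. by move=> [x' hx]; exists (x' ^+ m); rewrite -exprMn hx expr1n. Qed.

Lemma invertibleN (A : comNzRingType) (x : A) : invertible x -> invertible (- x).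
Proof. by move=> [x' hx]; exists (- x'); rewrite mulrNN. Qed.

Lemma invertible_map (A B : comNzRingType) (f : {rmorphism A -> B}) x : invertible x -> invertible (f x).
Proof. by move=> [x' hx]; exists (f x'); rewrite -rmorphM hx rmorph1. Qed.

Lemma invertible_reg (A : comNzRingType) (x t : A) : invertible x -> x * t = 0 -> t = 0.
Proof. by move=> [x' hx] h; rewrite -[t]mul1r -hx mulrAC h mul0r. Qed.

Lemma expr_cancel (A : comNzRingType) (x x' : A) r s : x * x' = 1 -> x ^+ (r + s) * x' ^+ s = x ^+ r.
Proof. by move=> h; rewrite exprD -mulrA -exprMn h expr1n mulr1. Qed.

(** * Polynomials even in one variable *)

Section EvenVariable.

Variables (k : fieldType) (M : nat) (i0 : 'I_M).

Definition square_var : {mpoly k[M]} -> {mpoly k[M]} :=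
  mmap (@mpolyC M k) (fun i => if i == i0 then 'X_i ^+ 2 else 'X_i).
Definition flip_var : {mpoly k[M]} -> {mpoly k[M]} :=
  mmap (@mpolyC M k) (fun i => if i == i0 then - 'X_i else 'X_i).

HB.instance Definition _ := GRing.RMorphism.on square_var.
HB.instance Definition _ := GRing.RMorphism.on flip_var.

Definition double_exp (m : multinom M) : multinom M :=
  [multinom if i == i0 then (m i).*2 else m i | i < M].
Definition half_exp (m : multinom M) : multinom M :=
  [multinom if i == i0 then (m i)./2 else m i | i < M].

Lemma double_expK : cancel double_exp half_exp.
Proof. by move=> m; apply/mnmP => i; rewrite !mnmE; case: eqP; rewrite ?doubleK. Qed.

Lemma half_expK (m : multinom M) : ~~ odd (m i0) -> double_exp (half_exp m) = m.
Proof.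
move=> o; apply/mnmP => i; rewrite !mnmE; case: eqP => // ->.
by rewrite -[RHS]odd_double_half (negPf o).
Qed.

Lemma square_varXn (m : multinom M) : square_var 'X_[m] = 'X_[double_exp m].
Proof.
rewrite /square_var mmapX /mmap1 [RHS]mpolyXE_id; apply: eq_bigr => i _.
by rewrite mnmE; case: eqP => // _; rewrite -exprM mul2n.
Qed.

Lemma flip_varXn (m : multinom M) : flip_var 'X_[m] = (-1) ^+ m i0 *: 'X_[m].
Proof.
rewrite /flip_var mmapX /mmap1 [in RHS]mpolyXE_id (bigD1 i0) //= [in RHS](bigD1 i0) //=.
rewrite eqxx (exprNn 'X_i0) -mulrA -[RHS]mul_mpolyC rmorph_sign; congr (_ * (_ * _)).
by apply: eq_bigr => i /negPf ->.
Qed.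

Lemma square_varZ c P : square_var (c *: P) = c *: square_var P.
Proof. by rewrite /square_var mmapZ mul_mpolyC. Qed.

Lemma flip_varZ c P : flip_var (c *: P) = c *: flip_var P.
Proof. by rewrite /flip_var mmapZ mul_mpolyC. Qed.

Lemma square_varE P : square_var P = \sum_(m <- msupp P) P@_m *: 'X_[double_exp m].
Proof.
rewrite {1}[P]mpolyE rmorph_sum; apply: eq_bigr => m _.
by rewrite -square_varXn; apply: square_varZ.
Qed.

Lemma flip_varE P : flip_var P = \sum_(m <- msupp P) (P@_m * (-1) ^+ m i0) *: 'X_[m].
Proof.
rewrite {1}[P]mpolyE rmorph_sum; apply: eq_bigr => m _.
by rewrite -scalerA -flip_varXn; apply: flip_varZ.
Qed.

Lemma square_var_inj : injective square_var.
Proof.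
apply: raddf_inj => P P0; have {}P0 : square_var P = 0 := P0; apply/mpolyP => m; rewrite mcoeff0.
have := congr1 (fun Q => Q@_(double_exp m)) P0; rewrite mcoeff0 square_varE raddf_sum /=.
have [mP|/memN_msupp_eq0 -> //] := boolP (m \in msupp P).
rewrite (bigD1_seq m) ?msupp_uniq //= mcoeffZ mcoeffX eqxx mulr1 big1 ?addr0 // => m' nm.
by rewrite mcoeffZ mcoeffX (inj_eq (can_inj double_expK)) (negPf nm) mulr0.
Qed.

Lemma flip_var_fixed P : 2 != 0 :> k -> flip_var P = P -> exists Q, P = square_var Q.
Proof.
move=> two fP; have ev m : m \in msupp P -> ~~ odd (m i0).
  move=> mP; apply: contraL (mP) => o; rewrite mcoeff_msupp negbK.
  have := congr1 (fun Q => Q@_m) fP; rewrite flip_varE raddf_sum /=.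
  under eq_bigr do rewrite mcoeffZ mcoeffX.
  rewrite (bigD1_seq m) ?msupp_uniq //= eqxx mulr1 big1 ?addr0 => [|m' /negPf ->]; last by rewrite !mulr0.
  rewrite -signr_odd o expr1 mulrN1 => /eqP; rewrite -subr_eq0 -opprD oppr_eq0 -mulr2n.
  by rewrite -mulr_natr mulf_eq0 (negPf two) orbF.
exists (\sum_(m <- msupp P) P@_m *: 'X_[half_exp m]).
rewrite rmorph_sum {1}[P]mpolyE big_seq [RHS]big_seq; apply: eq_bigr => m mP.
by rewrite [RHS]square_varZ square_varXn half_expK ?ev.
Qed.

End EvenVariable.

Lemma coord_eval_GL2_domain (k : fieldType) (d e : nat) (A : idomainType)
    (f : {rmorphism k -> A}) D w F g (a : 'M[A]_(d.+1, e.+1)) :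
  invariant_forms D F -> ((d + e) * D = 2 * w)%N -> \det g != 0 ->
  coord_eval f (act g a) F = \det g ^+ w * coord_eval f a F.
Proof.
move=> hF hD ng; apply/eqP; rewrite -tofrac_eq; apply/eqP.
rewrite rmorphM rmorphXn !(coord_eval_comp f (@FracField.tofrac A)) map_act -det_map_mx.
apply: (coord_eval_GL2 (gi := (\det (map_mx (@FracField.tofrac A) g))^-1) _ _ hF hD).
by rewrite mulfV // det_map_mx tofrac_eq0.
Qed.

(** * The slice *)

Section Slice.

Variables (d e : nat).
Local Notation n := (d + e)%N.
Local Notation form A := 'M[A]_(d.+1, e.+1).
Hypothesis d_gt0 : (0 < d)%N.
Hypothesis e_gt0 : (0 < e)%N.
Hypothesis n_gt2 : (2 < n)%N.

Notation index := ('I_d.+1 * 'I_e.+1)%type.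
Implicit Types x y : index.
Implicit Types A B : comNzRingType.

Definition level x : nat := lev x.1 x.2.
Definition star x : index := (rev_ord x.1, rev_ord x.2).

(* The entry at x has torus weight n - 2 (level x).  With the entry at
   star u_index, of weight -1 for odd n and -2 for even n, raised to the power
   twist (level x), it forms a product of weight 0. *)
Definition half_n : nat := n./2.
Definition u_level : nat := if odd n then half_n else half_n.-1.
Definition twist (l : nat) : nat := if odd n then (n - 2 * l)%N else (half_n - l)%N.
Definition lift_deg (l : nat) : nat := (n * (twist l).+1)./2.

Definition corner : index := (ord0, ord0).
(** The entry of level [u_level] with the least row: row 0 as long as the level is at most [e].
    [u_index] is the next entry on the same level. *)
Definition y_index : index := (inord (u_level - e), inord (u_level - (u_level - e))).
Definition u_index : index := (inord (u_level - e).+1, inord (u_level - (u_level - e)).-1).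
Definition z_index : index :=
  if odd n then u_index else (inord (half_n - e), inord (half_n - (half_n - e))).

(* One index of each pair {x, star x}. *)
Definition pos x : bool :=
  ((2 * level x < n) || ((2 * level x == n) && (2 * x.1 <= d)))%N.

Lemma level_le x : (level x <= n)%N.
Proof. exact: lev_le. Qed.

Lemma starK : involutive star.
Proof. by case=> i j; rewrite /star /= !rev_ordK. Qed.

Lemma level_star x : level (star x) = (n - level x)%N.
Proof.
by case: x => i j; rewrite /level /lev /star /= !subSS; have := ltn_ord i; have := ltn_ord j; lia.
Qed.

Lemma index_eqP x y : (x.1 = y.1 :> nat) -> (x.2 = y.2 :> nat) -> x = y.
Proof. by case: x y => [i j] [i' j'] /= h1 h2; congr (_, _); apply: val_inj. Qed.

Lemma pos_total x : pos x || pos (star x).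
Proof.
rewrite /pos level_star /=; have := level_le x; rewrite /level /lev.
by case: x => i j /=; have := ltn_ord i; have := ltn_ord j; lia.
Qed.

Lemma pos_both x : pos x -> pos (star x) -> star x = x.
Proof.
rewrite /pos level_star /=; have := level_le x; rewrite /level /lev.
case: x => i j /=; have := ltn_ord i; have := ltn_ord j => lj li ln h1 h2.
by apply: index_eqP => /=; lia.
Qed.

Lemma pos_level x : pos x -> (2 * level x <= n)%N.
Proof. rewrite /pos; lia. Qed.

Lemma level_pos x : (2 * level x < n)%N -> pos x.
Proof. by rewrite /pos => ->. Qed.

Lemma star_level x : (2 * level x < n)%N -> ~~ pos (star x) && (star x != x).
Proof.
move=> h; have := level_star x; have := level_le x => l1 l2.
apply/andP; split; first by rewrite /pos l2; lia.
by apply/eqP => E; rewrite E in l2; lia.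
Qed.

(** Positivity excludes degree (1, 1): for [n = 2] the only level below the middle is that of the
    corner. *)
Lemma u_level_bounds : (0 < u_level /\ 2 * u_level < n)%N.
Proof. by rewrite /u_level /half_n; case: ifP; lia. Qed.

Lemma lift_degE l : (2 * l <= n)%N -> (n * (twist l).+1 = 2 * lift_deg l)%N.
Proof.
move=> hl; rewrite /lift_deg mul2n; apply: esym; rewrite -[RHS]odd_double_half.
suff -> : odd (n * (twist l).+1) = false by [].
by rewrite oddM /twist; case: ifP => o; rewrite ?o //= oddB ?o //= mul2n odd_double.
Qed.

Lemma lift_deg_balanced l : (2 * l <= n)%N ->
  (l + twist l * (n - u_level) = lift_deg l)%N.
Proof.
move=> hl; have := lift_degE hl; rewrite /twist /u_level /half_n.
by have := odd_double_half n; case: ifP => o /=; nia.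
Qed.

Lemma y_level : level y_index = u_level.
Proof.
have [h1 h2] := u_level_bounds.
by rewrite /level /lev /y_index /= !inordK; lia.
Qed.

Lemma u_indexE : (u_index.1 = y_index.1.+1 :> nat) /\ (y_index.2 = u_index.2.+1 :> nat).
Proof.
have [h1 h2] := u_level_bounds.
by rewrite /u_index /y_index /= !inordK; lia.
Qed.

Lemma u_indexL : level u_index = u_level.
Proof. by have := y_level; have := u_indexE; rewrite /level /lev; lia. Qed.

Lemma z_level : level z_index = half_n.
Proof.
rewrite /z_index; case: ifP => o; first by rewrite u_indexL /u_level o.
by rewrite /level /lev /= /half_n !inordK; lia.
Qed.

Lemma pos_y : pos y_index.
Proof. by apply: level_pos; rewrite y_level; have [] := u_level_bounds. Qed.

Lemma pos_u : pos u_index.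
Proof. by apply: level_pos; rewrite u_indexL; have [] := u_level_bounds. Qed.

Lemma pos_z : pos z_index.
Proof.
case o : (odd n); first by rewrite /z_index o pos_u.
rewrite /pos z_level /z_index o /= /half_n inordK; lia.
Qed.

Lemma pos_corner : pos corner.
Proof. by apply: level_pos; rewrite /level /lev /=; lia. Qed.

Lemma corner_level x : (level x == 0%N) = (x == corner).
Proof.
apply/eqP/eqP => [|-> //]; rewrite /level /lev => h.
by apply: index_eqP => /=; lia.
Qed.

Lemma u_neq_y : u_index != y_index.
Proof. by apply/eqP => E; have [h _] := u_indexE; rewrite E in h; lia. Qed.

Lemma star_neq x y : (2 * level x < n)%N -> (2 * level y <= n)%N -> star x != y.
Proof.
by move=> h1 h2; apply/eqP => E; have := level_star x; rewrite E; have := level_le x; lia.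
Qed.

(* The slice has coordinates xi with xi z_index = 1 and xi (star u_index) = 0; the
   entries at x and star x have real part xi x and imaginary part xi (star x), in
   units of sigma, except that the imaginary part at y_index is sigma itself. *)
Section Point.

Variables (A : comNzRingType) (xi : index -> A).

Definition beta : A := xi u_index.
Definition sigma : A := xi (star y_index).

Definition imag x : A :=
  if x == y_index then 1 else if star x == x then 0 else xi (star x).

Definition wcoord x : A := xi x + sigma * imag x.
Definition wcoordC x : A := xi x - sigma * imag x.

(** In the torus normal form the conjugate of the entry at x is [beta ^+ (half_n - level x)] times
    the entry at [star x]. The common factor [beta ^+ half_n] clears the resulting denominators. The
    corners are solved for afterwards. *)
Definition pcoord x : A :=
  if (x == corner) || (x == star corner) then 0
  else if pos x then beta ^+ half_n * wcoord x
  else beta ^+ (n - level x) * wcoordC (star x).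

Definition pre_point : form A := \matrix_(i, j) pcoord (i, j).

Definition scale_factor : A :=
  n`!%:R * (omega_sum pre_point 1 * omega_sum pre_point n.-1).

(* The corner entries occur linearly in q0 and q2, and are determined by
   q0 = q2 = 0; scale_factor clears the denominators. *)
Definition point_coord x : A :=
  if x == corner then - (omega_sum pre_point 1 * q0 pre_point)
  else if x == star corner then - ((-1) ^+ n * omega_sum pre_point n.-1 * q2 pre_point)
  else scale_factor * pcoord x.

Definition slice_point : form A := \matrix_(i, j) point_coord (i, j).

End Point.

Lemma wcoord_map A B (f : {rmorphism A -> B}) (xi : index -> A) x :
  f (wcoord xi x) = wcoord (f \o xi) x /\ f (wcoordC xi x) = wcoordC (f \o xi) x.
Proof.
have fimag : f (imag xi x) = imag (f \o xi) x.
  by rewrite /imag; case: eqP => _; [rewrite rmorph1|case: eqP; rewrite ?rmorph0].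
by rewrite /wcoord /wcoordC rmorphD rmorphB !rmorphM fimag.
Qed.

Lemma pre_point_map A B (f : {rmorphism A -> B}) (xi : index -> A) :
  map_mx f (pre_point xi) = pre_point (f \o xi).
Proof.
apply/matrixP => i j; rewrite !mxE /pcoord; case: ifP => _; first exact: rmorph0.
have [h _] := wcoord_map f xi (i, j); have [_ hC] := wcoord_map f xi (star (i, j)).
by case: ifP => _; rewrite rmorphM rmorphXn ?h ?hC.
Qed.

Lemma slice_point_map A B (f : {rmorphism A -> B}) (xi : index -> A) :
  map_mx f (slice_point xi) = slice_point (f \o xi).
Proof.
have fpre := pre_point_map f xi.
have fp x : f (pcoord xi x) = pcoord (f \o xi) x.
  by have := congr1 (fun a : 'M__ => a x.1 x.2) fpre; rewrite !mxE -surjective_pairing.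
apply/matrixP => i j; rewrite !mxE /point_coord; case: ifP => _.
  by rewrite rmorphN rmorphM omega_sum_map q0_map fpre.
case: ifP => _.
  by rewrite rmorphN rmorphM (rmorphM f (_ ^+ _)) rmorph_sign omega_sum_map q2_map fpre.
by rewrite rmorphM /scale_factor !(rmorphM f (_%:R)) rmorphM rmorph_nat !omega_sum_map fpre fp.
Qed.

Lemma level_sum_corners A (a b : form A) l : (0 < l < n)%N ->
  (forall x, x != corner -> x != star corner -> a x.1 x.2 = b x.1 x.2) ->
  level_sum a l = level_sum b l.
Proof.
move=> /andP[l0 ln] h; apply: eq_bigr => i _; apply: eq_bigr => j /eqP ijl.
apply: (h (i, j)); apply/eqP => E.
  have : level (i, j) = level corner by rewrite E.
  by rewrite /level /= ijl /lev /=; lia.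
have : level (i, j) = level (star corner) by rewrite E.
by rewrite level_star /level /= ijl /lev /=; lia.
Qed.

Lemma omega_sum_corners A (a b : form A) l :
  (forall x, x != corner -> x != star corner -> a x.1 x.2 = b x.1 x.2) ->
  omega_sum a l = omega_sum b l.
Proof.
move=> h; apply: eq_bigr => i _; apply: eq_bigr => j _.
have [E|ne] := eqVneq (i, j) corner.
  by rewrite omega_coef0 ?mul0r //; case: E => -> ->.
have [E|ne'] := eqVneq (i, j) (star corner).
  rewrite omega_coefn ?mul0r // -[lev i j]/(level (i, j)) E level_star /level /lev /=; lia.
by rewrite (h (i, j)).
Qed.

Lemma level_sum0 A (a : form A) : level_sum a 0 = a ord0 ord0.
Proof.
rewrite /level_sum (bigD1 ord0) //= (bigD1 ord0) //= !big1 ?addr0 //.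
  by move=> i ni; rewrite big1 // => j; rewrite /lev addn_eq0 => /andP[/eqP i0 _]; case/eqP: ni; apply: val_inj.
by move=> j /andP[j0 nj]; case/eqP: nj; apply: val_inj => /=; move: j0; rewrite /lev add0n => /eqP.
Qed.

Lemma level_sumn A (a : form A) : level_sum a n = a ord_max ord_max.
Proof.
rewrite /level_sum (bigD1 ord_max) //= (bigD1 ord_max) ?/lev //= !big1 ?addr0 //.
  move=> i ni; rewrite big1 // => j; rewrite /lev => /eqP h; case/eqP: ni; apply: val_inj => /=.
  by have := ltn_ord i; have := ltn_ord j; lia.
move=> j /andP[/eqP j0 nj]; case/eqP: nj; apply: val_inj => /=; move: j0 => /=; lia.
Qed.

Lemma omega_sum0 A (a : form A) : omega_sum a 0 = 0.
Proof.
by rewrite /omega_sum big1 // => i _; rewrite big1 // => j /eqP h; rewrite omega_coef0 ?mul0r.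
Qed.

Lemma omega_sumn A (a : form A) : omega_sum a n = 0.
Proof.
by rewrite /omega_sum big1 // => i _; rewrite big1 // => j /eqP h; rewrite omega_coefn ?mul0r.
Qed.

Lemma omega_sum_big A (a : form A) l : (n < l)%N -> omega_sum a l = 0.
Proof.
move=> nl; rewrite /omega_sum big1 // => i _; rewrite big1 // => j /eqP h.
by have := lev_le i j; rewrite h; lia.
Qed.

(** The corner entries are the level sums at 0 and [n], so they enter only the first and the last
    term; [omega_sum] never sees them. *)
Lemma qsum_corners A (a b : form A) r :
  (forall x, x != corner -> x != star corner -> a x.1 x.2 = b x.1 x.2) ->
  qsum a r = qsum b r + n`!%:R * (a ord0 ord0 - b ord0 ord0) * omega_sum b (r n)
    + (-1) ^+ n * n`!%:R * (a ord_max ord_max - b ord_max ord_max) * omega_sum b (r 0%N).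
Proof.
move=> h; rewrite /qsum.
have E : n = n.-2.+2 by lia.
rewrite !big_ord_recl /=.
pose F (c : form A) (l : nat) :=
  (-1) ^+ l * (l`! * (n - l)`!)%:R * level_sum c l * omega_sum c (r (n - l)%N).
have S (c : form A) : \sum_(l < n.+1) F c l =
    F c 0%N + \sum_(1 <= l < n) F c l + F c n.
  by rewrite big_ord_recr /= -(big_mkord xpredT) big_ltn //; lia.
have := S a; have := S b; rewrite !big_ord_recl /= => -> ->.
rewrite (eq_big_nat _ _ (F2 := F b)); last first.
  by move=> l hl; rewrite /F (level_sum_corners hl h) (omega_sum_corners _ h).
rewrite /F !(omega_sum_corners _ h) !level_sum0 !level_sumn subn0 subnn fact0 mul1n muln1 expr0.
ring.
Qed.

Lemma slice_point_off A (xi : index -> A) x : x != corner -> x != star corner ->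
  slice_point xi x.1 x.2 = scale_factor xi * pcoord xi x.
Proof.
move=> h1 h2; rewrite mxE /point_coord -surjective_pairing (negPf h1) (negPf h2) //.
Qed.

Lemma pcoordE A (xi : index -> A) x : pcoord xi x = pre_point xi x.1 x.2.
Proof. by rewrite mxE -surjective_pairing. Qed.

Lemma star_corner : star corner = (ord_max, ord_max).
Proof. by apply: index_eqP; rewrite /= subSS subn0. Qed.

Lemma omega_sum_point A (xi : index -> A) l :
  omega_sum (slice_point xi) l = scale_factor xi * omega_sum (pre_point xi) l.
Proof.
rewrite -omega_sumZ; apply: omega_sum_corners => x h1 h2.
by rewrite slice_point_off // pcoordE [RHS]mxE.
Qed.

Lemma slice_point_q0 A (xi : index -> A) : q0 (slice_point xi) = 0.
Proof.
have h x : x != corner -> x != star corner ->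
    slice_point xi x.1 x.2 = (scale_factor xi *: pre_point xi) x.1 x.2.
  by move=> h1 h2; rewrite slice_point_off // pcoordE [RHS]mxE.
rewrite /q0 (qsum_corners _ h) omega_sum0 mulr0 addr0 qsumZ omega_sumZ.
have -> : slice_point xi ord0 ord0 = - (omega_sum (pre_point xi) 1 * q0 (pre_point xi)).
  by rewrite mxE.
have -> : (scale_factor xi *: pre_point xi) ord0 ord0 = 0.
  by rewrite !mxE /pcoord -[(ord0, ord0)]/corner eqxx mulr0.
rewrite /scale_factor /q0.
move: (n`!%:R : A) (omega_sum (pre_point xi) 1) (omega_sum (pre_point xi) n.-1)
  (qsum (pre_point xi) predn) => p q r t; ring.
Qed.

Lemma slice_point_q2 A (xi : index -> A) : q2 (slice_point xi) = 0.
Proof.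
have h x : x != corner -> x != star corner ->
    slice_point xi x.1 x.2 = (scale_factor xi *: pre_point xi) x.1 x.2.
  by move=> h1 h2; rewrite slice_point_off // pcoordE [RHS]mxE.
have nc : star corner != corner.
  by apply/eqP => E; have := level_star corner; rewrite E /level /lev /=; lia.
rewrite /q2 (qsum_corners _ h) omega_sum_big ?mulr0 ?addr0 // qsumZ omega_sumZ.
have -> : slice_point xi ord_max ord_max =
    - ((-1) ^+ n * omega_sum (pre_point xi) n.-1 * q2 (pre_point xi)).
  by rewrite mxE /point_coord -star_corner (negPf nc) eqxx.
have -> : (scale_factor xi *: pre_point xi) ord_max ord_max = 0.
  by rewrite !mxE /pcoord -star_corner eqxx orbT mulr0.
have sg : (-1) ^+ n * (-1) ^+ n = 1 :> A by rewrite -signr_odd -expr2 sqrr_sign.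
rewrite /scale_factor /q2; move: ((-1) ^+ n : A) sg => sg sg2.
move: (n`!%:R : A) (omega_sum (pre_point xi) 1) (omega_sum (pre_point xi) n.-1)
  (qsum (pre_point xi) succn) => p q r t.
transitivity ((1 - sg * sg) * (p * (q * r)) ^+ 2 * t); first by ring.
by rewrite sg2 subrr !mul0r.
Qed.

(** The two equations are linear, each in one corner, with leading coefficients assumed regular.
    With this lemma forms are identified below by comparing their other entries only. *)
Lemma corners_unique A (a b : form A) :
  (forall x, x != corner -> x != star corner -> a x.1 x.2 = b x.1 x.2) ->
  q0 a = 0 -> q2 a = 0 -> q0 b = 0 -> q2 b = 0 ->
  (forall t : A, n`!%:R * omega_sum b n.-1 * t = 0 -> t = 0) ->
  (forall t : A, n`!%:R * omega_sum b 1 * t = 0 -> t = 0) -> a = b.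
Proof.
move=> h a0 a2 b0 b2 r1 r2.
have := qsum_corners predn h; rewrite -!/(q0 _) a0 b0 omega_sum0 mulr0 addr0 add0r mulrAC.
move=> /esym /r1 /eqP; rewrite subr_eq0 => /eqP e1.
have := qsum_corners succn h; rewrite -!/(q2 _) a2 b2 omega_sum_big // mulr0 !add0r => e2.
have {}e2 : n`!%:R * omega_sum b 1 * (a ord_max ord_max - b ord_max ord_max) = 0.
  have sg : (-1) ^+ n * (-1) ^+ n = 1 :> A by rewrite -signr_odd -expr2 sqrr_sign.
  move: e2; move: ((-1) ^+ n : A) sg => z z2.
  move: (n`!%:R : A) (omega_sum b 1) (a ord_max ord_max - b ord_max ord_max) => p q r e2.
  transitivity (z * z * (p * q * r)); first by rewrite z2 mul1r.
  by transitivity (z * (z * p * r * q)); [ring | rewrite -e2 mulr0].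
move/r2/eqP: e2; rewrite subr_eq0 => /eqP e2.
apply/matrixP => i j.
have [[-> ->]//|ne] := eqVneq (i, j) corner.
have [|ne'] := eqVneq (i, j) (star corner); first by rewrite star_corner => -[-> ->].
exact: (h (i, j)).
Qed.


Lemma half_n_le : (half_n <= n)%N.
Proof. by rewrite /half_n; lia. Qed.

Lemma omega_sum_pair A (a : form A) l :
  omega_sum a l = \sum_(x : index | level x == l) omega_coef A x.1 x.2 * a x.1 x.2.
Proof. by rewrite /omega_sum pair_big_dep. Qed.

Lemma level_sum_pair A (a : form A) l :
  level_sum a l = \sum_(x : index | level x == l) a x.1 x.2.
Proof. by rewrite /level_sum pair_big_dep. Qed.

Lemma omega_coef_star A x : omega_coef A (star x).1 (star x).2 = - omega_coef A x.1 x.2.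
Proof.
case: x => i j; rewrite /omega_coef /= !subSS.
have li : (i <= d)%N by rewrite -ltnS.
have lj : (j <= e)%N by rewrite -ltnS.
by rewrite !natrM !natrB //; ring.
Qed.

Lemma q1_slice_point A (xi : index -> A) :
  q1 (slice_point xi) = scale_factor xi ^+ 2 * q1 (pre_point xi).
Proof.
have h x : x != corner -> x != star corner ->
    slice_point xi x.1 x.2 = (scale_factor xi *: pre_point xi) x.1 x.2.
  by move=> h1 h2; rewrite slice_point_off // pcoordE [RHS]mxE.
by rewrite /q1 (qsum_corners _ h) omega_sum0 omega_sumn !mulr0 !addr0 qsumZ; ring.
Qed.

Section SliceCoordinates.

Variables (A : comNzRingType) (xi : index -> A).
Hypothesis xi_z : xi z_index = 1.
Hypothesis xi_u : xi (star u_index) = 0.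

Local Notation b := (beta xi).

Lemma beta_odd : odd n -> b = 1.
Proof. by move=> o; rewrite /beta -xi_z /z_index o. Qed.

(** Merges the two parities: for odd [n] the entry [beta] is 1 and exponents are immaterial. *)
Lemma beta_pow i j : (~~ odd n -> i = j) -> b ^+ i = b ^+ j.
Proof.
case o : (odd n) => h; last by rewrite h.
by rewrite beta_odd // !expr1n.
Qed.

Lemma pcoord_pos x : pos x -> x != corner -> pcoord xi x = b ^+ half_n * wcoord xi x.
Proof.
move=> px nx; rewrite /pcoord (negPf nx) px /=; case: eqP => // E.
have /andP[h _] : ~~ pos (star corner) && (star corner != corner).
  by apply: star_level; rewrite /level /lev /=; lia.
by rewrite -E px in h.
Qed.

Lemma imag_star x : star x = x -> imag xi x = 0.
Proof.
move=> E; rewrite /imag E eqxx; case: eqP => // Ey.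
have [_ h] := u_level_bounds; rewrite -y_level in h.
by have /andP[_ /eqP] := star_level h; rewrite -Ey.
Qed.

Lemma pcoord_star x : pos x -> x != corner ->
  pcoord xi (star x) = b ^+ level x * wcoordC xi x.
Proof.
move=> px nx; rewrite /pcoord starK level_star subKn ?level_le //.
have -> : (star x == star corner) = false by rewrite (inj_eq (inv_inj starK)) (negPf nx).
have -> : (star x == corner) = false.
  apply/eqP => E; have := pos_level px; have := level_star x.
  by rewrite E /(level corner) /lev /=; have := level_le x; lia.
(* Both clauses of [pcoord] apply at a fixed point of [star], which lies on the middle level; there
   the imaginary part is 0 and the exponents agree. *)
rewrite /=; case: ifP => // ps; have E := pos_both px ps.
rewrite E /wcoord /wcoordC imag_star // mulr0 addr0 subr0; congr (_ * _).
apply: beta_pow => o; have := level_star x; rewrite E /half_n; have := level_le x.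
by have := odd_double_half n; rewrite (negPf o); lia.
Qed.

Lemma u_not_corner : u_index != corner.
Proof. by rewrite -corner_level u_indexL; have [] := u_level_bounds; lia. Qed.

Lemma pcoord_star_u : pcoord xi (star u_index) = b ^+ half_n.
Proof.
rewrite pcoord_star ?pos_u ?u_not_corner // u_indexL /wcoordC -[xi u_index]/b.
have -> : imag xi u_index = 0.
  by rewrite /imag (negPf u_neq_y) xi_u if_same.
rewrite mulr0 subr0 -exprSr; apply: beta_pow => o; have := u_level_bounds.
by rewrite /u_level (negPf o); lia.
Qed.

Lemma pcoord_u : pcoord xi u_index = b ^+ half_n.+1.
Proof.
rewrite pcoord_pos ?pos_u ?u_not_corner // /wcoord -[xi u_index]/b.
have -> : imag xi u_index = 0.
  by rewrite /imag (negPf u_neq_y) xi_u if_same.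
by rewrite mulr0 addr0 -exprSr.
Qed.

Definition lift_scale l : A :=
  (4 ^ lift_deg l * (lift_deg l)`! ^ 2)%:R *
  (q1 (slice_point xi) ^+ (3 * lift_deg l) *
   (scale_factor xi * b ^+ half_n) ^+ (twist l).+1).

Lemma off_corners x : pos x -> x != corner -> (x != star corner) && (star x != corner).
Proof.
move=> px nx; apply/andP; split; apply/eqP => E; have := pos_level px.
  by rewrite E level_star /level /lev /=; lia.
by rewrite -[x]starK E level_star /level /lev /=; lia.
Qed.

Lemma slice_point_pos x : pos x -> x != corner ->
  slice_point xi x.1 x.2 = scale_factor xi * (b ^+ half_n * wcoord xi x).
Proof.
move=> px nx; have /andP[n1 n2] := off_corners px nx.
by rewrite slice_point_off // pcoord_pos.
Qed.

Lemma slice_point_star x : pos x -> x != corner ->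
  slice_point xi (star x).1 (star x).2 = scale_factor xi * (b ^+ level x * wcoordC xi x).
Proof.
move=> px nx; have /andP[n1 n2] := off_corners px nx.
by rewrite slice_point_off ?pcoord_star // (inj_eq (inv_inj starK)).
Qed.

Lemma lift_slice x : pos x -> x != corner ->
  lift_inv (slice_point xi) (q1 (slice_point xi)) x.1 x.2 (star u_index).1 (star u_index).2
    (twist (level x)) (lift_deg (level x)) = lift_scale (level x) * wcoord xi x.
Proof.
move=> px nx; have pl := pos_level px.
rewrite (lift_inv_diag (slice_point_q0 xi) (slice_point_q2 xi) (lift_degE pl)); last first.
  by rewrite -/(level (star u_index)) level_star u_indexL; apply: lift_deg_balanced.
have /andP[n1 n2] := off_corners pos_u u_not_corner.
rewrite slice_point_pos // slice_point_off ?pcoord_star_u //; last first.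
  by rewrite (inj_eq (inv_inj starK)) u_not_corner.
by rewrite /lift_scale exprS; ring.
Qed.

(** The other square root yields the conjugate coordinate with the same scale. Half the sum and half
    the difference of the two values thus isolate the real and the imaginary part. *)
Lemma lift_slice_conj x : pos x -> x != corner ->
  lift_inv (slice_point xi) (- q1 (slice_point xi)) x.1 x.2 (star u_index).1 (star u_index).2
    (twist (level x)) (lift_deg (level x)) = lift_scale (level x) * wcoordC xi x.
Proof.
move=> px nx; have pl := pos_level px.
rewrite (lift_inv_anti (slice_point_q0 xi) (slice_point_q2 xi) (lift_degE pl)); last first.
  by rewrite -/(level (star u_index)) level_star u_indexL; apply: lift_deg_balanced.
have /andP[n1 n2] := off_corners pos_u u_not_corner.
have E1 := slice_point_star px nx; have E2 := slice_point_off xi u_not_corner n1.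
rewrite pcoord_u in E2; rewrite /= in E1.
rewrite /= !rev_ordK E1 E2.
rewrite /lift_scale; set s := scale_factor xi.
transitivity ((4 ^ lift_deg (level x) * (lift_deg (level x))`! ^ 2)%:R *
  q1 (slice_point xi) ^+ (3 * lift_deg (level x)) * s ^+ (twist (level x)).+1 *
  (b ^+ level x * (b ^+ half_n.+1) ^+ twist (level x)) * wcoordC xi x).
  by rewrite (exprMn _ s) (exprS s); ring.
rewrite (exprMn _ s) -!exprM -exprD.
have -> : b ^+ (level x + half_n.+1 * twist (level x)) = b ^+ (half_n * (twist (level x)).+1).
  apply: beta_pow => o; rewrite /twist (negPf o) /half_n.
  by have := odd_double_half n; rewrite (negPf o); nia.
ring.
Qed.

Definition wsum : A := \sum_(x : index | level x == 1%N) omega_coef A x.1 x.2 * wcoord xi x.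
Definition wsumC : A := \sum_(x : index | level x == 1%N) omega_coef A x.1 x.2 * wcoordC xi x.

Lemma level1_pos x : level x == 1%N -> pos x /\ x != corner.
Proof. by move=> /eqP h; split; [apply: level_pos|rewrite -corner_level]; rewrite h //; lia. Qed.

Lemma omega_sum_pre1 : omega_sum (pre_point xi) 1 = b ^+ half_n * wsum.
Proof.
rewrite omega_sum_pair mulr_sumr; apply: eq_bigr => x hx; have [px nx] := level1_pos hx.
by rewrite -pcoordE pcoord_pos // mulrCA.
Qed.

Lemma omega_sum_pren : omega_sum (pre_point xi) n.-1 = - (b * wsumC).
Proof.
rewrite omega_sum_pair (reindex_inj (inv_inj starK)) mulr_sumr -sumrN.
apply: eq_big => [x|x hx].
  by rewrite level_star; have := level_le x; lia.
have hx1 : level x == 1%N by move: hx; rewrite level_star; have := level_le x; lia.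
have [px nx] := level1_pos hx1.
by rewrite omega_coef_star -pcoordE pcoord_star // (eqP hx1) expr1; ring.
Qed.

(** In this shape the factor is visibly unchanged when conjugation exchanges [wsum] and [wsumC]. *)
Lemma scale_factorE : scale_factor xi = - (n`!%:R * b ^+ half_n.+1 * (wsum * wsumC)).
Proof. by rewrite /scale_factor omega_sum_pre1 omega_sum_pren exprS; ring. Qed.

End SliceCoordinates.

(* Conjugating sigma to - sigma moves the slice point within its GL_2-orbit. *)
Section Conjugation.

Variables (A : idomainType) (xi xi' : index -> A).
Hypothesis xi_z : xi z_index = 1.
Hypothesis xi'_y : xi' (star y_index) = - xi (star y_index).
Hypothesis xi'_E : forall x, x != star y_index -> xi' x = xi x.
Hypothesis torsion_free : forall m (x : A), x *+ m.+1 = 0 -> x = 0.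

Let pos_not_star_y x : pos x -> x != star y_index.
Proof.
have [_ h] := u_level_bounds; rewrite -y_level in h.
by have /andP[np _] := star_level h; apply: contraTneq => ->.
Qed.

Lemma conj_beta : beta xi' = beta xi.
Proof. by rewrite /beta xi'_E // pos_not_star_y // pos_u. Qed.

Lemma conj_wcoord x : pos x -> wcoord xi' x = wcoordC xi x.
Proof.
move=> px; rewrite /wcoord /wcoordC /sigma xi'_y xi'_E ?pos_not_star_y // mulNr; congr (_ - _ * _).
rewrite /imag; case: eqP => // /eqP ny; case: eqP => // _.
by rewrite xi'_E // (inj_eq (inv_inj starK)).
Qed.

Lemma conj_wcoordC x : pos x -> wcoordC xi' x = wcoord xi x.
Proof.
move=> px; rewrite /wcoord /wcoordC /sigma xi'_y xi'_E ?pos_not_star_y // mulNr opprK; congr (_ + _ * _).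
rewrite /imag; case: eqP => // /eqP ny; case: eqP => // _.
by rewrite xi'_E // (inj_eq (inv_inj starK)).
Qed.

Let xi'_z : xi' z_index = 1.
Proof. by rewrite xi'_E ?xi_z // pos_not_star_y // pos_z. Qed.

Lemma conj_wsum : wsum xi' = wsumC xi.
Proof. by apply: eq_bigr => x hx; rewrite conj_wcoord //; case: (level1_pos hx). Qed.

Lemma conj_wsumC : wsumC xi' = wsum xi.
Proof. by apply: eq_bigr => x hx; rewrite conj_wcoordC //; case: (level1_pos hx). Qed.

Lemma conj_scale_factor : scale_factor xi' = scale_factor xi.
Proof.
by rewrite (scale_factorE xi_z) (scale_factorE xi'_z) conj_beta conj_wsum conj_wsumC [wsumC _ * _]mulrC.
Qed.

(** An antidiagonal matrix exchanges 0 and oo, so both sides have q0 = q2 = 0 and [corners_unique]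
    leaves only the explicit entries to compare. *)
Lemma act_slice_point : scale_factor xi != 0 ->
  act (anti2 1 (beta xi)) (slice_point xi) =
  beta xi ^+ (n - half_n) *: slice_point xi'.
Proof.
move=> nz; have nz' : n`!%:R * beta xi ^+ half_n.+1 * (wsum xi * wsumC xi) != 0.
  by rewrite -oppr_eq0 -scale_factorE.
move: (nz'); rewrite !mulf_eq0 !negb_or => /andP[/andP[nf]].
rewrite expf_eq0 /= => nb /andP[nw nwC].
have det_a : \det (anti2 1 (beta xi)) = - beta xi.
  by rewrite det2E !mxE /=; ring.
have ndet : \det (anti2 1 (beta xi)) != 0 by rewrite det_a oppr_eq0.
have cancel (t : A) : \det (anti2 1 (beta xi)) ^+ 2 * t = 0 -> t = 0.
  by move/eqP; rewrite mulf_eq0 expf_eq0 (negPf ndet) andbF => /eqP.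
have q0E : q0 (act (anti2 1 (beta xi)) (slice_point xi)) = 0.
  apply: cancel; rewrite q0_act // !mxE /= /qform slice_point_q0 slice_point_q2.
  by rewrite mulr0 !mul0r !addr0 mulr0.
have q2E : q2 (act (anti2 1 (beta xi)) (slice_point xi)) = 0.
  apply: cancel; rewrite q2_act // !mxE /= /qform slice_point_q0 slice_point_q2.
  by rewrite mulr0 !mul0r !addr0 mulr0.
have nzb : beta xi ^+ (n - half_n) != 0 by rewrite expf_neq0.
apply: corners_unique => //.
- move=> x n1 n2; rewrite act_anti -/(lev _ _) -/(level x) expr1n mul1r [RHS]mxE.
  rewrite -[slice_point xi _ _]/(slice_point xi (star x).1 (star x).2).
  have [px|npx] := boolP (pos x).
    rewrite (slice_point_star xi_z px n1) (slice_point_pos xi' px n1) conj_scale_factor.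
    rewrite conj_beta conj_wcoord //.
    have E : beta xi ^+ (n - level x) * beta xi ^+ level x = beta xi ^+ n.
      by rewrite -exprD subnK // level_le.
    have E' : beta xi ^+ (n - half_n) * beta xi ^+ half_n = beta xi ^+ n.
      by rewrite -exprD subnK // half_n_le.
    transitivity (scale_factor xi * beta xi ^+ n * wcoordC xi x); [rewrite -E|rewrite -E']; ring.
  have ps : pos (star x) by have := pos_total x; rewrite (negPf npx).
  have ns : star x != corner by rewrite -(inj_eq (inv_inj starK)) starK.
  rewrite (slice_point_pos xi ps ns) -{4}[x]starK -{3}[x]starK (slice_point_star xi'_z ps ns).
  rewrite conj_scale_factor conj_beta conj_wcoordC // level_star.
  have E : beta xi ^+ (n - level x + half_n) = beta xi ^+ (n - half_n + (n - level x)).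
    apply: (beta_pow xi_z) => o; rewrite /half_n; have := odd_double_half n; rewrite (negPf o).
    by clear; lia.
  move: E; rewrite !exprD; move: (beta xi ^+ _) (beta xi ^+ half_n) (beta xi ^+ (n - half_n)).
  move=> p q r E; transitivity (p * q * scale_factor xi * wcoord xi (star x)); first by ring.
  by rewrite E; ring.
- by rewrite /q0 qsumZ -/(q0 _) slice_point_q0 mulr0.
- by rewrite /q2 qsumZ -/(q2 _) slice_point_q2 mulr0.
- move=> t h; have nC : n`!%:R * omega_sum (beta xi ^+ (n - half_n) *: slice_point xi') n.-1 != 0.
    rewrite omega_sumZ omega_sum_point omega_sum_pren // conj_scale_factor conj_beta conj_wsumC.
    by do 4?[apply: mulf_neq0 => //]; rewrite oppr_eq0 mulf_neq0.
  by move/eqP: h; rewrite mulf_eq0 (negPf nC) => /eqP.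
- move=> t h; have nC : n`!%:R * omega_sum (beta xi ^+ (n - half_n) *: slice_point xi') 1 != 0.
    rewrite omega_sumZ omega_sum_point omega_sum_pre1 // conj_scale_factor conj_beta conj_wsum.
    by do 4?[apply: mulf_neq0 => //]; rewrite expf_neq0.
  by move/eqP: h; rewrite mulf_eq0 (negPf nC) => /eqP.
Qed.

End Conjugation.

(** * Restriction of invariants to the slice *)

Variable k : fieldType.
Hypothesis char0 : [pchar k] =i pred0.
Local Notation coord := (coord_poly k d e).
Local Notation v := (generic_point k d e).

(** Of the four omitted indices, the corners are solved from q0 = q2 = 0, and the other two are
    fixed by the torus and the scaling of f. *)
Definition free : {set index} :=
  [set x | [&& x != corner, x != star corner, x != star u_index & x != z_index]].

Definition n_free : nat := #|free|.

Definition var x : {mpoly k[n_free]} :=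
  if [pick i : 'I_n_free | enum_val i == x] is Some i then 'X_i
  else if x == z_index then 1 else 0.

Lemma var_enum i : var (enum_val i) = 'X_i.
Proof.
rewrite /var; case: pickP => [l /eqP /enum_val_inj -> //|/(_ i)].
by rewrite eqxx.
Qed.

Lemma var_not_free x : x \notin free -> var x = if x == z_index then 1 else 0.
Proof.
move=> nx; rewrite /var; case: pickP => // l /eqP E.
by move: nx; rewrite -E enum_valP.
Qed.

Lemma var_z : var z_index = 1.
Proof. by rewrite var_not_free ?eqxx // inE eqxx !andbF. Qed.

Lemma z_not_star_u : z_index != star u_index.
Proof.
rewrite eq_sym; apply: star_neq; first by rewrite u_indexL; have [] := u_level_bounds.
by rewrite z_level /half_n; lia.
Qed.

Lemma var_star_u : var (star u_index) = 0.
Proof.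
rewrite var_not_free ?inE ?eqxx ?andbF //.
by rewrite eq_sym (negPf z_not_star_u).
Qed.

Lemma z_not_corner : (z_index != corner) && (z_index != star corner).
Proof.
rewrite -corner_level z_level /half_n; apply/andP; split; first by lia.
apply/eqP => E; have := z_level; rewrite E level_star /half_n /level /lev /=; lia.
Qed.

Lemma star_y_free : star y_index \in free.
Proof.
have [h1 h2] := u_level_bounds; have y2 : (2 * level y_index < n)%N by rewrite y_level.
rewrite inE !(inj_eq (inv_inj starK)) [y_index == u_index]eq_sym u_neq_y /=.
apply/and3P; split.
- by apply: star_neq => //; rewrite /level /lev /=; lia.
- by rewrite -corner_level y_level -lt0n.
- by apply: star_neq => //; rewrite z_level /half_n; lia.
Qed.

Lemma u_free : ~~ odd n -> u_index \in free.
Proof.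
move=> o; have [h1 h2] := u_level_bounds; have u2 : (2 * level u_index < n)%N by rewrite u_indexL.
have /andP[_ nu] := star_level u2.
rewrite inE u_not_corner [u_index == star u_index]eq_sym nu /=; apply/andP; split.
  by rewrite eq_sym; apply: star_neq; rewrite ?u_indexL // /level /lev /=; lia.
apply/eqP => E; have := u_indexL; rewrite E z_level.
by rewrite /u_level (negPf o) /half_n; lia.
Qed.

Definition slice_eval : coord -> {mpoly k[n_free]} :=
  coord_eval (@mpolyC n_free k) (slice_point var).

HB.instance Definition _ := GRing.RMorphism.on slice_eval.

Definition specialize A (f : {rmorphism k -> A}) (xi : index -> A) : {mpoly k[n_free]} -> A :=
  mmap f (fun i => xi (enum_val i)).

HB.instance Definition _ A f xi := GRing.RMorphism.on (@specialize A f xi).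

Lemma specialize_var A (f : {rmorphism k -> A}) (xi : index -> A) :
  xi z_index = 1 -> xi (star u_index) = 0 -> xi corner = 0 -> xi (star corner) = 0 ->
  specialize f xi \o var =1 xi.
Proof.
move=> xz xu x0 x1 x /=; have [|nx] := boolP (x \in free).
  move=> hx; rewrite -(enum_rankK_in hx hx) var_enum /specialize mmapX mmap1U.
  by rewrite enum_rankK_in.
rewrite var_not_free //; move: nx; rewrite inE; case: eqP => [->|_].
  by rewrite [corner == _]eq_sym; have /andP[/negPf -> _] := z_not_corner; rewrite rmorph0.
case: eqP => [->|_].
  by rewrite [star _ == _]eq_sym; have /andP[_ /negPf ->] := z_not_corner; rewrite rmorph0.
case: eqP => [->|_].
  by rewrite [star _ == _]eq_sym (negPf z_not_star_u) rmorph0.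
by case: eqP => // -> _; rewrite rmorph1.
Qed.

Lemma slice_point_specialize A (f : {rmorphism k -> A}) (xi : index -> A) :
  xi z_index = 1 -> xi (star u_index) = 0 -> xi corner = 0 -> xi (star corner) = 0 ->
  map_mx (specialize f xi) (slice_point var) = slice_point xi.
Proof.
move=> xz xu x0 x1; rewrite slice_point_map; congr slice_point; apply/funext.
exact: specialize_var.
Qed.

(** The slice point [slice_point var] is generic: values at every slice point, over any ring, are
    specializations of [slice_eval]. *)
Lemma slice_eval_specialize A (f : {rmorphism k -> A}) (xi : index -> A) F :
  xi z_index = 1 -> xi (star u_index) = 0 -> xi corner = 0 -> xi (star corner) = 0 ->
  coord_eval f (slice_point xi) F = specialize f xi (slice_eval F).
Proof.
move=> xz xu x0 x1; rewrite /slice_eval (coord_eval_comp (@mpolyC _ k) (specialize f xi)).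
rewrite slice_point_specialize // /coord_eval; congr (mmap _ _ F); apply/funext => c.
by rewrite /= /specialize mmapC.
Qed.


Lemma natr_mpoly_neq0 m c : (0 < c)%N -> c%:R != 0 :> {mpoly k[m]}.
Proof.
move=> c0; rewrite -(rmorph_nat (@mpolyC m k)) mpolyC_eq0.
by rewrite ((pcharf0P k).1 char0) -lt0n.
Qed.

Lemma var_free_neq0 x : x \in free -> var x != 0.
Proof.
move=> h; rewrite -(enum_rankK_in h h) var_enum; apply/eqP => E.
by have := msuppX k U_(enum_rank_in h x)%MM; rewrite E msupp0.
Qed.

Lemma wsum_map A B (f : {rmorphism A -> B}) (xi : index -> A) :
  f (wsum xi) = wsum (f \o xi) /\ f (wsumC xi) = wsumC (f \o xi).
Proof.
by split; rewrite rmorph_sum; apply: eq_bigr => x _; rewrite rmorphM;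
  have [h1 h2] := wcoord_map f xi x; rewrite ?h1 ?h2 /omega_coef rmorphB !rmorph_nat.
Qed.

Lemma sigma_var_neq0 : sigma var != 0.
Proof. exact: var_free_neq0 star_y_free. Qed.

Lemma beta_var_neq0 : beta var != 0.
Proof.
case o : (odd n); first by rewrite (beta_odd var_z) // oner_eq0.
exact: var_free_neq0 (u_free (negbT o)).
Qed.

Lemma wsum_var_neq0 : wsum var != 0 /\ wsumC var != 0.
Proof.
(* The two indices have coefficients d and - e, both nonzero, and at least one of them differs from
   [z_index]. *)
pose o1 : index := (ord0, inord 1); pose o2 : index := (inord 1, ord0).
have l1 : level o1 = 1%N by rewrite /level /lev /= inordK.
have l2 : level o2 = 1%N by rewrite /level /lev /= inordK.
have [x0 [nz lx nc]] : exists x0 : index,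
    [/\ x0 != z_index, level x0 = 1%N & omega_coef k x0.1 x0.2 != 0].
  have [E|ne] := eqVneq z_index o1.
    exists o2; split => //; last first.
      rewrite /omega_coef /= muln0 sub0r oppr_eq0 ((pcharf0P k).1 char0).
      by rewrite inordK // muln1 -lt0n.
    by rewrite E; apply/eqP => /(congr1 (fun x : index => x.1 : nat)); rewrite /= inordK.
  exists o1; split => //; first by rewrite eq_sym.
  rewrite /omega_coef /= muln0 subr0 ((pcharf0P k).1 char0).
  by rewrite inordK // muln1 -lt0n.
(* The points for t = 1 and t = 0 have sigma = 0 and differ only at [x0], so the difference of their
   sums is the coefficient at [x0]. *)
pose xi (t : k) x : k := if x == z_index then 1 else if x == x0 then t else 0.
have [uh1 uh2] := u_level_bounds.
have nstar x : (2 * level x < n)%N -> star x != z_index /\ star x != x0.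
  move=> h; split; apply: star_neq => //; last by rewrite lx; lia.
  by rewrite z_level /half_n; lia.
have xi_star t x : (2 * level x < n)%N -> xi t (star x) = 0.
  by move=> h; have [/negPf h1 /negPf h2] := nstar x h; rewrite /xi h1 h2.
have xi0 t : xi t corner = 0.
  have /andP[h _] := z_not_corner; rewrite /xi eq_sym (negPf h).
  by case: eqP => // E; move: lx; rewrite -E /level /lev.
have [c0 u2 y2] : [/\ (2 * level corner < n)%N, (2 * level u_index < n)%N & (2 * level y_index < n)%N].
  by rewrite u_indexL y_level; split => //; rewrite /level /lev /=; lia.
have spec t := @specialize_var _ (idfun : {rmorphism k -> k}) (xi t).
have xiz t : xi t z_index = 1 by rewrite /xi eqxx.
have Espec t : specialize idfun (xi t) \o var = xi t.
  by apply/funext; apply: spec => //; apply: xi_star.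
have sg t : sigma (xi t) = 0 by apply: xi_star.
have W t : wsum (xi t) = \sum_(x : index | level x == 1%N) omega_coef k x.1 x.2 * xi t x.
  by apply: eq_bigr => x _; rewrite /wcoord sg mul0r addr0.
have WC t : wsumC (xi t) = \sum_(x : index | level x == 1%N) omega_coef k x.1 x.2 * xi t x.
  by apply: eq_bigr => x _; rewrite /wcoordC sg mul0r subr0.
have D : \sum_(x : index | level x == 1%N) omega_coef k x.1 x.2 * xi 1 x -
    \sum_(x : index | level x == 1%N) omega_coef k x.1 x.2 * xi 0 x = omega_coef k x0.1 x0.2.
  rewrite -sumrB (bigD1 x0) ?lx //= big1 => [|x /andP[_ nx]].
    by rewrite /xi eqxx (negPf nz); ring.
  by rewrite /xi (negPf nx) subrr.
have S1 t : wsum (xi t) = specialize idfun (xi t) (wsum var).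
  by rewrite (wsum_map _ _).1 Espec.
have S2 t : wsumC (xi t) = specialize idfun (xi t) (wsumC var).
  by rewrite (wsum_map _ _).2 Espec.
split; apply: contraNneq nc => E; rewrite -D.
  by rewrite -(W 1) -(W 0) !S1 E !rmorph0 subrr.
by rewrite -(WC 1) -(WC 0) !S2 E !rmorph0 subrr.
Qed.

Lemma scale_factor_var_neq0 : scale_factor var != 0.
Proof.
have [h1 h2] := wsum_var_neq0.
rewrite (scale_factorE var_z) oppr_eq0.
apply: mulf_neq0; last exact: mulf_neq0.
by apply: mulf_neq0; [apply: natr_mpoly_neq0; apply: fact_gt0|apply: expf_neq0; apply: beta_var_neq0].
Qed.


Lemma q1_slice_var_neq0 : q1 (slice_point var) != 0.
Proof.
rewrite q1_slice_point mulf_neq0 ?expf_neq0 ?scale_factor_var_neq0 //.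
(* Test point with beta = sigma = 1: the entries at [u_index] and [y_index] become 1 and 1, their
   stars 1 and -1. Signs then cancel in the level sum at [n - u_level] and add up at [u_level]. *)
pose xi x : k := ((x == u_index) || (x == z_index) || (x == star y_index))%:R.
have [uh1 uh2] := u_level_bounds.
have [c0 u2 y2] : [/\ (2 * level corner < n)%N, (2 * level u_index < n)%N & (2 * level y_index < n)%N].
  by rewrite u_indexL y_level; split => //; rewrite /level /lev /=; lia.
have zl : (2 * level z_index <= n)%N by rewrite z_level /half_n; lia.
have [nzc nzsc] := andP z_not_corner.
have nyc : y_index != corner by rewrite -corner_level y_level -lt0n.
have xiE x : pos x -> xi x = ((x == u_index) || (x == z_index))%:R.
  move=> px; rewrite /xi; case: (x =P star y_index) => [E|_]; last by rewrite orbF.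
  by have /andP[] := star_level y2; rewrite -E px.
have xiz : xi z_index = 1 by rewrite xiE ?pos_z // eqxx orbT.
have xib : beta xi = 1 by rewrite /beta xiE ?pos_u // eqxx.
have xis : sigma xi = 1 by rewrite /sigma /xi eqxx orbT.
have xi_u : xi (star u_index) = 0.
  rewrite /xi [_ == z_index]eq_sym (negPf z_not_star_u) (inj_eq (inv_inj starK)) (negPf u_neq_y).
  by have /andP[_ /negPf ->] := star_level u2.
have xi_c : xi corner = 0.
  rewrite xiE ?pos_corner // ![corner == _]eq_sym (negPf nzc).
  by rewrite (negPf u_not_corner).
have xi_sc : xi (star corner) = 0.
  rewrite /xi (inj_eq (inv_inj starK)) [corner == _]eq_sym (negPf nyc).
  by rewrite (negPf (star_neq c0 _)) // ?u_indexL ?(negPf (star_neq c0 zl)) //; lia.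
have imagE x : pos x -> imag xi x = (x == y_index)%:R.
  move=> px; rewrite /imag; case: eqP => // /eqP ny; case: eqP => // /eqP ns.
  rewrite /xi (inj_eq (inv_inj starK)) (negPf ny) orbF; case: (star x =P u_index) => [E|_] /=.
    have /andP[h _] := star_level u2; move: h; rewrite -E starK px //.
  case: eqP => // E; case/eqP: ns; apply: pos_both => //; rewrite E; exact: pos_z.
(* For odd [n] the index [z_index] is [u_index] and must not be counted again; for even [n] it may
   coincide with its own star. *)
pose c1 : k := (~~ odd n)%:R; pose c2 : k := (~~ odd n && (star z_index != z_index))%:R.
pose D x a : k := (x == a)%:R.
have xiE' x : pos x -> xi x = D x u_index + c1 * D x z_index.
  move=> px; rewrite xiE // /D /c1 /z_index; case o : (odd n); first by rewrite mul0r addr0 orbb.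
  rewrite mul1r -natrD; congr (_%:R); case: (x =P u_index) => [->|] //=.
  case: eqP => // E; have := u_level_bounds; rewrite -u_indexL E.
  by have := z_level; rewrite /z_index o => ->; rewrite /half_n; have := odd_double_half n; rewrite o; lia.
have preE x : pcoord xi x = D x u_index + D x y_index + D x (star u_index) - D x (star y_index)
    + c1 * D x z_index + c2 * D x (star z_index).
  have off a : a != corner -> a != star corner -> pos a ->
      [/\ D corner a = 0, D corner (star a) = 0, D (star corner) a = 0 & D (star corner) (star a) = 0].
    move=> h1 h2 _; rewrite /D (inj_eq (inv_inj starK)) ![corner == _]eq_sym ![star corner == _]eq_sym.
    rewrite (negPf h1) (negPf h2); split => //.
    by case: eqP => // E; case/eqP: h2; rewrite -E starK.
  have [u1' u2' u3' u4'] := off _ u_not_corner (introN eqP (fun E => negP (star_neq c0 (ltnW u2)) (introT eqP (esym E)))) pos_u.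
  have [y1' y2' y3' y4'] := off _ nyc (introN eqP (fun E => negP (star_neq c0 (ltnW y2)) (introT eqP (esym E)))) pos_y.
  have [z1' z2' z3' z4'] := off _ nzc nzsc pos_z.
  have [->|nx0] := eqVneq x corner.
    by rewrite /pcoord eqxx u1' u2' y1' y2' z1' z2'; ring.
  have [->|nx1] := eqVneq x (star corner).
    by rewrite /pcoord eqxx orbT u3' u4' y3' y4' z3' z4'; ring.
  have Dstar a y : D (star a) y = D a (star y) by rewrite /D -(inj_eq (inv_inj starK)) starK.
  have Dneg a : (2 * level a < n)%N -> pos x -> D x (star a) = 0.
    move=> /star_level /andP[/negPf h _] px; rewrite /D; case: eqP => // E.
    by rewrite -E px in h.
  rewrite /pcoord (negPf nx0) (negPf nx1) /= xib !expr1n !mul1r.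
  have [px|npx] := boolP (pos x).
    rewrite /wcoord xis mul1r imagE // xiE' // (Dneg _ u2 px) (Dneg _ y2 px).
    suff -> : c2 * D x (star z_index) = 0 by rewrite /D; ring.
    rewrite /c2 /D; case: (x =P star z_index) => [E|_]; last by rewrite mulr0.
    by rewrite pos_both ?eqxx ?andbF ?mul0r // -?E ?pos_z.
  have ps : pos (star x) by have := pos_total x; rewrite (negPf npx).
  rewrite /wcoordC xis mul1r imagE // xiE' // -/(D _ _) !Dstar.
  have Dpos a : pos a -> D x a = 0.
    by move=> pa; rewrite /D; case: eqP => // E; rewrite E pa in npx.
  rewrite (Dpos _ pos_u) (Dpos _ pos_y) (Dpos _ pos_z).
  suff -> : c1 * D x (star z_index) = c2 * D x (star z_index) by rewrite /D; ring.
  rewrite /c1 /c2 /D; case: (x =P star z_index) => [E|_]; last by rewrite !mulr0.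
  suff -> : star z_index != z_index by rewrite andbT.
  by apply: contraNneq npx => E'; rewrite E E' pos_z.
have sumD (F : index -> k) l a : \sum_(x : index | level x == l) F x * D x a =
    if level a == l then F a else 0.
  rewrite big_mkcond (bigD1 a) //= big1 => [|x nx]; last by rewrite /D (negPf nx) mulr0 if_same.
  by rewrite /D eqxx mulr1 addr0.
have P l : level_sum (pre_point xi) l =
   (if level u_index == l then 1 else 0) + (if level y_index == l then 1 else 0)
   + (if level (star u_index) == l then 1 else 0) - (if level (star y_index) == l then 1 else 0)
   + c1 * (if level z_index == l then 1 else 0) + c2 * (if level (star z_index) == l then 1 else 0).
  rewrite level_sum_pair -!(sumD (fun=> 1)) !mulr_sumr -!sumrN -!big_split /=.
  by apply: eq_bigr => x _; rewrite -pcoordE preE; ring.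
pose w x := omega_coef k x.1 x.2.
have R l : omega_sum (pre_point xi) l =
   (if level u_index == l then w u_index else 0) + (if level y_index == l then w y_index else 0)
   + (if level (star u_index) == l then w (star u_index) else 0)
   - (if level (star y_index) == l then w (star y_index) else 0)
   + c1 * (if level z_index == l then w z_index else 0)
   + c2 * (if level (star z_index) == l then w (star z_index) else 0).
  rewrite omega_sum_pair -!(sumD w) !mulr_sumr -!sumrN -!big_split /=.
  by apply: eq_bigr => x _; rewrite -pcoordE preE /w; ring.
have yE : w (star y_index) = - w y_index by apply: omega_coef_star.
have uE : w (star u_index) = - w u_index by apply: omega_coef_star.
have zE : w (star z_index) = - w z_index by apply: omega_coef_star.
have ul := u_indexL; have yl := y_level; have zlE := z_level; have [hu1 hu2] := u_indexE.
have usl : level (star u_index) = (n - u_level)%N by rewrite level_star ul.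
have ysl : level (star y_index) = (n - u_level)%N by rewrite level_star yl.
have zsl : level (star z_index) = (n - half_n)%N by rewrite level_star zlE.
have wyu : w y_index - w u_index = n%:R.
  rewrite /w /omega_coef hu1 hu2 !mulnS !natrD.
  have arith (p q r s : k) : p + r - s - (r - (q + s)) = p + q by ring.
  exact: arith.
have cancel_z : ~~ odd n -> c1 * w z_index + c2 * w (star z_index) = 0.
  move=> o; rewrite /c1 /c2 o /=; case: (star z_index =P z_index) => [E|_]; last by rewrite zE mulrN subrr.
  have : w z_index *+ 2 = 0 by rewrite mulr2n -{2}E zE subrr.
  by move/eqP; rewrite -[_ *+ 2]mulr_natr mulf_eq0 ((pcharf0P k).1 char0) orbF => /eqP ->; rewrite mulr0 mul0r addr0.
(* Only the term at [u_level] survives: its level sum is 2, and the opposite [omega_sum] is the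
   difference [n] of the coefficients at the adjacent indices [y_index] and [u_index]. The middle
   level drops out because [omega_coef] is odd under [star]. *)
have Q : qsum (pre_point xi) id = (-1) ^+ u_level * (u_level`! * (n - u_level)`!)%:R * 2 * n%:R.
  have hu : (u_level < n.+1)%N by lia.
  have PR l : l <> u_level -> level_sum (pre_point xi) l * omega_sum (pre_point xi) (n - l) = 0.
    move=> nl; rewrite P R ul yl usl ysl zlE zsl.
    have /negPf -> : u_level != l by rewrite eq_sym; apply/eqP.
    set s := if (n - u_level == l)%N then _ else _.
    case: (boolP (odd n)) => [o1|o2]; first by rewrite /c1 /c2 o1 /=; ring.
    have hm : (n - half_n)%N = half_n.
      by have := odd_double_half n; rewrite (negPf o2) /half_n; clear; lia.
    rewrite hm; have [El|/negPf nlm] := eqVneq half_n l; last by ring.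
    rewrite -El hm eqxx.
    have /negPf -> : u_level != half_n by rewrite /u_level (negPf o2); lia.
    have /negPf -> : (n - u_level)%N != half_n by move: hm uh2; rewrite /u_level (negPf o2); clear; lia.
    by rewrite !add0r oppr0 add0r cancel_z // mulr0.
  rewrite /qsum (bigD1 (Ordinal hu)) //= big1 ?addr0 => [|l nl]; last first.
    rewrite -mulrA PR ?mulr0 //; move=> E; case/eqP: nl; exact: val_inj.
  have n1 : ((n - u_level)%N == u_level) = false by apply/eqP; move: uh2; clear; lia.
  have cz (F : nat -> bool) (p q : k) : (~~ odd n -> F half_n = false) ->
      c1 * (if F half_n then p else 0) + c2 * (if F (n - half_n)%N then q else 0) = 0.
    rewrite /c1 /c2; have [o|o] := boolP (odd n); first by rewrite !mul0r addr0.
    have -> : (n - half_n)%N = half_n.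
      by have := odd_double_half n; rewrite (negPf o) /half_n; clear; lia.
    by move=> -> //; rewrite !mulr0 addr0.
  have n2 : ~~ odd n -> (half_n == u_level) = false.
    by move=> o; apply/eqP; rewrite /u_level (negPf o) /half_n; move: n_gt2; clear; lia.
  have n3 : ~~ odd n -> (half_n == n - u_level)%N = false.
    move=> o; have h := odd_double_half n; rewrite (negPf o) in h.
    by apply/eqP; rewrite /u_level (negPf o) /half_n; move: n_gt2 h; clear; lia.
  rewrite P R ul yl usl ysl zlE zsl !eqxx n1 [u_level == _]eq_sym n1.
  rewrite -addrA (cz (fun l => l == u_level)) // -[X in _ * X]addrA (cz (fun l => l == n - u_level)%N) //.
  rewrite uE yE opprK -wyu; move: (w y_index) (w u_index) ((_ * _)%:R : k) ((-1) ^+ _ : k) => p q r s.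
  ring.
have [E|nq] := eqVneq (q1 (pre_point var)) 0; last by [].
have : specialize (idfun : {rmorphism k -> k}) xi (q1 (pre_point var)) = 0 by rewrite E rmorph0.
rewrite q1_map pre_point_map.
have -> : specialize (idfun : {rmorphism k -> k}) xi \o var = xi.
  by apply/funext; apply: specialize_var.
rewrite /q1 Q => /eqP; rewrite !mulf_eq0 oppr_eq0 signr_eq0 !((pcharf0P k).1 char0) /=.
have := fact_gt0 u_level; have := fact_gt0 (n - u_level); move: n_gt2; clear; nia.
Qed.

(** * Lifting the slice coordinates to invariants *)

Definition lift_even x : coord := (generic_lift k x.1 x.2 (star u_index).1 (star u_index).2
  (twist (level x)) (lift_deg (level x))).1.
Definition lift_odd x : coord := (generic_lift k x.1 x.2 (star u_index).1 (star u_index).2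
  (twist (level x)) (lift_deg (level x))).2.

Lemma disc_slice_point A (xi : index -> A) : q1 (slice_point xi) ^+ 2 = disc (slice_point xi).
Proof. by rewrite /disc slice_point_q0 mulr0 mul0r subr0. Qed.

Lemma slice_eval_lift x : pos x -> x != corner ->
  slice_eval (lift_even x) = lift_scale var (level x) * var x /\
  slice_eval (lift_odd x) * q1 (slice_point var) =
    lift_scale var (level x) * (sigma var * imag var x).
Proof.
move=> px nx; have hs := disc_slice_point var.
have hs' : (- q1 (slice_point var)) ^+ 2 = disc (slice_point var) by rewrite sqrrN.
have := generic_lift_eval x.1 x.2 (star u_index).1 (star u_index).2 (twist (level x))
  (lift_deg (level x)) (@mpolyC n_free k) hs.
rewrite -/(lift_even x) -/(lift_odd x) -!/(slice_eval _) (lift_slice var_z var_star_u) //.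
have := generic_lift_eval x.1 x.2 (star u_index).1 (star u_index).2 (twist (level x))
  (lift_deg (level x)) (@mpolyC n_free k) hs'.
rewrite -/(lift_even x) -/(lift_odd x) -!/(slice_eval _) (lift_slice_conj var_z var_star_u) //.
rewrite /wcoord /wcoordC.
move: (slice_eval _) (slice_eval _) (q1 _) (lift_scale _ _) (var x) (sigma var * _).
move=> h1 h0 q L w s E1 E2; have two : 2 != 0 :> {mpoly k[n_free]} by apply: natr_mpoly_neq0.
split; apply: (mulfI two).
  transitivity (h0 + h1 * q + (h0 + h1 * - q)); first by ring.
  by rewrite E1 E2; ring.
transitivity (h0 + h1 * q - (h0 + h1 * - q)); first by ring.
by rewrite E1 E2; ring.
Qed.

(** Up to constants, the degree of a lift and the power of q1 and the scale factor in its
    restriction are all proportional to [(twist l).+1]. Dividing by the value on the middle level (2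
    for odd [n], 1 for even [n]) gives the exponent of [base]. *)
Definition weight l : nat := ((twist l).+1 %/ (twist half_n).+1)%N.
Definition base : {mpoly k[n_free]} := lift_scale var half_n.
Definition base_deg : nat := ((3 * n).+1 * (twist half_n).+1)%N.

Lemma weightE l : (2 * l <= n)%N -> ((twist l).+1 = weight l * (twist half_n).+1)%N.
Proof.
move=> hl; rewrite /weight divnK //; have := odd_double_half n; rewrite /twist /half_n.
case o : (odd n) => h; last by rewrite subnn dvd1n.
have -> : (n - 2 * n./2 = 1)%N by move: h; clear; lia.
rewrite dvdn2 /= negbK oddB // o oddM //.
Qed.

Lemma weight_half : weight half_n = 1%N.
Proof. by rewrite /weight divnn. Qed.

Lemma lift_deg_weight l : (2 * l <= n)%N -> (lift_deg l = weight l * lift_deg half_n)%N.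
Proof.
move=> hl; have h2 : (2 * half_n <= n)%N by rewrite /half_n; lia.
have := lift_degE hl; have := lift_degE h2; rewrite (weightE hl).
move: (lift_deg l) (lift_deg half_n) (weight l) ((twist half_n).+1) => p q r s h h'.
by apply/eqP; rewrite -(eqn_pmul2l (isT : (0 < 2)%N)) -h' mulnCA h mulnCA.
Qed.

Lemma lift_scale_base l : (2 * l <= n)%N ->
  exists2 c : k, c != 0 & lift_scale var l = c%:MP * base ^+ weight l.
Proof.
move=> hl; pose C m : k := (4 ^ lift_deg m * (lift_deg m)`! ^ 2)%:R.
have nC m : C m != 0.
  by rewrite ((pcharf0P k).1 char0) -lt0n muln_gt0 !expn_gt0 fact_gt0.
exists (C l / C half_n ^+ weight l); first by rewrite mulf_neq0 ?invr_neq0 ?expf_neq0.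
rewrite /base /lift_scale (weightE hl) {3}(lift_deg_weight hl).
have E m : (4 ^ lift_deg m * (lift_deg m)`! ^ 2)%:R = (C m)%:MP :> {mpoly k[n_free]}.
  by rewrite rmorph_nat.
have [w ew] : exists w, w = weight l by eexists.
have EC : (C l)%:MP = (C l / C half_n ^+ w)%:MP * (C half_n)%:MP ^+ w :> {mpoly k[n_free]}.
  by rewrite -(rmorphXn (@mpolyC n_free k)) -mpolyCM divfK // expf_neq0.
rewrite !E EC -ew; move: (_ / _)%:MP (C half_n)%:MP (q1 _) (scale_factor var * _) => c C' q s.
have -> : (3 * (w * lift_deg half_n) = 3 * lift_deg half_n * w)%N by clear; lia.
by rewrite [(w * (twist _).+1)%N]mulnC !exprM !exprMn; ring.
Qed.

Lemma slice_evalM F G : slice_eval (F * G) = slice_eval F * slice_eval G.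
Proof. exact: rmorphM. Qed.

(* F is a lift of p to an invariant, up to a constant and a power of base;
   both the degree of F and the power of base are proportional to w. *)
Definition lifts w (p : {mpoly k[n_free]}) : Prop :=
  exists F (c : k), [/\ invariant_forms (w * base_deg) F, c != 0
    & slice_eval F = c%:MP * (base ^+ w * p)].

Lemma liftsM w w' p p' : lifts w p -> lifts w' p' -> lifts (w + w') (p * p').
Proof.
move=> [F [c [hF nc eF]]] [F' [c' [hF' nc' eF']]]; exists (F * F'), (c * c'); split.
- by rewrite mulnDl; apply: invariant_formsM.
- exact: mulf_neq0.
- by rewrite slice_evalM eF eF' mpolyCM exprD; ring.
Qed.

Lemma lifts1 : lifts 0 1.
Proof.
exists 1, 1; split; first exact: invariant_forms1; first exact: oner_neq0.
by rewrite rmorph1 expr0 mulr1 mul1r.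
Qed.

Lemma liftsX m w p : lifts w p -> lifts (m * w) (p ^+ m).
Proof.
move=> h; elim: m => [|m IH]; first by rewrite mul0n expr0; apply: lifts1.
by rewrite mulSn exprS; apply: liftsM.
Qed.

Lemma lift_invariant x : pos x ->
  invariant_forms (weight (level x) * base_deg) (lift_even x) /\
  invariant_forms (weight (level x) * base_deg - 2) (lift_odd x).
Proof.
move=> px; have pl := pos_level px.
rewrite /base_deg mulnCA -(weightE pl); apply: generic_lift_invariant => //; first lia.
exact: lift_degE.
Qed.

Lemma base_deg_ge2 : (2 <= base_deg)%N.
Proof. by rewrite /base_deg; move: n_gt2; nia. Qed.

Lemma weight_gt0 x : pos x -> (0 < weight (level x))%N.
Proof. by move=> /pos_level /weightE; case: (weight _). Qed.

Lemma lifts_var x : pos x -> x != corner -> lifts (weight (level x)) (var x).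
Proof.
move=> px nx; have [c nc Ec] := lift_scale_base (pos_level px).
exists (lift_even x), c; split=> //; first by case: (lift_invariant px).
by rewrite (slice_eval_lift px nx).1 Ec mulrA.
Qed.

Lemma y_not_corner : y_index != corner.
Proof. by rewrite -corner_level y_level -lt0n; have [] := u_level_bounds. Qed.

(** [lift_odd x] restricts to a multiple of sigma times [imag var x], divided by q1. Multiplying by
    [lift_odd y_index], whose imaginary part is sigma itself, and by the discriminant q1^2 clears q1
    and makes the result even in sigma. *)
Lemma lifts_imag x : pos x -> x != corner ->
  lifts (weight (level x) + weight u_level) (sigma var ^+ 2 * imag var x).
Proof.
move=> px nx; have [c nc Ec] := lift_scale_base (pos_level px).
have := lift_scale_base (pos_level pos_y); rewrite y_level => -[c' nc' Ec'].
exists (disc v * (lift_odd x * lift_odd y_index)), (c * c'); split.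
- have [_ h1] := lift_invariant px; have [_ h2] := lift_invariant pos_y; rewrite y_level in h2.
  have := weight_gt0 px; have := weight_gt0 pos_y; rewrite y_level => g1 g2.
  have -> : ((weight (level x) + weight u_level) * base_deg =
     4 + ((weight (level x) * base_deg - 2) + (weight u_level * base_deg - 2)))%N.
    by move: base_deg_ge2 g1 g2; clear; nia.
  by do 2?[apply: invariant_formsM => //]; apply: invariant_disc.
- exact: mulf_neq0.
- have h1 := (slice_eval_lift px nx).2; have h2 := (slice_eval_lift pos_y y_not_corner).2.
  rewrite [imag var y_index]/imag eqxx y_level in h2.
  have h0 : slice_eval (disc v) = q1 (slice_point var) ^+ 2 by rewrite disc_slice_point; apply: coord_eval_disc.
  rewrite !slice_evalM h0.
  transitivity (slice_eval (lift_odd x) * q1 (slice_point var) *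
    (slice_eval (lift_odd y_index) * q1 (slice_point var))); first by ring.
  by rewrite h1 h2 Ec Ec' mpolyCM exprD; ring.
Qed.

Lemma lifts_sigma : lifts (2 * weight u_level) (sigma var ^+ 2).
Proof.
have := lifts_imag pos_y y_not_corner.
by rewrite y_level /imag eqxx mulr1 addnn mul2n.
Qed.

(** The coordinate at [z_index] is 1, so its lift is [base] alone; its powers serve to adjust
    degrees. *)
Lemma lifts_base : lifts 1 1.
Proof.
have := lifts_var pos_z (andP z_not_corner).1.
by rewrite z_level weight_half var_z.
Qed.

(** The weight of the fourth power of the product of the lifts of 1 and of sigma^2. The factor 4
    makes every degree in the chart a multiple of 4, as [slice_eval_flip] needs. *)
Definition denom_weight : nat := (4 * (2 * weight u_level).+1)%N.

Lemma lifts_denom : lifts denom_weight (sigma var ^+ 2 ^+ 4).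
Proof.
have := liftsX 4 (liftsM lifts_base lifts_sigma).
by rewrite add1n mul1r.
Qed.

Lemma base_neq0 : base != 0.
Proof.
apply: mulf_neq0; first by apply: natr_mpoly_neq0; rewrite muln_gt0 !expn_gt0 fact_gt0.
apply: mulf_neq0; apply: expf_neq0; first exact: q1_slice_var_neq0.
apply: mulf_neq0; first exact: scale_factor_var_neq0.
by apply: expf_neq0; apply: beta_var_neq0.
Qed.

Definition sigma_index : 'I_n_free := enum_rank_in star_y_free (star y_index).

Lemma sigma_indexE : enum_val sigma_index = star y_index.
Proof. exact: enum_rankK_in star_y_free. Qed.

Lemma sigma_var : sigma var = 'X_sigma_index.
Proof. by rewrite -var_enum sigma_indexE. Qed.

Lemma square_sigmaX i : square_var sigma_index 'X_i =
  if enum_val i == star y_index then sigma var ^+ 2 else var (enum_val i).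
Proof.
rewrite /square_var mmapX mmap1U -sigma_indexE (inj_eq enum_val_inj) sigma_var var_enum.
by case: eqP => // ->.
Qed.

Lemma lifts_coord i : exists r, lifts (denom_weight * r) (square_var sigma_index 'X_i * (sigma var ^+ 2 ^+ 4) ^+ r).
Proof.
have [h1 h2] := u_level_bounds; rewrite square_sigmaX; have := enum_valP i.
set x := enum_val i; rewrite inE => /and4P[nc nsc nu nz].
have L w1 w2 p1 p2 : lifts w1 p1 -> w1 = w2 -> p1 = p2 -> lifts w2 p2 by move=> h <- <-.
case: eqP => [_|/eqP ny].
  exists (weight u_level).
  apply: L (liftsM lifts_sigma (liftsM (liftsX (2 * weight u_level) lifts_base)
    (liftsX (4 * weight u_level) lifts_sigma))) _ _; first by rewrite /denom_weight; nia.
  by rewrite expr1n mul1r (exprM _ 4).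
have [px|npx] := boolP (pos x).
  exists (weight (level x)).
  apply: L (liftsM (lifts_var px nc) (liftsM (liftsX (3 * weight (level x)) lifts_base)
    (liftsX (4 * weight (level x)) lifts_sigma))) _ _; first by rewrite /denom_weight; nia.
  by rewrite expr1n mul1r (exprM _ 4).
(* Here the coordinate is an imaginary part, which [lifts_imag] lifts together with a factor
   sigma^2; the padding therefore has one sigma^2 less. *)
have ps : pos (star x) by have := pos_total x; rewrite (negPf npx).
have ns : star x != corner by rewrite -(inj_eq (inv_inj starK)) starK.
have := weight_gt0 ps; have := lifts_imag ps ns; set w := weight (level (star x)) => hi gw.
exists w.
apply: L (liftsM hi (liftsM (liftsX (3 * w + weight u_level) lifts_base)
  (liftsX (4 * w - 1) lifts_sigma))) _ _.
  by rewrite /denom_weight; move: gw; clear; nia.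
rewrite expr1n mul1r /imag starK -(inj_eq (inv_inj starK)) starK (negPf ny).
have -> : (x == star x) = false by apply/eqP => E; rewrite -E (negPf npx) in ps.
have -> : ((sigma var ^+ 2 ^+ 4) ^+ w = sigma var ^+ 2 * (sigma var ^+ 2) ^+ (4 * w - 1)).
  by rewrite -exprS subn1 prednK ?muln_gt0 // (exprM _ 4).
by rewrite [sigma var ^+ 2 * var _]mulrC -mulrA.
Qed.

Lemma denom_degE : exists q, (denom_weight * base_deg = 4 * q)%N.
Proof. by rewrite /denom_weight -mulnA; eexists. Qed.

Let var' x : {mpoly k[n_free]} := if x == star y_index then - var x else var x.

Lemma var_corner : var corner = 0.
Proof.
rewrite var_not_free ?inE ?eqxx // eq_sym.
by have /andP[/negPf -> _] := z_not_corner.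
Qed.

Lemma var_star_corner : var (star corner) = 0.
Proof.
rewrite var_not_free ?inE ?eqxx ?andbF // eq_sym.
by have /andP[_ /negPf ->] := z_not_corner.
Qed.

(** The slice points for sigma and - sigma are exchanged by a matrix of determinant [- beta], up to
    scaling. In degree 4D the sign disappears, and determinant and scaling contribute the same power
    of [beta]. *)
Lemma slice_eval_flip F D : invariant_forms (4 * D) F ->
  flip_var sigma_index (slice_eval F) = slice_eval F.
Proof.
move=> hF; have var'E x : x != star y_index -> var' x = var x by move=> /negPf h; rewrite /var' h.
have := star_y_free; rewrite inE => /and4P[y1 y2 y3 y4].
have vz : var' z_index = 1 by rewrite var'E ?var_z // eq_sym.
have vu : var' (star u_index) = 0 by rewrite var'E ?var_star_u // eq_sym.
have v0 : var' corner = 0 by rewrite var'E ?var_corner // eq_sym.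
have v1 : var' (star corner) = 0 by rewrite var'E ?var_star_corner // eq_sym.
have -> : flip_var sigma_index (slice_eval F) =
    coord_eval (@mpolyC n_free k) (slice_point var') F.
  rewrite (slice_eval_specialize (@mpolyC n_free k)) //.
  rewrite /flip_var /specialize; congr (mmap _ _ _); apply/funext => i.
  by rewrite /var' -sigma_indexE (inj_eq enum_val_inj) var_enum.
have tf m (x : {mpoly k[n_free]}) : x *+ m.+1 = 0 -> x = 0.
  exact: (torsion_free_via char0 (@mpolyC n_free k)).
have v'y : var' (star y_index) = - var (star y_index) by rewrite /var' eqxx.
have := act_slice_point var_z v'y var'E tf scale_factor_var_neq0.
have det_a : \det (anti2 1 (beta var)) = - beta var by rewrite det2E !mxE /=; ring.
have ndet : \det (anti2 1 (beta var)) != 0 by rewrite det_a oppr_eq0 beta_var_neq0.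
have hD : (n * (4 * D) = 2 * (2 * (n * D)))%N by clear; lia.
have := coord_eval_GL2_domain (@mpolyC n_free k) (slice_point var) hF hD ndet.
move=> E1 E2; rewrite E2 (coord_eval_scale _ _ _ hF.1) det_a in E1.
move: E1; rewrite -exprM [(- _) ^+ _]exprM sqrrN -exprM.
have -> : beta var ^+ ((n - half_n) * (4 * D)) = beta var ^+ (2 * (n * D)).
  apply: (beta_pow var_z) => o; rewrite /half_n; have := odd_double_half n; rewrite (negPf o) add0n.
  have [h eh] : exists h, h = n./2 by eexists.
  rewrite -eh => <-; rewrite -addnn addnK; clear; nia.
by move/(mulfI (expf_neq0 _ beta_var_neq0)).
Qed.

Lemma slice_eval_square F j : invariant_forms (denom_weight * base_deg * j) F ->
  exists P, slice_eval F = square_var sigma_index P.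
Proof.
have [q ->] := denom_degE; rewrite -mulnA => hF.
apply: flip_var_fixed; last exact: slice_eval_flip hF.
by rewrite ((pcharf0P k).1 char0).
Qed.

Lemma lifts_coord_denom b c i : c != 0 ->
  slice_eval b = c%:MP * (base ^+ denom_weight * sigma var ^+ 2 ^+ 4) ->
  exists r F, invariant_forms (denom_weight * base_deg * r) F /\
    slice_eval F = square_var sigma_index 'X_i * slice_eval b ^+ r.
Proof.
move=> nc Eb; have [r [F [c' [hF nc' EF]]]] := lifts_coord i.
exists r, (c ^+ r / c' *: F); split.
  rewrite mulnAC -[_ *: F]addr0; apply: invariant_forms_lin; first by [].
  exact: invariant_forms0.
rewrite -mul_mpolyC slice_evalM EF Eb /slice_eval coord_evalC mulrA -mpolyCM divfK //.
rewrite (exprMn _ c%:MP) -(rmorphXn (@mpolyC n_free k)) (exprMn _ (base ^+ _)) -(exprM base).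
by rewrite (mulrCA (base ^+ _)) [LHS]mulrCA.
Qed.


(** * Equivalence with a point of the slice *)

Section TorusNormalForm.

Variables (A : comNzRingType) (conj : {rmorphism A -> A}) (y : form A).
Hypothesis conjK : involutive conj.
Hypothesis torsion_free : forall m (x : A), x *+ m.+1 = 0 -> x = 0.
Hypothesis natr_inv : forall m, invertible (m.+1%:R : A).
Hypothesis conj_y : forall x, conj (y x.1 x.2) = y (star x).1 (star x).2.
Hypothesis y_q0 : q0 y = 0.
Hypothesis y_q2 : q2 y = 0.

Let Y x := y x.1 x.2.
Hypothesis inv_u : invertible (Y u_index).
Hypothesis inv_z : ~~ odd n -> invertible (Y z_index + conj (Y z_index)).
Hypothesis inv_y : invertible (conj (Y u_index) * Y y_index - Y u_index * conj (Y y_index)).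
Hypothesis inv_omega : invertible (omega_sum y 1).

Let torus_coord c p q x : A := c * (p ^+ (n - level x) * q ^+ level x * Y x).

(* For even n the torus takes the entry at star u_index to 1 and the real part
   of the entry at z_index to 1; for odd n, the entries at u_index and
   star u_index to 1. *)
Lemma torus_parameters : exists c p q, [/\ invertible c, invertible p, invertible q &
  let t := torus_coord c p q in let b := t u_index in
  [/\ forall x, pos x -> conj (t x) = b ^+ (half_n - level x) * t (star x),
      t z_index + conj (t z_index) = 2, conj b = b, invertible b
    & invertible (t y_index - conj (t y_index))]].
Proof.
have [hu1 hu2] := u_level_bounds.
have inv_cu : invertible (conj (Y u_index)) by apply: invertible_map.
have [ui hui] := inv_u; have hcui : conj (Y u_index) * conj ui = 1 by rewrite -rmorphM hui rmorph1.
have cY x : conj (Y x) = Y (star x) by apply: conj_y.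
move: hui hcui inv_cu; set u := Y u_index; set cu := conj u; set cui := conj ui => hui hcui inv_cu.
have ccu : conj cu = u by rewrite /cu conjK.
have [o|o] := boolP (odd n).
  have nE : (n = half_n + half_n.+1)%N.
    by have := odd_double_half n; rewrite o /half_n; clear; lia.
  have uE : u_level = half_n by rewrite /u_level o.
  (* The torus parameters [cu] and [u] are conjugate, so conjugation carries the scaled entry at x
     to that at [star x]; [c] makes the entry at [u_index] equal to 1. *)
  pose c := (ui * cui) ^+ half_n.+1.
  have cc : conj c = c by rewrite /c rmorphXn rmorphM /cui conjK mulrC.
  have tE x : conj (torus_coord c cu u x) = torus_coord c cu u (star x).
    rewrite /torus_coord (rmorphM conj c) cc 2!(rmorphM conj) !rmorphXn ccu cY level_star.
    by rewrite subKn ?level_le // [u ^+ _ * _]mulrC.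
  have tu : torus_coord c cu u u_index = 1.
    rewrite /torus_coord u_indexL uE -/u -mulrA -exprSr.
    have -> : (n - half_n = half_n.+1)%N by move: nE; clear; lia.
    rewrite /c -!exprMn -[RHS](expr1n _ half_n.+1); congr (_ ^+ _).
    by transitivity ((u * ui) * (cu * cui)); [ring|rewrite hui hcui mulr1].
  have inv_c : invertible c.
    by apply: invertibleX; apply: invertibleM; [exists u|exists cu]; rewrite mulrC.
  exists c, cu, u; split => //=; split.
  - by move=> x px; rewrite tE tu expr1n mul1r.
  - by rewrite /z_index o tE -tE tu rmorph1.
  - by rewrite tu rmorph1.
  - by rewrite tu; apply: invertible1.
  rewrite tE; have -> : torus_coord c cu u y_index - torus_coord c cu u (star y_index) =
      c * (u * cu) ^+ half_n * (cu * Y y_index - u * conj (Y y_index)).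
    rewrite /torus_coord level_star y_level uE.
    have -> : (n - half_n = half_n.+1)%N by move: nE; clear; lia.
    have -> : (n - half_n.+1 = half_n)%N by move: nE; clear; lia.
    by rewrite cY !exprS exprMn; ring.
  by do 2?[apply: invertibleM => //]; apply: invertibleX; apply: invertibleM.
have nE : (n = half_n + half_n)%N.
  by have := odd_double_half n; rewrite (negPf o) /half_n; clear; lia.
have uE : (half_n = u_level.+1)%N by rewrite /u_level (negPf o) prednK // /half_n; move: n_gt2; clear; lia.
have zL := z_level.
have [hf hhf] : invertible (2 : A) by apply: natr_inv.
pose w := hf * (Y z_index + conj (Y z_index)).
have cw : conj w = w.
  have chf : conj hf = hf.
    have : 2 * (conj hf - hf) = 0.
      by rewrite mulrBr hhf -[2](rmorph_nat conj) -rmorphM hhf rmorph1 subrr.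
    by move/(invertible_reg (natr_inv 1))/eqP; rewrite subr_eq0 => /eqP.
  by rewrite /w rmorphM rmorphD conjK chf [Y _ + _]addrC.
have inv_w : invertible w by apply: invertibleM; [exists 2; rewrite mulrC|apply: inv_z].
have [wi hwi] := inv_w.
have cwi : conj wi = wi.
  have : w * (conj wi - wi) = 0 by rewrite mulrBr hwi -{1}cw -rmorphM hwi rmorph1 subrr.
  by move/(invertible_reg inv_w)/eqP; rewrite subr_eq0 => /eqP.
(* The entry at x becomes [Y x] times cu^(half_n - level x) w^(level x - half_n - 1). At
   [star u_index] this is 1, and at [z_index] it is [Y z_index] divided by its real part w. *)
pose c := cui ^+ half_n * wi ^+ half_n.+1.
have inv_wi : invertible wi by exists w; rewrite mulrC.
have inv_c : invertible c.
  by apply: invertibleM; apply: invertibleX => //; exists cu; rewrite mulrC.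
have t_low x r : (level x + r = half_n)%N -> torus_coord c cu w x = cu ^+ r * wi ^+ r.+1 * Y x.
  move=> hr; rewrite /torus_coord /c.
  have -> : (n - level x = r + half_n)%N by move: nE hr; clear; lia.
  have -> : (half_n.+1 = r.+1 + level x)%N by move: hr; clear; lia.
  transitivity ((cu ^+ (r + half_n) * cui ^+ half_n) * (wi ^+ (r.+1 + level x) * w ^+ level x) * Y x).
    by ring.
  by rewrite expr_cancel // expr_cancel // mulrC.
have t_high x r : (level x = half_n + r)%N -> (r <= half_n)%N ->
    cu ^+ r * torus_coord c cu w x = w ^+ r * wi * Y x.
  move=> hr hrm; rewrite /torus_coord /c.
  have -> : (n - level x = half_n - r)%N by move: nE hr hrm; clear; lia.
  have -> : (level x = r + half_n)%N by rewrite hr addnC.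
  transitivity ((cu ^+ (half_n - r + r) * cui ^+ half_n) * (w ^+ (r + half_n) * wi ^+ half_n) * wi * Y x).
    by rewrite (exprD cu) (exprS wi); ring.
  by rewrite expr_cancel // subnK // -(exprMn _ cu) hcui expr1n mul1r.
have tu : torus_coord c cu w u_index = cu * wi ^+ 2 * u.
  by rewrite (t_low _ 1%N) ?expr1 // u_indexL uE addn1.
have tz : torus_coord c cu w z_index = wi * Y z_index.
  by rewrite (t_low _ 0%N) ?expr0 ?expr1 ?mul1r // zL addn0.
exists c, cu, w; split => //=; rewrite tu; split.
- move=> x px; have lx : (level x <= half_n)%N by have := pos_level px; move: nE; clear; lia.
  rewrite (t_low x (half_n - level x)%N) ?subnKC //.
  have [r er] : exists r, r = (half_n - level x)%N by eexists.
  have := t_high (star x) r; rewrite level_star er => /(_ _ (leq_subr _ _)) h.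
  rewrite -er !rmorphM !rmorphXn ccu cwi cY.
  transitivity (u ^+ r * (wi ^+ r) ^+ 2 * (cu ^+ r * torus_coord c cu w (star x))).
    rewrite er h; last by move: nE lx; clear; lia.
    rewrite exprS; move: hwi; move: (half_n - level x)%N => s hwi.
    transitivity ((w * wi) ^+ s * (u ^+ s * (wi ^+ s) * wi * Y (star x))).
      by rewrite hwi expr1n mul1r; ring.
    by rewrite exprMn; ring.
  by rewrite !exprMn; ring.
- rewrite tz rmorphM cwi -mulrDr.
  have -> : Y z_index + conj (Y z_index) = 2 * w by rewrite /w mulrA hhf mul1r.
  by rewrite mulrCA [wi * w]mulrC hwi mulr1.
- by rewrite !rmorphM ccu cwi -/cu; ring.
- by do 2?[apply: invertibleM => //]; apply: invertibleX.
rewrite (t_low y_index 1%N); last by rewrite y_level uE addn1.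
rewrite !rmorphM ccu cwi !expr1.
have -> : cu * wi ^+ 2 * Y y_index - u * wi ^+ 2 * conj (Y y_index) =
   wi ^+ 2 * (cu * Y y_index - u * conj (Y y_index)) by ring.
by apply: invertibleM => //; apply: invertibleX.
Qed.

(** The real and imaginary parts of the scaled entries are taken as slice coordinates. Off the
    corners the slice point then agrees with the scaled form up to a unit, and [corners_unique]
    settles the corners. *)
Lemma torus_normal_form : exists (xi : index -> A) c p q,
  [/\ invertible c, invertible p, invertible q & slice_point xi = c *: act (diag2 p q) y] /\
  [/\ xi z_index = 1, xi (star u_index) = 0, xi corner = 0 & xi (star corner) = 0].
Proof.
have [_ hu2] := u_level_bounds.
have u2 : (2 * level u_index < n)%N by rewrite u_indexL.
have y2 : (2 * level y_index < n)%N by rewrite y_level.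
have [c [p [q [inv_c inv_p inv_q]]]] := torus_parameters.
set t := torus_coord c p q; set b := t u_index => /= -[t_star t_z conj_b inv_b inv_s].
have [hf hhf] : invertible (2 : A) by apply: natr_inv.
have [si hs] := inv_s.
pose off x := (x == corner) || (x == star corner).
(* At [star y_index] stands sigma itself; the other imaginary parts are measured in units of sigma,
   through the inverse [si] of 2 sigma. *)
pose xi x : A := if off x then 0
  else if x == star y_index then hf * (t y_index - conj (t y_index))
  else if pos x then hf * (t x + conj (t x))
  else si * (t (star x) - conj (t (star x))).
have off_star x : off (star x) = off x.
  by rewrite /off (inj_eq (inv_inj starK)) -[star x == corner](inj_eq (inv_inj starK)) starK orbC.
have star_off x : pos x -> x != corner -> off x = false.
  by move=> px nx; rewrite /off (negPf nx); have /andP[/negPf -> _] := off_corners px nx.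
have np_y : ~~ pos (star y_index) by have /andP[] := star_level y2.
have xi_pos x : pos x -> x != corner -> xi x = hf * (t x + conj (t x)).
  move=> px nx; rewrite /xi star_off // px; case: eqP => // E.
  by rewrite -E px in np_y.
have y_off : off y_index = false by apply: star_off pos_y y_not_corner.
have xi_sigma : sigma xi = hf * (t y_index - conj (t y_index)).
  by rewrite /sigma /xi off_star y_off eqxx.
have hb : beta xi = b.
  by rewrite /beta xi_pos ?pos_u ?u_not_corner // -/b conj_b mulrDr -mulr2n -mulr_natl mulrA hhf mul1r.
have xi_z : xi z_index = 1.
  have /andP[nz _] := z_not_corner.
  by rewrite xi_pos ?pos_z // t_z mulrC hhf.
have xi_u : xi (star u_index) = 0.
  rewrite /xi off_star (star_off _ pos_u u_not_corner) (inj_eq (inv_inj starK)) (negPf u_neq_y).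
  have /andP[/negPf -> _] := star_level u2.
  by rewrite starK -/b conj_b subrr mulr0.
have sigma_imag x : pos x -> x != corner -> sigma xi * imag xi x = hf * (t x - conj (t x)).
  move=> px nx; rewrite xi_sigma /imag; case: (x =P y_index) => [->|/eqP ny]; first by rewrite mulr1.
  case: (star x =P x) => [E|ns].
    rewrite mulr0 t_star // E.
    have -> : (half_n - level x = 0)%N by have := level_star x; rewrite E /half_n; have := level_le x; clear; lia.
    by rewrite expr0 mul1r subrr mulr0.
  rewrite /xi off_star star_off // (inj_eq (inv_inj starK)) (negPf ny) starK.
  have -> : pos (star x) = false by apply/negP => ps; case: ns; apply: pos_both.
  have E w : hf * (t y_index - conj (t y_index)) * (si * w) = hf * w.
    by transitivity (hf * ((t y_index - conj (t y_index)) * si) * w); [ring|rewrite hs mulr1].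
  exact: E.
have wE x : pos x -> x != corner -> wcoord xi x = t x /\ wcoordC xi x = conj (t x).
  move=> px nx; rewrite /wcoord /wcoordC sigma_imag // xi_pos //.
  move: (t x) (conj (t x)) => r r'; split.
    by transitivity (2 * hf * r); [ring|rewrite hhf mul1r].
  by transitivity (2 * hf * r'); [ring|rewrite hhf mul1r].
have pE x : ~~ off x -> pcoord xi x = b ^+ half_n * t x.
  rewrite /off negb_or => /andP[n0 n1]; have [px|npx] := boolP (pos x).
    by rewrite pcoord_pos // hb (wE x px n0).1.
  have ps : pos (star x) by have := pos_total x; rewrite (negPf npx).
  have ns : star x != corner by rewrite -(inj_eq (inv_inj starK)) starK.
  rewrite -{1}[x]starK pcoord_star // hb (wE _ ps ns).2 t_star // starK mulrA -exprD subnKC //.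
  by rewrite /half_n; have := pos_level ps; clear; lia.
have [T eT] : exists T, T = c *: act (diag2 p q) y by eexists.
have TE x : T x.1 x.2 = t x by rewrite eT mxE act_diag.
have det_d : \det (diag2 p q) = p * q by rewrite det2E !mxE /=; ring.
have cancel (r : A) : \det (diag2 p q) ^+ 2 * r = 0 -> r = 0.
  by apply: invertible_reg; apply: invertibleX; rewrite det_d; apply: invertibleM.
have Tq0 : q0 T = 0.
  rewrite eT /q0 qsumZ -/(q0 _) [q0 _](cancel _ _) ?mulr0 //.
  by rewrite q0_act // !mxE /= /qform y_q0 y_q2 !(mulr0, mul0r, addr0) ?expr0n /= ?mulr0.
have Tq2 : q2 T = 0.
  rewrite eT /q2 qsumZ -/(q2 _) [q2 _](cancel _ _) ?mulr0 //.
  by rewrite q2_act // !mxE /= /qform y_q0 y_q2 !(mulr0, mul0r, addr0).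
have omegaT l : omega_sum T l = c * (p ^+ (n - l) * q ^+ l * omega_sum y l).
  rewrite !omega_sum_pair !mulr_sumr; apply: eq_bigr => x /eqP <-.
  by rewrite TE /t /torus_coord /Y; ring.
have inv_omega_last : invertible (omega_sum y n.-1).
  suff -> : omega_sum y n.-1 = - conj (omega_sum y 1).
    by apply: invertibleN; apply: invertible_map.
  rewrite !omega_sum_pair rmorph_sum (reindex_inj (inv_inj starK)) -sumrN; apply: eq_big => [x|x _].
    by rewrite level_star; have := level_le x; move: n_gt2; clear; lia.
  rewrite omega_coef_star -conj_y mulNr; congr (- _).
  by rewrite rmorphM /omega_coef rmorphB !rmorph_nat.
have pre_omega l : omega_sum (pre_point xi) l = b ^+ half_n * omega_sum T l.
  rewrite -omega_sumZ; apply: omega_sum_corners => x n0 n1.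
  by rewrite -pcoordE pE ?[RHS]mxE ?TE // /off negb_or n0.
have inv_T1 : invertible (omega_sum T 1).
  by rewrite omegaT; do 3?[apply: invertibleM => //]; apply: invertibleX.
have inv_Tn : invertible (omega_sum T n.-1).
  by rewrite omegaT; do 3?[apply: invertibleM => //]; apply: invertibleX.
have inv_fact : invertible (n`!%:R : A).
  by case: n`! (fact_gt0 n) => // m _; apply: natr_inv.
have inv_bm : invertible (b ^+ half_n) by apply: invertibleX.
have inv_D : invertible (scale_factor xi).
  by rewrite /scale_factor !pre_omega; do 3?[apply: invertibleM => //].
pose s := scale_factor xi * b ^+ half_n; have inv_sc : invertible s by apply: invertibleM.
exists xi, (s * c), p, q; have xi_c : xi corner = 0 by rewrite /xi /off eqxx.
have xi_sc : xi (star corner) = 0 by rewrite /xi /off eqxx orbT.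
split; split => //; first exact: invertibleM.
rewrite -scalerA -eT; apply: corners_unique.
- move=> x n0 n1; rewrite slice_point_off // pE ?[RHS]mxE ?TE ?mulrA //.
  by rewrite /off negb_or n0.
- exact: slice_point_q0.
- exact: slice_point_q2.
- by rewrite /q0 qsumZ -/(q0 _) Tq0 mulr0.
- by rewrite /q2 qsumZ -/(q2 _) Tq2 mulr0.
- move=> r; apply: invertible_reg; rewrite omega_sumZ; do 2?[apply: invertibleM => //].
- move=> r; apply: invertible_reg; rewrite omega_sumZ; do 2?[apply: invertibleM => //].
Qed.

End TorusNormalForm.

(** * Injectivity of the restriction to the slice *)

Section Injectivity.

Local Notation E := {mpoly k[n_free]}.
Local Notation Q := (quad (disc v)).
Local Notation sl := (slice_point var).
Local Notation gen := (quad_gen (disc v)).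

Variables (B : comNzRingType) (toB : {rmorphism Q -> B}) (conj : {rmorphism B -> B}).
Variables (evp evm : {rmorphism Q -> E}).
Hypothesis conjK : involutive conj.
Hypothesis conj_in : forall F, conj (toB (quad_in _ F)) = toB (quad_in _ F).
Hypothesis conj_gen : conj (toB gen) = - toB gen.
Hypothesis evp_in : forall F, evp (quad_in _ F) = slice_eval F.
Hypothesis evm_in : forall F, evm (quad_in _ F) = slice_eval F.
Hypothesis evp_gen : evp gen = q1 sl.
Hypothesis evm_gen : evm gen = - q1 sl.
Hypothesis toB_inj : forall F, toB (quad_in _ F) = 0 -> F = 0.
Hypothesis toB_inv : forall w, evp w != 0 -> evm w != 0 -> invertible (toB w).

Let fB : {rmorphism k -> B} := toB \o (quad_in (disc v) \o @mpolyC _ k).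
Let vQ := map_mx (quad_in (disc v)) v.
(** For the auxiliary vector (1, 1) the frame at the slice point has entries 2 q1 and - 2 q1 on the
    diagonal or the antidiagonal, hence nonzero determinant. *)
Let yQ := normalized vQ gen 1 1.
Let vB := map_mx toB vQ.
Let y := normalized vB (toB gen) 1 1.
Let P : E := 2 * q1 sl.
Let R : E := - 2 * q1 sl.

Let toB_y : map_mx toB yQ = y.
Proof. by rewrite /yQ normalized_map rmorph1. Qed.

Let ev_vQ (ev : {rmorphism Q -> E}) :
  (forall F, ev (quad_in _ F) = slice_eval F) -> map_mx ev vQ = sl.
Proof.
move=> ev_in; rewrite -[RHS](coord_eval_generic (@mpolyC n_free k)).
by apply/matrixP => i j; rewrite /vQ !mxE ev_in.
Qed.

Let evp_y x : evp (yQ x.1 x.2) = P ^+ (n - level x) * R ^+ level x * sl x.1 x.2.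
Proof.
transitivity (map_mx evp yQ x.1 x.2); first by rewrite [RHS]mxE.
rewrite /yQ normalized_map (ev_vQ evp_in) evp_gen rmorph1 /normalized.
rewrite (frame_diag 1 1 (slice_point_q0 _) (slice_point_q2 _)) !mulr1.
exact: act_diag.
Qed.

Let evm_y x : evm (yQ x.1 x.2) = P ^+ level x * R ^+ (n - level x) * sl (star x).1 (star x).2.
Proof.
transitivity (map_mx evm yQ x.1 x.2); first by rewrite [RHS]mxE.
rewrite /yQ normalized_map (ev_vQ evm_in) evm_gen rmorph1 /normalized.
rewrite (frame_anti 1 1 (slice_point_q0 _) (slice_point_q2 _)) !mulr1.
exact: act_anti.
Qed.

Let conj_y x : conj (y x.1 x.2) = y (star x).1 (star x).2.
Proof.
transitivity (map_mx conj y x.1 x.2); first by rewrite [RHS]mxE.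
rewrite /y normalized_map conj_gen rmorph1.
have -> : map_mx conj vB = vB by apply/matrixP => i j; rewrite /vB /vQ !mxE conj_in.
have -> : normalized vB (- toB gen) 1 1 = act (anti2 1 1) (normalized vB (toB gen) 1 1).
  rewrite /normalized act_comp; congr (act _ vB).
  apply/matrixP => i j; rewrite [RHS]mxE sum_I2 !mxE.
  by case: (I2_cases i) => ->; case: (I2_cases j) => -> /=; ring.
by rewrite act_anti !expr1n !mul1r.
Qed.

Let tf m (x : B) : x *+ m.+1 = 0 -> x = 0.
Proof. exact: (torsion_free_via char0 fB). Qed.

Let q1_neq0 : q1 sl != 0 := q1_slice_var_neq0.
Let P_neq0 : P != 0.
Proof. by rewrite mulf_neq0 // natr_mpoly_neq0. Qed.
Let R_neq0 : R != 0.
Proof. by rewrite /R mulNr oppr_eq0. Qed.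

Let inv_det : invertible (\det (frame vB (toB gen) 1 1)).
Proof.
have -> : \det (frame vB (toB gen) 1 1) = toB (\det (frame vQ gen 1 1)).
  by rewrite -det_map_mx frame_map rmorph1.
apply: toB_inv; rewrite -det_map_mx frame_map rmorph1.
  rewrite (ev_vQ evp_in) evp_gen (frame_diag 1 1 (slice_point_q0 _) (slice_point_q2 _)).
  rewrite det2E !mxE /= !mulr1 mulr0 subr0; exact: mulf_neq0.
rewrite (ev_vQ evm_in) evm_gen (frame_anti 1 1 (slice_point_q0 _) (slice_point_q2 _)).
rewrite det2E !mxE /= !mulr1 mulr0 sub0r oppr_eq0; exact: mulf_neq0.
Qed.

Let y_isotropic : q0 y = 0 /\ q2 y = 0.
Proof.
have hs : toB gen ^+ 2 = disc vB.
  rewrite -rmorphXn quad_gen2 /vB /vQ -!disc_map //.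
have cancel (r : B) : \det (frame vB (toB gen) 1 1) ^+ 2 * r = 0 -> r = 0.
  by apply: invertible_reg; apply: invertibleX.
have i0 := frame_isotropic 1 1 0 hs; have i1 := frame_isotropic 1 1 1 hs.
by split; apply: cancel; rewrite ?q0_act ?q2_act // ?i0 ?i1 mulr0.
Qed.

Let slE x : pos x -> x != corner ->
  sl x.1 x.2 = scale_factor var * (beta var ^+ half_n * wcoord var x) /\
  sl (star x).1 (star x).2 = scale_factor var * (beta var ^+ level x * wcoordC var x).
Proof. by move=> px nx; rewrite slice_point_pos // slice_point_star // var_z. Qed.

Let sl_u : sl u_index.1 u_index.2 = scale_factor var * beta var ^+ half_n.+1.
Proof.
have /andP[_ h] := off_corners pos_u u_not_corner.
by rewrite slice_point_off ?u_not_corner ?pcoord_u ?var_star_u //; case/andP: (off_corners pos_u u_not_corner).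
Qed.

Let sl_su : sl (star u_index).1 (star u_index).2 = scale_factor var * beta var ^+ half_n.
Proof.
have /andP[h1 h2] := off_corners pos_u u_not_corner.
rewrite slice_point_off ?pcoord_star_u ?var_z ?var_star_u //.
by rewrite (inj_eq (inv_inj starK)) u_not_corner.
Qed.

Let yE x : y x.1 x.2 = toB (yQ x.1 x.2).
Proof. by rewrite -toB_y [LHS]mxE. Qed.

Let PR_neq0 i j : P ^+ i * R ^+ j != 0.
Proof. by apply: mulf_neq0; apply: expf_neq0. Qed.

Let scale_neq0 m : scale_factor var * beta var ^+ m != 0.
Proof.
by apply: mulf_neq0; [apply: scale_factor_var_neq0|apply: expf_neq0; apply: beta_var_neq0].
Qed.

Let inv_u : invertible (y u_index.1 u_index.2).
Proof.
rewrite yE; apply: toB_inv.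
  by rewrite evp_y sl_u; apply: mulf_neq0.
by rewrite evm_y sl_su; apply: mulf_neq0.
Qed.

Let inv_z : ~~ odd n -> invertible (y z_index.1 z_index.2 + conj (y z_index.1 z_index.2)).
Proof.
move=> o; rewrite conj_y !yE -(rmorphD toB).
have nE : (n - half_n = half_n)%N.
  by have := odd_double_half n; rewrite (negPf o) /half_n; clear; lia.
have [z1 z2] := slE pos_z (andP z_not_corner).1.
have two : 2 != 0 :> E by apply: natr_mpoly_neq0.
have sum_neq0 : sl z_index.1 z_index.2 + sl (star z_index).1 (star z_index).2 != 0.
  rewrite z1 z2 z_level /wcoord /wcoordC var_z.
  have -> (s b i : E) : s * (b * (1 + i)) + s * (b * (1 - i)) = 2 * (s * b) by ring.
  exact: mulf_neq0.
apply: toB_inv; rewrite rmorphD ?evp_y ?evm_y level_star z_level !nE -mulrDr; apply: mulf_neq0 => //.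
by rewrite starK addrC.
Qed.

Let inv_y : invertible (conj (y u_index.1 u_index.2) * y y_index.1 y_index.2 -
  y u_index.1 u_index.2 * conj (y y_index.1 y_index.2)).
Proof.
rewrite !conj_y !yE -!(rmorphM toB) -(rmorphB toB).
have [y1 y2] := slE pos_y y_not_corner.
have two : 2 != 0 :> E by apply: natr_mpoly_neq0.
have bE : beta var ^+ half_n.+1 * beta var ^+ u_level = beta var ^+ half_n * beta var ^+ half_n.
  rewrite -!exprD; apply: (beta_pow var_z) => o; have := u_level_bounds.
  by rewrite /u_level (negPf o) /half_n; move: n_gt2; clear; lia.
have ne : sl (star u_index).1 (star u_index).2 * sl y_index.1 y_index.2 -
    sl u_index.1 u_index.2 * sl (star y_index).1 (star y_index).2 != 0.
  rewrite sl_u sl_su y1 y2 y_level.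
  have -> : wcoord var y_index = var y_index + sigma var by rewrite /wcoord /imag eqxx mulr1.
  have -> : wcoordC var y_index = var y_index - sigma var by rewrite /wcoordC /imag eqxx mulr1.
  have key (s b1 b2 b3 w t : E) : b1 * b2 = b3 * b3 ->
      s * b3 * (s * (b3 * (w + t))) - s * b1 * (s * (b2 * (w - t))) = (s * b3) * (s * b3) * (2 * t).
    move=> h; transitivity (s * s * (b3 * b3 * (w + t) - b1 * b2 * (w - t))); first by ring.
    by rewrite h; ring.
  rewrite (key _ _ _ _ _ _ bE); apply: mulf_neq0; first exact: mulf_neq0.
  by apply: mulf_neq0 => //; apply: sigma_var_neq0.
have key (a b s1 s2 s3 s4 : E) : a * s1 * (b * s2) - b * s3 * (a * s4) = a * b * (s1 * s2 - s3 * s4).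
  by ring.
have lE : (n - (n - u_level) = u_level)%N.
  by rewrite subKn //; have [_] := u_level_bounds; clear; lia.
apply: toB_inv.
  rewrite rmorphB !rmorphM !evp_y !level_star u_indexL y_level !lE key.
  by apply: mulf_neq0 => //; apply: mulf_neq0.
rewrite rmorphB !rmorphM !evm_y !level_star u_indexL y_level !lE !starK key.
apply: mulf_neq0; first exact: mulf_neq0.
by rewrite -oppr_eq0 opprB.
Qed.

Let inv_omega : invertible (omega_sum y 1).
Proof.
rewrite -toB_y -omega_sum_map; apply: toB_inv.
  have -> : evp (omega_sum yQ 1) = P ^+ n.-1 * R ^+ 1 * omega_sum sl 1.
    rewrite !omega_sum_pair rmorph_sum mulr_sumr; apply: eq_bigr => x /eqP lx.
    by rewrite rmorphM /omega_coef rmorphB !rmorph_nat evp_y lx subn1; ring.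
  apply: mulf_neq0 => //; rewrite omega_sum_point (omega_sum_pre1 var) mulrA.
  by apply: mulf_neq0 => //; case: wsum_var_neq0.
have -> : evm (omega_sum yQ 1) = - (P ^+ 1 * R ^+ n.-1 * omega_sum sl n.-1).
  rewrite !omega_sum_pair rmorph_sum mulr_sumr -sumrN [RHS](reindex_inj (inv_inj starK)).
  apply: eq_big => [x|x /eqP lx].
    by rewrite level_star; have := level_le x; move: n_gt2; clear; lia.
  rewrite omega_coef_star rmorphM /omega_coef rmorphB !rmorph_nat evm_y lx subn1; ring.
rewrite oppr_eq0; apply: mulf_neq0 => //; rewrite omega_sum_point (omega_sum_pren var_z) mulrN oppr_eq0 mulrA.
apply: mulf_neq0; last by case: wsum_var_neq0.
by have := scale_neq0 1; rewrite expr1.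
Qed.

(** Over [B] the generic form is carried to a slice point by the frame, the torus and a scalar, each
    multiplying the value of an invariant by a unit. The fourth power of [F] makes [n] times the
    degree even, so that the determinant enters with an integral exponent. *)
Lemma slice_eval_inj_via D F : invariant_forms D F -> slice_eval F = 0 -> F = 0.
Proof.
move=> hF F0; have hG : invariant_forms (4 * D) (F ^+ 4).
  have X m : invariant_forms (m * D) (F ^+ m).
    elim: m => [|m IH]; first exact: invariant_forms1.
    by rewrite exprS mulSn; apply: invariant_formsM.
  exact: X.
have nr m : invertible (m.+1%:R : B).
  rewrite -(rmorph_nat fB); apply: invertible_map; exists (m.+1%:R)^-1.
  by rewrite mulfV // ((pcharf0P k).1 char0).
have [y0 y2] := y_isotropic.
have [xi [c [p [q [[[ci hc] [pi hp] [qi hq] E] [xz xu x0 x1]]]]]] :=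
  torus_normal_form conjK tf nr conj_y y0 y2 inv_u inv_z inv_y inv_omega.
have := slice_eval_specialize fB (F ^+ 4) xz xu x0 x1.
have -> : slice_eval (F ^+ 4) = 0 by rewrite exprS slice_evalM F0 mul0r.
rewrite rmorph0 E (coord_eval_scale _ _ _ hG.1).
move/(invertible_reg (invertibleX _ (ex_intro _ ci hc))).
have hw : (n * (4 * D) = 2 * (2 * (n * D)))%N by clear; lia.
have det_d : \det (diag2 p q) = p * q by rewrite det2E !mxE /=; ring.
have hpq : \det (diag2 p q) * (pi * qi) = 1 by rewrite det_d mulrACA hp hq mulr1.
rewrite (coord_eval_GL2 _ _ hG hw hpq).
move/(invertible_reg (invertibleX _ (ex_intro _ _ hpq))).
have [gi hg] := inv_det.
rewrite /y /normalized (coord_eval_GL2 _ _ hG hw hg).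
move/(invertible_reg (invertibleX _ (ex_intro _ _ hg))).
have -> : coord_eval fB vB (F ^+ 4) = toB (quad_in _ (F ^+ 4)).
  have := coord_eval_comp (@mpolyC _ k) (toB \o quad_in (disc v)) v (F ^+ 4).
  rewrite coord_eval_id => h; apply: esym; apply: etrans h _.
  by rewrite /vB /vQ map_mx_comp.
by move/toB_inj/eqP; rewrite expf_eq0 => /andP[_ /eqP].
Qed.

End Injectivity.


Lemma slice_eval_inj D F : invariant_forms D F -> slice_eval F = 0 -> F = 0.
Proof.
pose iota : {rmorphism coord -> {fraction coord}} := @FracField.tofrac coord.
have iota_inj G : iota G = 0 -> G = 0 by move/eqP; rewrite tofrac_eq0 => /eqP.
have [b eb] : exists b, b = iota (disc v) by eexists.
pose inB : {rmorphism coord -> quad b} := quad_in b \o iota.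
have hB : quad_gen b ^+ 2 = inB (disc v) by rewrite quad_gen2; apply: (congr1 (quad_in b) eb).
have hC : (- quad_gen b) ^+ 2 = quad_in b b by rewrite sqrrN quad_gen2.
have hp : q1 (slice_point var) ^+ 2 = slice_eval (disc v).
  by rewrite disc_slice_point; apply: esym; apply: coord_eval_disc.
have hm : (- q1 (slice_point var)) ^+ 2 = slice_eval (disc v) by rewrite sqrrN.
have conjE (w : quad b) : quad_eval (f := quad_in b) hC w = (w.1, - w.2).
  by case: w => w1 w2; rewrite /quad_eval; congr (_, _) => /=; ring.
apply: (@slice_eval_inj_via _ (quad_eval hB) (quad_eval (f := quad_in b) hC)
  (quad_eval hp) (quad_eval hm)).
- by move=> w; rewrite /= !conjE opprK; case: w.
- by move=> G; rewrite /= !quad_eval_in.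
- by rewrite /= !quad_eval_gen.
- by move=> G; apply: quad_eval_in.
- by move=> G; apply: quad_eval_in.
- exact: quad_eval_gen.
- exact: quad_eval_gen.
- by move=> G; rewrite /= quad_eval_in => /(congr1 fst) /iota_inj.
(* The norm of [w] restricts to the product of its two values on the slice. It is therefore nonzero,
   and the conjugate of [w] divided by it is the inverse. *)
move=> w np nm; pose N := w.1 * w.1 - disc v * (w.2 * w.2).
have nN : iota N != 0.
  apply: contra_neq (mulf_neq0 np nm) => /iota_inj N0.
  transitivity (slice_eval N); last by rewrite N0; apply: rmorph0.
  have -> : slice_eval N = slice_eval w.1 * slice_eval w.1 -
      slice_eval (disc v) * (slice_eval w.2 * slice_eval w.2).
    by rewrite -!slice_evalM; apply: (rmorphB slice_eval).
  rewrite -hp.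
  by rewrite /= /quad_eval; ring.
have iN : iota N = iota w.1 * iota w.1 - b * (iota w.2 * iota w.2).
  by rewrite /N (rmorphB iota) !(rmorphM iota) eb.
have [W [W' [eW hW]]] : exists W W' : quad b, quad_eval hB w = W /\ W * W' = quad_in b (iota N).
  exists (iota w.1, iota w.2), (iota w.1, - iota w.2); split.
    by rewrite /quad_eval; congr (_, _) => /=; ring.
  by rewrite iN; congr (_, _) => /=; ring.
exists (W' * quad_in b (iota N)^-1).
change (quad_eval hB w * (W' * quad_in b (iota N)^-1) = 1).
by rewrite eW mulrA hW -rmorphM mulfV.
Qed.

Lemma rational_dyn : rational (Dyn k d e).
Proof.
have [b [c [hb nc Eb]]] := lifts_denom.
(* The second embedding is [square_var]: the polynomial variable at [sigma_index] stands for
   sigma^2. *)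
apply: (@rational_criterion _ _ _ _ _ slice_eval (square_var sigma_index)
  (denom_weight * base_deg) b).
- exact: square_var_inj.
- by move=> a; apply: etrans (coord_evalC _ _ a) (esym (mmapC _ _ _)).
- by rewrite muln_gt0 /base_deg /denom_weight !muln_gt0.
- exact: hb.
- change (slice_eval b != 0); rewrite Eb; apply: mulf_neq0; first by rewrite mpolyC_eq0.
  by apply: mulf_neq0; do ?apply: expf_neq0; [apply: base_neq0|apply: sigma_var_neq0].
- exact: slice_eval_inj.
- by move=> j F; apply: slice_eval_square.
- by move=> i; apply: lifts_coord_denom nc Eb.
Qed.

End Slice.

Theorem proposition1p4 (k : fieldType) (hk : [pchar k] =i pred0)
  (d e : nat) (hd : (1 <= d)%N) (he : (1 <= e)%N)
  (hde : (d, e) <> (1%N, 1%N)) :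
  rational (Dyn k d e).
Proof.
have n_gt2 : (2 < d + e)%N.
  by rewrite ltnNge; apply/negP => h; apply: hde; congr (_, _); lia.
exact: rational_dyn.
Qed.
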